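(* Let $\mathbf u,\mathbf v\in\ell_2(\vee)$ with $\mathbf u\in\mathcal A(\gamma)$, where $\gamma$ is an admissible growth sequence, let $s>0$ and $\pi^{(\mathrm t,i)}(\mathbf u)\in\mathcal A^s$ for $i=1,\dots,d$, and let $\eta>0$ with $\|\mathbf u-\mathbf v\|\le\eta$. Let $\alpha>0$, $\kappa_{\mathrm P}=\sqrt{2d-3}$ and $\kappa_{\mathrm C}=\sqrt d$. Then for $$\mathbf w_\eta=\hat{\mathrm C}_{\kappa_{\mathrm C}(\kappa_{\mathrm P}+1)(1+\alpha)\eta}\bigl(\hat{\mathrm P}_{\kappa_{\mathrm P}(1+\alpha)\eta}(\mathbf v)\bigr)$$ we have $$\|\mathbf u-\mathbf w_\eta\|\le\bigl(1+\kappa_{\mathrm P}(1+\alpha)+\kappa_{\mathrm C}(\kappa_{\mathrm P}+1)(1+\alpha)\bigr)\eta,$$ as well as $$\operatorname{rank}_\infty(\mathbf w_\eta)\le\gamma^{-1}\bigl(\rho_\gamma\|\mathbf u\|_{\mathcal A(\gamma)}/(\alpha\eta)\bigr),\qquad \|\mathbf w_\eta\|_{\mathcal A(\gamma)}\le C_1\|\mathbf u\|_{\mathcal A(\gamma)},$$ where $C_1=\alpha^{-1}(1+\kappa_{\mathrm P}(1+\alpha))+1$, and $$\sum_{i=1}^d\#\operatorname{supp}(\pi^{(\mathrm t,i)}(\mathbf w_\eta))\le2\,\eta^{-1/s}\,d\,\alpha^{-1/s}\Bigl(\sum_{i=1}^d\|\pi^{(\mathrm t,i)}(\mathbf u)\|_{\mathcal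 A^s}\Bigr)^{1/s},\qquad \sum_{i=1}^d\|\pi^{(\mathrm t,i)}(\mathbf w_\eta)\|_{\mathcal A^s}\le C_2\sum_{i=1}^d\|\pi^{(\mathrm t,i)}(\mathbf u)\|_{\mathcal A^s}$$ with $C_2=2^s(1+2^s)+2^{3s}\alpha^{-1}\bigl(1+\kappa_{\mathrm P}(1+\alpha)+\kappa_{\mathrm C}(\kappa_{\mathrm P}+1)(1+\alpha)\bigr)d^{\max\{1,s\}}$.
   Context: $d\ge2$; $\vee_{\mathrm t},\vee_1$ are countable index sets, $\vee_{\mathrm x}=\vee_1^d$, $\vee=\vee_{\mathrm t}\times\vee_{\mathrm x}$; $\|\cdot\|$ is the $\ell_2$-norm. $\mathrm R_\Lambda\mathbf v$ equals $\mathbf v$ on $\Lambda$ and zero elsewhere. Fix a binary dimension tree $\mathbb T_d$: a collection of subsets of the root $\alpha^*=\{1,\dots,d\}\in\mathbb T_d$ such that each $\alpha\in\mathbb T_d$ with $\#\alpha>1$ has exactly two disjoint children in $\mathbb T_d$ with union $\alpha$, the leaves being $\{1\},\dots,\{d\}$. Effective edges: $\mathbb E_d=\{\{\alpha,\alpha^{\mathsf c}\}:\alpha\in\mathbb T_d\setminus\{\alpha^*\}\}$, with a chosen representer $[e]\in e\cap\mathbb T_d$ for $e\in\mathbb E_d$ ($\#\mathbb E_d=2d-3$). For $\mathbf v\in\ell_2(\vee_{\mathrm x})$, $\operatorname{mat}_\alpha(\mathbf v)$ is the matrix with rows indexed by $\nu_\alpha=(\nu_i)_{i\in\alpha}$ and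 columns by $\nu_{\alpha^{\mathsf c}}$; its singular values are $\sigma_k^\alpha(\mathbf v)$ and its rank is $\operatorname{rank}_\alpha(\mathbf v)$; $\operatorname{rank}(\mathbf v)=(\operatorname{rank}_{[e]}(\mathbf v))_{e\in\mathbb E_d}$. $\mathcal R\subset(\mathbb N_0\cup\{\infty\})^{\mathbb E_d}$ is the set of feasible hierarchical rank vectors, and $\mathcal H(\mathsf r)=\{\mathbf v\in\ell_2(\vee_{\mathrm x}):\operatorname{rank}_{[e]}(\mathbf v)\le r_e\ \forall e\}$. Each $\mathbf v\in\ell_2(\vee)$ is written uniquely as $\mathbf v=\sum_{\nu_{\mathrm t}\in\vee_{\mathrm t}}\mathbf e_{\nu_{\mathrm t}}\otimes\mathbf v_{\nu_{\mathrm t}}$ with Kronecker vectors $\mathbf e_{\nu_{\mathrm t}}$ and $\mathbf v_{\nu_{\mathrm t}}\in\ell_2(\vee_{\mathrm x})$. $\operatorname{rank}_\infty(\mathbf v)=\sup_{\nu_{\mathrm t}}|\operatorname{rank}(\mathbf v_{\nu_{\mathrm t}})|_\infty$, $\operatorname{rank}_\infty((\mathsf r_{\nu_{\mathrm t}}))=\sup_{\nu_{\mathrm t}}|\mathsf r_{\nu_{\mathrm t}}|_\infty$ for $(\mathsf r_{\nu_{\mathrm t}})\in\mathcal R^{\vee_{\mathrm t}}$, and $\mathcal F((\mathsf r_{\nu_{\mathrm t}}))=\{\mathbf v\in\ell_2(\vee):\mathbf v_{\nu_{\mathrm t}}\in\mathcal H(\mathsf r_{\nu_{\mathrm t}})\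 \forall\nu_{\mathrm t}\}$. Recompression: $\lambda((\mathsf r_{\nu_{\mathrm t}});\mathbf v)=\bigl(\sum_{\nu_{\mathrm t}}\sum_{e\in\mathbb E_d}\sum_{k>r_{\nu_{\mathrm t},e}}|\sigma_k^{[e]}(\mathbf v_{\nu_{\mathrm t}})|^2\bigr)^{1/2}$. $\mathsf r(\mathbf v,\eta)\in\mathcal R^{\vee_{\mathrm t}}$ is chosen with minimal $\operatorname{rank}_\infty$ such that $\lambda(\mathsf r(\mathbf v,\eta);\mathbf v)\le\eta$. $\hat{\mathrm P}_\eta(\mathbf v)=\sum_{\nu_{\mathrm t}}\mathbf e_{\nu_{\mathrm t}}\otimes\mathrm P_{\mathbf v_{\nu_{\mathrm t}},\mathsf r_{\nu_{\mathrm t}}}\mathbf v_{\nu_{\mathrm t}}$ with $(\mathsf r_{\nu_{\mathrm t}})=\mathsf r(\mathbf v,\eta)$, where $\mathrm P_{\mathbf w,\mathsf r}\mathbf w$ is the truncation of the hierarchical singular value decomposition (HSVD) of $\mathbf w\in\ell_2(\vee_{\mathrm x})$ to hierarchical rank $\mathsf r$: in the nested representation of $\mathbf w$ whose mode frames for each non-root node $\alpha$ are left singular vectors of $\operatorname{mat}_\alpha(\mathbf w)$, ordered by decreasing singular values, all frame elements with index exceeding the rank bound for $\alpha$ are deleted; it satisfies $\|\mathbf w-\mathrm P_{\mathbf w,\mathsf r}\mathbf w\|^2\le\sum_e\sum_{k>r_e}|\sigma_k^{[e]}(\mathbf w)|^2$. Approximation classes: a growth sequence is a positive strictly increasing $\gamma=(\gamma(n))_{n\in\mathbb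 N_0}$ with $\gamma(0)=1$, $\gamma(n)\to\infty$; it is admissible if $\rho_\gamma=\sup_{n\ge1}\gamma(n)/\gamma(n-1)<\infty$; $\gamma^{-1}:\mathbb R^+\to\mathbb N_0$ is its left-continuous inverse. $\sigma_r(\mathbf v)=\inf\{\|\mathbf v-\mathbf w\|:\mathbf w\in\mathcal F((\mathsf r_{\nu_{\mathrm t}})),\ (\mathsf r_{\nu_{\mathrm t}})\in\mathcal R^{\vee_{\mathrm t}},\ \operatorname{rank}_\infty((\mathsf r_{\nu_{\mathrm t}}))\le r\}$, $\|\mathbf v\|_{\mathcal A(\gamma)}=\sup_{r\in\mathbb N_0}\gamma(r)\sigma_r(\mathbf v)$, $\mathcal A(\gamma)=\{\mathbf v\in\ell_2(\vee):\|\mathbf v\|_{\mathcal A(\gamma)}<\infty\}$. On a countable index set $\hat\vee$, $\|\mathbf v\|_{\mathcal A^s}=\sup_{N\in\mathbb N_0}(N+1)^s\inf_{\#\Lambda\le N}\|\mathbf v-\mathrm R_\Lambda\mathbf v\|$ and $\mathcal A^s=\mathcal A^s(\hat\vee)$ is the set of $\mathbf v\in\ell_2(\hat\vee)$ for which it is finite. Contractions: for $\mathbf w\in\ell_2(\vee_{\mathrm x})$, $\pi^{(i)}_\mu(\mathbf w)=(\sum_{\nu\in\vee_{\mathrm x},\nu_i=\mu}|\mathbf w_\nu|^2)^{1/2}$, $\mu\in\vee_1$; for $\mathbf v\in\ell_2(\vee)$, $\pi^{(\mathrm t,i)}(\mathbf v)=(\pi^{(i)}_\mu(\mathbf v_{\nu_{\mathrm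 t}}))_{(\nu_{\mathrm t},\mu)\in\vee_{\mathrm t}\times\vee_1}$. Coarsening: arrange all values $\pi^{(\mathrm t,i)}_{\nu_{\mathrm t},\mu}(\mathbf v)$ (over all $i,\nu_{\mathrm t},\mu$) in non-increasing order; $\Lambda^{(i)}_{\nu_{\mathrm t}}(\mathbf v,N)$ is the set of those $\mu$ such that $(i,\nu_{\mathrm t},\mu)$ is among the first $N$; $\Lambda(\mathbf v,N)=\bigcup_{\nu_{\mathrm t}}\{\nu_{\mathrm t}\}\times\prod_{i=1}^d\Lambda^{(i)}_{\nu_{\mathrm t}}(\mathbf v,N)$; $\mu_N(\mathbf v)=\bigl(\sum_{\nu_{\mathrm t}}\sum_i\sum_{\mu\in\vee_1\setminus\Lambda^{(i)}_{\nu_{\mathrm t}}(\mathbf v,N)}|\pi^{(\mathrm t,i)}_{\nu_{\mathrm t},\mu}(\mathbf v)|^2\bigr)^{1/2}$; $N(\mathbf v,\eta)=\min\{N:\mu_N(\mathbf v)\le\eta\}$; $\hat{\mathrm C}_\eta(\mathbf v)=\mathrm R_{\Lambda(\mathbf v,N(\mathbf v,\eta))}\mathbf v$. *)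

(* Defs.v *)
From HB Require Import structures.
From mathcomp Require Import all_boot all_order all_algebra.
From mathcomp Require Import all_classical all_reals all_analysis.

Set Implicit Arguments.
Unset Strict Implicit.
Unset Printing Implicit Defensive.

Import Order.TTheory GRing.Theory Num.Theory.
Import numFieldNormedType.Exports.

Local Open Scope classical_set_scope.
Local Open Scope ring_scope.

(* Norms, ranks and approximation-class (quasi-)norms take values in \bar R, so
   that a divergent sum or an infinite rank is +oo and an upper bound on such a
   quantity carries its finiteness. Countable index sets are countTypes, finite
   ones included. *)

Section SequenceSpaces.
Context {R : realType}.
Implicit Types I J : choiceType.

Definition sqnorm I (f : I -> R) : \bar R :=
  (\esum_(i in [set: I]) (f i ^+ 2)%:E)%E.

Definition l2norm I (f : I -> R) : \bar R := sqrte (sqnorm f).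

Definition l2 I : set (I -> R) := [set f | (sqnorm f < +oo)%E].

(* Difference of the sums of the positive and negative parts of f * g; both are
   finite when f and g are in l2. *)
Definition dot I (f g : I -> R) : R :=
  fine (\esum_(i in [set: I]) ((f \* g)^\+ i)%:E)%E
  - fine (\esum_(i in [set: I]) ((f \* g)^\- i)%:E)%E.

Definition restrict0 I (L : set I) (f : I -> R) : I -> R := patch (fun=> 0) L f.

Definition supp I (f : I -> R) : set I := [set i | f i != 0].

Definition As_norm I (s : R) (f : I -> R) : \bar R :=
  ereal_sup (range (fun N : nat =>
    ((N.+1%:R `^ s)%:E *
     ereal_inf [set l2norm (f \- restrict0 L f)%R |
                L in [set L : set I | (L #<= `I_N)%card]])%E)).

Definition As_class I (s : R) : set (I -> R) :=
  [set f | l2 f /\ (As_norm s f < +oo)%E].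

(* Dimension of the column space. *)
Definition lin_indep_cols I J n (M : I -> J -> R) (c : 'I_n -> J) : Prop :=
  forall x : 'I_n -> R,
    (forall i, \sum_(k < n) x k * M i (c k) = 0) -> forall k, x k = 0.

Definition matrix_rank I J (M : I -> J -> R) : \bar R :=
  ereal_sup [set (n%:R)%:E |
    n in [set n | exists c : 'I_n -> J, lin_indep_cols M c]].

(* Singular value decomposition M = \sum_k s_k U_k (V_k)^T, convergent in the
   Hilbert-Schmidt norm. Indices start at 0, so that s k is the (k+1)-st singular
   value. The sequences are infinite: if M has finite rank, s and the singular
   vectors are continued by zero. *)
Record is_svd I J (M : I -> J -> R) (s : nat -> R)
    (U : nat -> I -> R) (V : nat -> J -> R) : Prop := {
  svd_ge0 : forall k, 0 <= s k;
  svd_noninc : nonincreasing_seq s;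
  svd_l2l : forall k, l2 (U k);
  svd_l2r : forall k, l2 (V k);
  svd_orthol : forall k l, dot (U k) (U l) = ((k == l) && (s k != 0))%:R;
  svd_orthor : forall k l, dot (V k) (V l) = ((k == l) && (s k != 0))%:R;
  svd_cvg : l2norm (fun p : I * J =>
      M p.1 p.2 - \sum_(k < n) s k * U k p.1 * V k p.2) @[n --> \oo] --> 0%E
}.

(* The sequence of singular values, which M determines; every square-summable M
   has a singular value decomposition. *)
Definition sing_vals I J (M : I -> J -> R) : nat -> R :=
  xget (fun=> 0) [set s | exists U V, is_svd M s U V].

End SequenceSpaces.

Section DimensionTree.
Variable d : nat.
Implicit Types (T : {set {set 'I_d}}) (a b : {set 'I_d}).

Definition children T a : {set {set 'I_d}} :=
  [set b in T | (b \proper a) &&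
     ~~ [exists c in T, (b \proper c) && (c \proper a)]]%SET.

Definition dimension_tree T : Prop :=
  [/\ [set: 'I_d]%SET \in T,
      (forall a, a \in T -> (1 < #|a|)%N -> exists b c,
         [/\ b != c, children T a = [set b; c]%SET,
             (b :&: c = finset.set0)%SET & (b :|: c = a)%SET]) &
      [set a in T | children T a == finset.set0]%SET
        = [set [set i]%SET | i in 'I_d]%SET].

Definition edge a : {set {set 'I_d}} := [set a; (~: a)]%SET.

Definition edges T : {set {set {set 'I_d}}} :=
  [set edge a | a in T :\ [set: 'I_d]%SET]%SET.

Definition edge_representer T (rep : {set {set 'I_d}} -> {set 'I_d}) : Prop :=
  forall e, e \in edges T -> rep e \in e /\ rep e \in T.

Definition subcoord a := {i : 'I_d | i \in a}.

Definition subcoord_incl a b (h : b \subset a) (i : subcoord b) : subcoord a :=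
  exist _ (val i) (fintype.subsetP h _ (valP i)).

Lemma notin_setC a i : ~ (i \in a) -> i \in (~: a)%SET.
Proof. by move/negP=> h; rewrite inE. Qed.

End DimensionTree.

Arguments subcoord_incl {d a b} h i.

Section HierarchicalTensors.
Context {R : realType} {d : nat} {v1 : countType}.
Implicit Types a b c : {set 'I_d}.
Variables (T : {set {set 'I_d}}) (rep : {set {set 'I_d}} -> {set 'I_d}).

Definition mindex : Type := {ffun 'I_d -> v1}.
Definition pindex (a : {set 'I_d}) : Type := {ffun subcoord a -> v1}.

HB.instance Definition _ := Countable.on mindex.
HB.instance Definition _ a := Countable.on (pindex a).

Definition midx_restr a (nu : mindex) : pindex a := [ffun i => nu (val i)].

Definition pidx_restr a b (h : b \subset a) (nu : pindex a) : pindex b :=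
  [ffun i => nu (subcoord_incl h i)].

Definition midx_glue a (mu : pindex a) (nu : pindex (~: a)%SET) : mindex :=
  [ffun i => match @idP (i \in a) with
             | ReflectT h => mu (exist _ i h)
             | ReflectF h => nu (exist _ i (notin_setC h))
             end].

Definition mat a (w : mindex -> R) : pindex a -> pindex (~: a)%SET -> R :=
  fun mu nu => w (midx_glue mu nu).
Arguments mat a w mu nu : clear implicits.

(* Vectors of hierarchical ranks; only the values on edges T are meaningful. *)
Definition rankvec : Type := {set {set 'I_d}} -> \bar R.

Definition hrank (w : mindex -> R) : rankvec :=
  fun e => matrix_rank (mat (rep e) w).

Definition feasible (r : rankvec) : Prop :=
  exists2 w, l2 w & forall e, e \in edges T -> r e = hrank w e.

Definition Hset (r : rankvec) : set (mindex -> R) :=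
  [set w | l2 w /\ forall e, e \in edges T -> (hrank w e <= r e)%E].

Definition rankmax (r : rankvec) : \bar R := \big[maxe/0%E]_(e in edges T) r e.

(* Mode frames of the HSVD of w. For the two children of the root, which form a
   single edge, the frames are the left and the right singular vectors of one
   decomposition; with unrelated choices inside an eigenspace of a multiple
   singular value the error of the truncation would not be controlled by the sum
   of the discarded singular values over the edges. *)
Definition hsvd_frames (w : mindex -> R)
    (U : forall a, nat -> pindex a -> R) : Prop :=
  (forall a, a \in T -> a != [set: 'I_d]%SET ->
     exists V, is_svd (mat a w) (sing_vals (mat a w)) (U a) V) /\
  (forall a, a \in T -> (~: a)%SET \in T ->
     is_svd (mat a w) (sing_vals (mat a w)) (U a) (U (~: a)%SET)).

(* Sum of F i j over the 0-based indices i < r1 and j < r2. *)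
Definition sum_below (r1 r2 : \bar R) (F : nat -> nat -> R) : R :=
  limn (fun n => \sum_(i < n | ((i%:R)%:E < r1)%E)
                 \sum_(j < n | ((j%:R)%:E < r2)%E) F i j).

(* Transfer coefficients of the nested representation. The frames are
   orthonormal, so the coefficient of U_i (x) U_j is an inner product. *)
Definition transfer (U : forall a, nat -> pindex a -> R) a b c
    (hb : b \subset a) (hc : c \subset a) (k i j : nat) : R :=
  dot (U a k) (fun nu => U b i (pidx_restr hb nu) * U c j (pidx_restr hc nu)).

Definition root_transfer (w : mindex -> R) (U : forall a, nat -> pindex a -> R)
    b c (i j : nat) : R :=
  dot w (fun nu => U b i (midx_restr b nu) * U c j (midx_restr c nu)).

(* W holds the mode frames that the nested representation generates, from the
   leaves to the root, once all frame elements beyond the rank bounds have been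
   deleted; x is the tensor that it then represents. *)
Definition hsvd_truncation (r : rankvec) (w x : mindex -> R) : Prop :=
  exists U W : forall a, nat -> pindex a -> R,
  [/\ hsvd_frames w U,
      (forall a, a \in T -> children T a = finset.set0 ->
         forall k, W a k = U a k),
      (forall a b c (hb : b \subset a) (hc : c \subset a),
         a \in T -> a != [set: 'I_d]%SET -> children T a = [set b; c]%SET ->
         forall k nu, W a k nu = sum_below (r (edge b)) (r (edge c))
           (fun i j => transfer U hb hc k i j
                       * W b i (pidx_restr hb nu) * W c j (pidx_restr hc nu))) &
      (forall b c, children T [set: 'I_d]%SET = [set b; c]%SET ->
         forall nu, x nu = sum_below (r (edge b)) (r (edge c))
           (fun i j => root_transfer w U b c i j
                       * W b i (midx_restr b nu) * W c j (midx_restr c nu)))].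

Definition mode_contraction (i : 'I_d) (w : mindex -> R) (mu : v1) : R :=
  Num.sqrt (fine (\esum_(nu in [set nu : mindex | nu i = mu]) (w nu ^+ 2)%:E)%E).

End HierarchicalTensors.

Arguments mindex : clear implicits.
Arguments pindex {d} v1 a.
Arguments mat {R d v1} a w mu nu.
Arguments feasible {R d} v1 T rep r.

Section SpaceTime.
Context {R : realType} {d : nat} {vt v1 : countType}.
Variables (T : {set {set 'I_d}}) (rep : {set {set 'I_d}} -> {set 'I_d}).

Definition stindex : Type := (vt * mindex d v1)%type.
HB.instance Definition _ := Countable.on stindex.

Definition slice (v : stindex -> R) (t : vt) : mindex d v1 -> R :=
  fun nu => v (t, nu).

Definition rank_sup (r : vt -> @rankvec R d) : \bar R :=
  ereal_sup (range (fun t => rankmax T (r t))).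

Definition rank_infty (v : stindex -> R) : \bar R :=
  rank_sup (fun t => hrank rep (slice v t)).

Definition Fset (r : vt -> @rankvec R d) : set (stindex -> R) :=
  [set v | l2 v /\ forall t, Hset T rep (r t) (slice v t)].

Definition feasible_family (r : vt -> @rankvec R d) : Prop :=
  forall t, feasible v1 T rep (r t).

(* The condition r <= k on the 0-based index k is k + 1 > r. *)
Definition trunc_bound (r : vt -> @rankvec R d) (v : stindex -> R) : \bar R :=
  sqrte (\esum_(t in [set: vt]) \sum_(e in edges T)
    \esum_(k in [set k : nat | (r t e <= (k%:R)%:E)%E])
      (sing_vals (mat (rep e) (slice v t)) k ^+ 2)%:E)%E.

Definition min_rank_family (v : stindex -> R) (eta : R)
    (r : vt -> @rankvec R d) : Prop :=
  [/\ feasible_family r, (trunc_bound r v <= eta%:E)%E &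
      forall r', feasible_family r' -> (trunc_bound r' v <= eta%:E)%E ->
        (rank_sup r <= rank_sup r')%E].

(* x is a value of the recompression of v with tolerance eta, for some choice of
   minimal ranks and of singular vectors. *)
Definition recompression (eta : R) (v x : stindex -> R) : Prop :=
  exists2 r, min_rank_family v eta r &
    forall t, hsvd_truncation T (r t) (slice v t) (slice x t).

Definition st_contraction (i : 'I_d) (v : stindex -> R) : vt * v1 -> R :=
  fun p => mode_contraction i (slice v p.1) p.2.

(* f lists J in the order of non-increasing values of a. An infinite family with
   infinitely many nonzero values leaves no place for indices of value zero, so
   these need not be listed; f is None past the end of a finite list. *)
Record arrangement (J : Type) (a : J -> R) (f : nat -> option J) : Prop := {
  arr_inj : forall m n j, f m = Some j -> f n = Some j -> m = n;
  arr_end : forall m n, (m <= n)%N -> f m = None -> f n = None;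
  arr_noninc : forall m n j k, (m <= n)%N -> f m = Some j -> f n = Some k ->
    a k <= a j;
  arr_all : forall j, a j != 0 -> exists n, f n = Some j
}.

Definition first_set (f : nat -> option ('I_d * vt * v1)) (N : nat)
    (i : 'I_d) (t : vt) : set v1 :=
  [set mu | exists2 n, (n < N)%N & f n = Some (i, t, mu)].

Definition product_set (f : nat -> option ('I_d * vt * v1)) (N : nat)
    : set stindex :=
  [set p : stindex | forall i, first_set f N i p.1 (p.2 i)].

Definition coarse_bound (f : nat -> option ('I_d * vt * v1))
    (v : stindex -> R) (N : nat) : \bar R :=
  sqrte (\esum_(t in [set: vt]) \sum_(i < d)
    \esum_(mu in ~` first_set f N i t) (st_contraction i v (t, mu) ^+ 2)%:E)%E.

(* w is a value of the coarsening of v with tolerance eta, for some arrangement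
   of the contractions (ties may be broken in any way). *)
Definition coarsening (eta : R) (v w : stindex -> R) : Prop :=
  exists f N,
  [/\ arrangement (fun j => st_contraction j.1.1 v (j.1.2, j.2)) f,
      (coarse_bound f v N <= eta%:E)%E,
      (forall M, (coarse_bound f v M <= eta%:E)%E -> (N <= M)%N) &
      w = restrict0 (product_set f N) v].

Definition growth_sequence (g : nat -> R) : Prop :=
  [/\ forall n, 0 < g n, {homo g : m n / (m < n)%N >-> m < n},
      g 0 = 1 & g n @[n --> \oo] --> +oo].

Definition growth_ratio (g : nat -> R) : \bar R :=
  ereal_sup (range (fun n : nat => (g n.+1 / g n)%:E)).

Definition admissible (g : nat -> R) : Prop :=
  growth_sequence g /\ (growth_ratio g < +oo)%E.

(* Left-continuous inverse: the least n with g n >= x. *)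
Definition growth_inv (g : nat -> R) (x : R) : nat :=
  xget 0%N [set n | x <= g n /\ forall m, x <= g m -> (n <= m)%N].

Definition best_error (v : stindex -> R) (r : nat) : \bar R :=
  ereal_inf [set l2norm (v \- w) | w in
    [set w | exists rr, [/\ feasible_family rr,
                            (rank_sup rr <= (r%:R)%:E)%E & Fset rr w]]].

Definition A_norm (g : nat -> R) (v : stindex -> R) : \bar R :=
  ereal_sup (range (fun r : nat => ((g r)%:E * best_error v r)%E)).

Definition Aclass (g : nat -> R) : set (stindex -> R) :=
  [set v | l2 v /\ (A_norm g v < +oo)%E].

End SpaceTime.

Arguments stindex : clear implicits.
Arguments feasible_family {R d vt} v1 T rep r.

(* Main.v *)
(* Two facts about singular values carry the argument. First, Eckart-Young: if N
   has rank at most m, the squared singular values of M beyond the m-th sum to at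
   most |M - N|^2. Second, the recursion defining the HSVD truncation is a product
   of orthogonal projections, parents applied first, and a projection P satisfies
   |w - P y|^2 <= |w - P w|^2 + |w - y|^2; hence the squared error is bounded by the
   discarded squared singular values summed over the 2d - 3 effective edges.
   If u is approximated to an error below alpha eta by a family of ranks at most n,
   Eckart-Young makes these ranks admissible for v at tolerance
   kP (1 + alpha) eta. So the minimal ranks are at most n, and conversely
   gamma(n) alpha eta <= |u| whenever they exceed n, which gives both rank bounds.
   Restriction to a product set neither raises ranks nor increases distances, so
   the coarsening does no harm to them.
   For the supports, comparing with near-best N_i-term approximations of the
   contractions of u with (N_i + 1)^s > |pi_i(u)| / (alpha eta) shows that the number
   N of indices kept satisfies N <= sum_i (|pi_i(u)| / (alpha eta))^(1/s); with the
   error bound this controls the A^s quasi-norms of the contractions of w. *)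
Require Import Defs.
From mathcomp Require Import all_boot all_order all_algebra.
From mathcomp Require Import all_classical all_reals all_analysis.
From mathcomp Require Import ring lra zify.

Set Implicit Arguments.
Unset Strict Implicit.
Unset Printing Implicit Defensive.

Import Order.TTheory GRing.Theory Num.Theory.
Import numFieldNormedType.Exports.

Local Open Scope classical_set_scope.
Local Open Scope ring_scope.


(** * Unconditional sums and the inner product *)

(** The singular value decompositions to which Eckart-Young is applied are read off from the
    recompression itself: its frames supply one of [mat a (slice v t)] at every non-root node [a].
    The order of the bounds matters. The rank bound for the recompression comes before its error
    bound, because it turns the possibly infinite ranks into natural numbers; the truncation formula
    is then a finite sum, and all projections are onto spans of finite families. As singular vectors
    are continued by zero, the members of these families have norm one or zero, which is why every
    orthogonality hypothesis carries a predicate marking the nonzero members. The tolerance of the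
    coarsening is dictated by the comparison with [u]. Off the support of a near-best approximation
    of a contraction of [u], the same contraction of [v'] has norm at most alpha eta + |u - v'|,
    hence at most alpha eta + (1 + kP (1 + alpha)) eta = (kP + 1) (1 + alpha) eta; the [d] modes
    together contribute the factor [kC]. *)

Section UnconditionalSums.
Context {R : realType}.
Implicit Types I J : choiceType.

(** Finite subsums give one inequality; the same inequality for the factor [c^-1] and the scaled
    family gives the other. *)
Lemma esumZl I (A : set I) (c : R) (a : I -> \bar R) :
  0 <= c -> (forall i, A i -> (0 <= a i)%E) ->
  (\esum_(i in A) (c%:E * a i) = c%:E * \esum_(i in A) a i)%E.
Proof.
have le_mul (k : R) (b : I -> \bar R) : 0 < k -> (forall i, A i -> (0 <= b i)%E) ->
    (\esum_(i in A) (k%:E * b i) <= k%:E * \esum_(i in A) b i)%E.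
  move=> k0 b0; apply: ge_ereal_sup => _ [X [finX XA] <-].
  rewrite fsbig_finite//= big_seq -ge0_sume_distrr -?big_seq; last first.
    by move=> i; rewrite in_fset_set// inE => /XA/b0.
  rewrite -fsbig_finite// lee_pmul2l//; apply: ereal_sup_ubound.
  by exists X.
rewrite le_eqVlt => /orP[/eqP<- a0|c0 a0].
  by rewrite mul0e esum1// => i _; rewrite mul0e.
apply/eqP; rewrite eq_le le_mul//=.
have ca0 i : A i -> (0 <= c%:E * a i)%E.
  by move=> Ai; rewrite mule_ge0 ?a0// lee_fin ltW.
have := le_mul c^-1 (fun i => c%:E * a i)%E _ ca0; rewrite invr_gt0 => /(_ c0).
rewrite -(@lee_pmul2l _ c%:E)// muleA -EFinM mulfV ?gt_eqF// mul1e.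
congr (_ <= _)%E; congr (_ * _)%E; apply: eq_esum => i Ai.
by rewrite muleA -EFinM mulVf ?gt_eqF// mul1e.
Qed.

Lemma esum_prod I J (a : I -> J -> \bar R) : (forall i j, (0 <= a i j)%E) ->
  (\esum_(p in [set: I * J]) a p.1 p.2 =
   \esum_(i in [set: I]) \esum_(j in [set: J]) a i j)%E.
Proof.
move=> a0; rewrite esum_esum//; congr esum.
by apply/seteqP; split.
Qed.

Lemma esum_prodC I J (a : I -> J -> \bar R) : (forall i j, (0 <= a i j)%E) ->
  (\esum_(p in [set: I * J]) a p.1 p.2 =
   \esum_(j in [set: J]) \esum_(i in [set: I]) a i j)%E.
Proof.
move=> a0; rewrite -(@esum_prod J I (fun j i => a i j))//.
rewrite (@reindex_esum R _ _ setT setT (fun p : J * I => (p.2, p.1)))//.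
split => //.
- by move=> [? ?] [? ?] _ _ [-> ->].
- by move=> [i j] _; exists (j, i).
Qed.

Lemma le_esum_set I (A B : set I) (a : I -> \bar R) :
  (forall i, B i -> (0 <= a i)%E) -> A `<=` B ->
  (\esum_(i in A) a i <= \esum_(i in B) a i)%E.
Proof.
move=> a0 AB; rewrite (esumID A B a a0) (_ : B `&` A = A).
  by rewrite leeDl// esum_ge0// => i [/a0].
by apply/seteqP; split => [i []//|i Ai]; split => //; exact: AB.
Qed.

Lemma esum_reindex_inj I J (e : I -> J) (a : J -> \bar R) :
  injective e -> (forall j, (0 <= a j)%E) ->
  (\esum_(i in [set: I]) a (e i) <= \esum_(j in [set: J]) a j)%E.
Proof.
move=> inje a0; rewrite -(@esum_image R _ _ setT e a); first exact: le_esum_set.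
by move=> x y _ _; exact: inje.
Qed.

Lemma posnegE I (h : I -> R) i : h^\+ i - h^\- i = h i.
Proof. by rewrite -[in RHS](funrposBneg h). Qed.

Definition abs_summable I (h : I -> R) :=
  (\esum_(i in [set: I]) (`|h i|)%:E < +oo)%E.

(** This is the expression in [dot], isolated from the product, so that [dot f g] unfolds to the
    [usum] of the pointwise product and inherits linearity. *)
Definition usum I (h : I -> R) : R :=
  fine (\esum_(i in [set: I]) (h^\+ i)%:E)%E
  - fine (\esum_(i in [set: I]) (h^\- i)%:E)%E.

Lemma abs_summable_pos I (h : I -> R) : abs_summable h ->
  (\esum_(i in [set: I]) (h^\+ i)%:E)%E \is a fin_num.
Proof.
move=> hs; rewrite ge0_fin_numE; last first.
  by apply: esum_ge0 => i _; rewrite lee_fin funrpos_ge0.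
apply: le_lt_trans hs; apply: le_esum => i _.
by rewrite lee_fin /funrpos ge_max ler_norm normr_ge0.
Qed.

Lemma abs_summable_neg I (h : I -> R) : abs_summable h ->
  (\esum_(i in [set: I]) (h^\- i)%:E)%E \is a fin_num.
Proof.
move=> hs; rewrite ge0_fin_numE; last first.
  by apply: esum_ge0 => i _; rewrite lee_fin funrneg_ge0.
apply: le_lt_trans hs; apply: le_esum => i _.
by rewrite lee_fin /funrneg ge_max -normrN ler_norm normr_ge0.
Qed.

(** From h = p - q follows h^+ + q = h^- + p, and both sides can be summed termwise. Linearity is
    then proved with whatever splitting is convenient, since the positive part of a sum is not the
    sum of the positive parts. *)
Lemma usumE I (h p q : I -> R) :
  (forall i, 0 <= p i) -> (forall i, 0 <= q i) ->
  (\esum_(i in [set: I]) (p i)%:E)%E \is a fin_num ->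
  (\esum_(i in [set: I]) (q i)%:E)%E \is a fin_num ->
  (forall i, h i = p i - q i) ->
  usum h = fine (\esum_(i in [set: I]) (p i)%:E)%E
           - fine (\esum_(i in [set: I]) (q i)%:E)%E.
Proof.
move=> p0 q0 fp fq hE.
have hs : abs_summable h.
  apply: (@le_lt_trans _ _ (\esum_(i in [set: I]) ((p i)%:E + (q i)%:E))%E).
    apply: le_esum => i _; rewrite -EFinD lee_fin hE.
    by rewrite (le_trans (ler_normB _ _))// !ger0_norm.
  rewrite esumD//; [|by move=> i _; rewrite lee_fin..].
  by rewrite lte_add_pinfty// ltey_eq ?fp ?fq.
have fP := abs_summable_pos hs; have fN := abs_summable_neg hs.
have : (\esum_(i in [set: I]) (h^\+ i)%:E + \esum_(i in [set: I]) (q i)%:E =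
        \esum_(i in [set: I]) (h^\- i)%:E + \esum_(i in [set: I]) (p i)%:E)%E.
  rewrite -!esumD; do ?by move=> i _; rewrite lee_fin// ?funrpos_ge0 ?funrneg_ge0.
  apply: eq_esum => i _; rewrite -!EFinD; congr EFin.
  have := posnegE h i; rewrite /= hE; lra.
move=> /(congr1 fine); rewrite !fineD// /usum; lra.
Qed.

Lemma usumD I (h k : I -> R) : abs_summable h -> abs_summable k ->
  usum (fun i => h i + k i) = usum h + usum k.
Proof.
move=> hs ks.
have fP := abs_summable_pos hs; have fN := abs_summable_neg hs.
have fP' := abs_summable_pos ks; have fN' := abs_summable_neg ks.
have e1 : (\esum_(i in [set: I]) (h^\+ i + k^\+ i)%:E =
   \esum_(i in [set: I]) (h^\+ i)%:E + \esum_(i in [set: I]) (k^\+ i)%:E)%E.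
  by rewrite -esumD// => i _; rewrite lee_fin funrpos_ge0.
have e2 : (\esum_(i in [set: I]) (h^\- i + k^\- i)%:E =
   \esum_(i in [set: I]) (h^\- i)%:E + \esum_(i in [set: I]) (k^\- i)%:E)%E.
  by rewrite -esumD// => i _; rewrite lee_fin funrneg_ge0.
rewrite (@usumE _ _ (fun i => h^\+ i + k^\+ i) (fun i => h^\- i + k^\- i)).
- by rewrite e1 e2 !fineD// /usum; lra.
- by move=> i; rewrite addr_ge0// funrpos_ge0.
- by move=> i; rewrite addr_ge0// funrneg_ge0.
- by rewrite e1 fin_numD fP fP'.
- by rewrite e2 fin_numD fN fN'.
- by move=> i; have := posnegE h i; have := posnegE k i => /=; lra.
Qed.

Lemma usumZ I c (h : I -> R) : abs_summable h ->
  usum (fun i => c * h i) = c * usum h.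
Proof.
move=> hs.
have fP := abs_summable_pos hs; have fN := abs_summable_neg hs.
have P0 i : (0 <= (h^\+ i)%:E)%E by rewrite lee_fin funrpos_ge0.
have N0 i : (0 <= (h^\- i)%:E)%E by rewrite lee_fin funrneg_ge0.
have hB i := posnegE h i.
have [c0|c0] := leP 0 c.
  rewrite (@usumE _ _ (fun i => c * h^\+ i) (fun i => c * h^\- i)).
  - by under eq_esum do rewrite EFinM; under [in X in _ - X]eq_esum do rewrite EFinM;
      rewrite !esumZl// !fineM// /usum/= mulrBr.
  - by move=> i; rewrite mulr_ge0// -lee_fin.
  - by move=> i; rewrite mulr_ge0// -lee_fin.
  - by under eq_esum do rewrite EFinM; rewrite esumZl// fin_numM.
  - by under eq_esum do rewrite EFinM; rewrite esumZl// fin_numM.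
  - by move=> i; rewrite -mulrBr; have := hB i => /= ->.
have c0' : 0 <= - c by rewrite oppr_ge0 ltW.
rewrite (@usumE _ _ (fun i => - c * h^\- i) (fun i => - c * h^\+ i)).
- under eq_esum do rewrite EFinM; under [in X in _ - X]eq_esum do rewrite EFinM.
  by rewrite !esumZl// !fineM// /usum/=; lra.
- by move=> i; rewrite mulr_ge0// -lee_fin.
- by move=> i; rewrite mulr_ge0// -lee_fin.
- by under eq_esum do rewrite EFinM; rewrite esumZl// fin_numM.
- by under eq_esum do rewrite EFinM; rewrite esumZl// fin_numM.
- by move=> i; have := hB i => /= <-; lra.
Qed.

Lemma usum_ge0E I (h : I -> R) : (forall i, 0 <= h i) ->
  usum h = fine (\esum_(i in [set: I]) (h i)%:E)%E.
Proof.
move=> h0; rewrite /usum [X in _ - fine X]esum1 ?subr0; last first.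
  by move=> i _; rewrite /funrneg max_r// oppr_le0.
by congr fine; apply: eq_esum => i _; rewrite /funrpos max_l.
Qed.

Lemma usum_reindex I J (e : I -> J) (h : J -> R) :
  set_bij setT setT e -> usum h = usum (h \o e).
Proof.
by move=> be; rewrite /usum; congr (fine _ - fine _);
  rewrite (@reindex_esum R I J setT setT e _ be).
Qed.

Lemma eq_usum I (h k : I -> R) : h =1 k -> usum h = usum k.
Proof. by move=> /funext ->. Qed.

(** The product of the two splittings into positive and negative parts has four non-negative terms,
    and each factorises by summing over one index at a time. *)
Lemma usum_tensor I J (h : I -> R) (k : J -> R) :
  abs_summable h -> abs_summable k ->
  usum (fun p : I * J => h p.1 * k p.2) = usum h * usum k.
Proof.
move=> hs ks.
have hP := abs_summable_pos hs; have hN := abs_summable_neg hs.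
have kP := abs_summable_pos ks; have kN := abs_summable_neg ks.
have hp0 i := funrpos_ge0 h i; have hn0 i := funrneg_ge0 h i.
have kp0 j := funrpos_ge0 k j; have kn0 j := funrneg_ge0 k j.
have tE (a : I -> R) (b : J -> R) : (forall i, 0 <= a i) -> (forall j, 0 <= b j) ->
    (\esum_(i in [set: I]) (a i)%:E)%E \is a fin_num ->
    (\esum_(i in [set: J]) (b i)%:E)%E \is a fin_num ->
    (\esum_(p in [set: I * J]) (a p.1 * b p.2)%:E =
    (fine (\esum_(i in [set: I]) (a i)%:E) *
    fine (\esum_(j in [set: J]) (b j)%:E))%:E)%E.
  move=> a0 b0 fa fb.
  rewrite (@esum_prod I J (fun i j => (a i * b j)%:E)); last first.
    by move=> i j; rewrite lee_fin mulr_ge0.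
  under eq_esum => i _.
    under eq_esum do rewrite EFinM.
    rewrite esumZl//; last by move=> j _; rewrite lee_fin.
    rewrite -(fineK fb) muleC.
    over.
  rewrite esumZl//; [|by rewrite fine_ge0// esum_ge0// => j _; rewrite lee_fin
    |by move=> j _; rewrite lee_fin].
  by rewrite -[X in (_ * X)%E](fineK fa) -EFinM mulrC.
rewrite (@usumE _ _ (fun p => h^\+ p.1 * k^\+ p.2 + h^\- p.1 * k^\- p.2)
                    (fun p => h^\+ p.1 * k^\- p.2 + h^\- p.1 * k^\+ p.2)).
- under eq_esum do rewrite EFinD.
  under [in X in _ - X]eq_esum do rewrite EFinD.
  do 2 (rewrite esumD; [|by move=> i _; rewrite lee_fin mulr_ge0..]).
  by rewrite !tE// -!EFinD /usum/=; lra.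
- by move=> p; rewrite addr_ge0// mulr_ge0.
- by move=> p; rewrite addr_ge0// mulr_ge0.
- under eq_esum do rewrite EFinD.
  rewrite esumD; [|by move=> i _; rewrite lee_fin mulr_ge0..].
  by rewrite !tE.
- under eq_esum do rewrite EFinD.
  rewrite esumD; [|by move=> i _; rewrite lee_fin mulr_ge0..].
  by rewrite !tE.
- by move=> p; rewrite -{1}(posnegE h p.1) -{1}(posnegE k p.2); ring.
Qed.

End UnconditionalSums.

Section InnerProduct.
Context {R : realType}.
Implicit Types I J : choiceType.

Lemma sqnorm_ge0 I (f : I -> R) : (0 <= sqnorm f)%E.
Proof. by apply: esum_ge0 => i _; rewrite lee_fin sqr_ge0. Qed.

Lemma l2norm_ge0 I (f : I -> R) : (0 <= l2norm f)%E.
Proof. exact: sqrte_ge0. Qed.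

Lemma l2_fin I (f : I -> R) : l2 f -> sqnorm f \is a fin_num.
Proof. by move=> fl; rewrite ge0_fin_numE ?sqnorm_ge0. Qed.

Lemma l2_mul_summable I (f g : I -> R) : l2 f -> l2 g ->
  abs_summable (fun i => f i * g i).
Proof.
move=> fl gl.
apply: (@le_lt_trans _ _ (\esum_(i in [set: I]) ((f i ^+ 2)%:E + (g i ^+ 2)%:E))%E).
  apply: le_esum => i _; rewrite -EFinD lee_fin normrM -(real_normK (num_real (f i)))
    -(real_normK (num_real (g i))).
  have := sqr_ge0 (`|f i| - `|g i|); have := sqr_ge0 (`|f i|); have := sqr_ge0 (`|g i|).
  nra.
rewrite esumD; [|by move=> i _; rewrite lee_fin sqr_ge0..].
exact: lte_add_pinfty.
Qed.

Lemma dotE I (f g : I -> R) : dot f g = usum (fun i => f i * g i).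
Proof. by []. Qed.

Lemma dot_selfE I (f : I -> R) : dot f f = fine (sqnorm f).
Proof.
rewrite dotE usum_ge0E; last by move=> i; rewrite -expr2 sqr_ge0.
by congr fine; apply: eq_esum => i _; rewrite expr2.
Qed.

Lemma sqnormE I (f : I -> R) : l2 f -> sqnorm f = (dot f f)%:E.
Proof. by move=> /l2_fin ff; rewrite dot_selfE fineK. Qed.

Lemma dot_ge0 I (f : I -> R) : 0 <= dot f f.
Proof. by rewrite dot_selfE fine_ge0// sqnorm_ge0. Qed.

Lemma l2normE I (f : I -> R) : l2 f -> l2norm f = (Num.sqrt (dot f f))%:E.
Proof. by move=> fl; rewrite /l2norm sqnormE. Qed.

Lemma le_sqnorm I (f g : I -> R) : (forall i, `|f i| <= `|g i|) ->
  (sqnorm f <= sqnorm g)%E.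
Proof.
move=> fg; apply: le_esum => i _.
by rewrite lee_fin -(real_normK (num_real (f i))) -(real_normK (num_real (g i))) lerXn2r ?nnegrE.
Qed.

Lemma eq_sqnorm I (f g : I -> R) : f =1 g -> sqnorm f = sqnorm g.
Proof. by move=> /funext ->. Qed.

Lemma le_l2norm I (f g : I -> R) : (sqnorm f <= sqnorm g)%E ->
  (l2norm f <= l2norm g)%E.
Proof. by rewrite /l2norm lee_sqrt ?sqnorm_ge0. Qed.

Lemma sqnorm0 I : sqnorm (fun _ : I => 0 : R) = 0%E.
Proof. by rewrite /sqnorm esum1// => i _; rewrite expr0n. Qed.

Lemma l20 I : l2 (fun _ : I => 0 : R).
Proof. by rewrite /l2/= sqnorm0. Qed.

Lemma l2D I (f g : I -> R) : l2 f -> l2 g -> l2 (fun i => f i + g i).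
Proof.
move=> fl gl.
apply: (@le_lt_trans _ _ (\esum_(i in [set: I])
    (2%:E * ((f i ^+ 2)%:E + (g i ^+ 2)%:E)))%E).
  apply: le_esum => i _; rewrite -EFinD -EFinM lee_fin.
  by have := sqr_ge0 (f i - g i); nra.
rewrite esumZl//; last by move=> i _; rewrite adde_ge0// lee_fin sqr_ge0.
rewrite esumD; [|by move=> i _; rewrite lee_fin sqr_ge0..].
by rewrite lte_mul_pinfty// lte_add_pinfty.
Qed.

Lemma sqnormZ I c (f : I -> R) : sqnorm (fun i => c * f i) = ((c ^+ 2)%:E * sqnorm f)%E.
Proof.
rewrite /sqnorm -esumZl ?sqr_ge0//; last by move=> i _; rewrite lee_fin sqr_ge0.
by apply: eq_esum => i _; rewrite exprMn EFinM.
Qed.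

Lemma l2Z I c (f : I -> R) : l2 f -> l2 (fun i => c * f i).
Proof.
move=> fl; rewrite /l2/= sqnormZ lte_mul_pinfty// ?lee_fin ?sqr_ge0//.
Qed.

Lemma sqnormN I (f : I -> R) : sqnorm (fun i => - f i) = sqnorm f.
Proof. by apply: eq_esum => i _; rewrite sqrrN. Qed.

Lemma l2B I (f g : I -> R) : l2 f -> l2 g -> l2 (fun i => f i - g i).
Proof. by move=> fl gl; apply: l2D => //; rewrite /l2/= sqnormN. Qed.

Lemma l2_sum I (K : finType) (P : pred K) (e : K -> I -> R) : (forall k, P k -> l2 (e k)) ->
  l2 (fun i => \sum_(k | P k) e k i).
Proof.
move=> el; rewrite (_ : (fun i => _) = \big[(fun f g i => f i + g i)/(fun=> 0)]_(k | P k) e k).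
  elim/big_rec: _ => [|k f Pk fl]; first exact: l20.
  by apply: l2D => //; exact: el.
apply/funext => i; elim/big_rec2: _ => // k x f Pk -> //.
Qed.

Lemma dotC I (f g : I -> R) : dot f g = dot g f.
Proof. by rewrite !dotE; apply: eq_usum => i; rewrite mulrC. Qed.

Lemma dotDl I (f g h : I -> R) : l2 f -> l2 g -> l2 h ->
  dot (fun i => f i + g i) h = dot f h + dot g h.
Proof.
move=> fl gl hl; rewrite !dotE -usumD; [|exact: l2_mul_summable..].
by apply: eq_usum => i; rewrite mulrDl.
Qed.

Lemma dotZl I c (f h : I -> R) : l2 f -> l2 h ->
  dot (fun i => c * f i) h = c * dot f h.
Proof.
move=> fl hl; rewrite !dotE -usumZ; last exact: l2_mul_summable.
by apply: eq_usum => i; rewrite mulrA.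
Qed.

Lemma dotBl I (f g h : I -> R) : l2 f -> l2 g -> l2 h ->
  dot (fun i => f i - g i) h = dot f h - dot g h.
Proof.
move=> fl gl hl; rewrite -[X in _ = _ + X]mulN1r -dotZl// -dotDl//; last exact: l2Z.
by rewrite !dotE; apply: eq_usum => i; rewrite mulN1r.
Qed.

Lemma dot0l I (h : I -> R) : dot (fun=> 0) h = 0.
Proof.
rewrite dotE (@eq_usum _ _ _ (fun=> 0)); last by move=> i; rewrite mul0r.
by rewrite usum_ge0E// esum1.
Qed.

Lemma dot_suml I (K : finType) (P : pred K) (c : K -> R) (e : K -> I -> R) (h : I -> R) :
  (forall k, l2 (e k)) -> l2 h ->
  dot (fun i => \sum_(k | P k) c k * e k i) h = \sum_(k | P k) c k * dot (e k) h.
Proof.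
move=> el hl.
have sE (F : K -> I -> R) : (fun i => \sum_(k | P k) F k i) =
    \big[(fun f g i => f i + g i)/(fun=> 0)]_(k | P k) F k.
  by apply/funext => i; elim/big_rec2: _ => // k x f Pk ->.
rewrite (sE (fun k i => c k * e k i)).
suff : l2 (\big[(fun f g i => f i + g i)/(fun=> 0)]_(k | P k) (fun i => c k * e k i)) /\
  dot (\big[(fun f g i => f i + g i)/(fun=> 0)]_(k | P k) (fun i => c k * e k i)) h =
  \sum_(k | P k) c k * dot (e k) h by case.
elim/big_rec2: _ => [|k x f Pk [fl fE]]; first by split; [exact: l20|rewrite dot0l].
split; first by apply: l2D => //; exact: l2Z.
by rewrite dotDl//; [rewrite dotZl// fE|exact: l2Z].
Qed.

Lemma dot_eq0 I (f : I -> R) : l2 f -> dot f f = 0 -> f = fun=> 0.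
Proof.
move=> fl f0; apply/funext => i; apply/eqP; rewrite -sqrf_eq0 eq_le sqr_ge0 andbT.
rewrite -lee_fin -[X in (_ <= X%:E)%E]f0 -sqnormE//.
rewrite -(@esum_set1 R I i (fun i => (f i ^+ 2)%:E)) ?lee_fin ?sqr_ge0//.
by apply: le_esum_set => // j _; rewrite lee_fin sqr_ge0.
Qed.

(** Needed for the members of norm zero in an orthogonal family: they contribute no coefficient. *)
Lemma dot_self0r I (f g : I -> R) : l2 g -> dot g g = 0 -> dot f g = 0.
Proof. by move=> gl /(dot_eq0 gl) ->; rewrite dotC dot0l. Qed.

Lemma dot_normB I (f g : I -> R) : l2 f -> l2 g ->
  dot (fun i => f i - g i) (fun i => f i - g i) =
  dot f f - 2 * dot f g + dot g g.
Proof.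
move=> fl gl; have bl := l2B fl gl.
rewrite dotBl// ![dot _ (fun i => f i - g i)]dotC !dotBl// (dotC g f).
ring.
Qed.

Lemma dot_normD I (f g : I -> R) : l2 f -> l2 g ->
  dot (fun i => f i + g i) (fun i => f i + g i) =
  dot f f + 2 * dot f g + dot g g.
Proof.
move=> fl gl; have bl := l2D fl gl.
rewrite dotDl// ![dot _ (fun i => f i + g i)]dotC !dotDl// (dotC g f).
ring.
Qed.

Lemma cauchy_schwarz I (f g : I -> R) : l2 f -> l2 g ->
  dot f g ^+ 2 <= dot f f * dot g g.
Proof.
move=> fl gl; have [g0|gN0] := eqVneq (dot g g) 0.
  by rewrite g0 mulr0 (dot_self0r f gl g0) expr0n.
have gp : 0 < dot g g by rewrite lt_neqAle eq_sym gN0 dot_ge0.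
have := dot_ge0 (fun i => f i - (dot f g / dot g g) * g i).
rewrite dot_normB//; last exact: l2Z.
rewrite dotZl//; last exact: l2Z.
rewrite ![dot _ (fun i => _ * g i)]dotC !dotZl// (dotC g f) => h.
have : 0 <= (dot f f - 2 * (dot f g / dot g g * dot f g) +
    dot f g / dot g g * (dot f g / dot g g * dot g g)) * dot g g.
  by rewrite mulr_ge0// ltW.
move=> h'; rewrite -subr_ge0 (le_trans h')// le_eqVlt; apply/orP; left; apply/eqP; field;
  exact: gN0.
Qed.

Lemma l2normD I (f g : I -> R) :
  (l2norm (fun i => f i + g i)%R <= l2norm f + l2norm g)%E.
Proof.
have ninf (h : I -> R) : ~ l2 h -> l2norm h = +oo%E.
  rewrite /l2/= => /negP; rewrite -leNgt leye_eq /l2norm => /eqP -> //.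
have [fl|/ninf ->] := pselect (l2 f); last first.
  by rewrite addye ?leey// gt_eqF// (lt_le_trans _ (l2norm_ge0 g)).
have [gl|/ninf ->] := pselect (l2 g); last first.
  by rewrite addey ?leey// gt_eqF// (lt_le_trans _ (l2norm_ge0 f)).
rewrite !l2normE//; last exact: l2D.
rewrite -EFinD lee_fin -[leRHS]ger0_norm ?addr_ge0 ?sqrtr_ge0// -sqrtr_sqr.
rewrite ler_wsqrtr// dot_normD// sqrrD !sqr_sqrtr ?dot_ge0// lerD2r lerD2l.
rewrite -[leRHS]mulr_natl ler_wpM2l// -sqrtrM ?dot_ge0//.
by rewrite (le_trans (ler_norm _))// -sqrtr_sqr ler_wsqrtr// cauchy_schwarz.
Qed.

Lemma l2norm_sub_trans I (f g h : I -> R) :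
  (l2norm (fun i => f i - h i)%R <=
   l2norm (fun i => f i - g i)%R + l2norm (fun i => g i - h i)%R)%E.
Proof.
apply: le_trans (l2normD _ _); rewrite le_eqVlt; apply/orP; left; apply/eqP.
by congr l2norm; apply/funext => i; ring.
Qed.

Lemma l2norm_subC I (f g : I -> R) :
  l2norm (fun i => f i - g i) = l2norm (fun i => g i - f i).
Proof. by rewrite /l2norm -sqnormN; do 2 f_equal; apply/funext => i; rewrite opprB. Qed.

Lemma l2norm_le_fin I (f : I -> R) (c : R) : 0 <= c ->
  (l2norm f <= c%:E)%E = (sqnorm f <= (c ^+ 2)%:E)%E.
Proof.
move=> c0; rewrite /l2norm -[X in (_ <= X)%E](_ : sqrte (c ^+ 2)%:E = _).
  by rewrite lee_sqrt ?lee_fin ?sqr_ge0.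
by rewrite /= sqrtr_sqr ger0_norm.
Qed.

Lemma l2_comp_inj I J (e : I -> J) (f : J -> R) : injective e -> l2 f -> l2 (f \o e).
Proof.
move=> ei; apply: le_lt_trans.
by apply: (@esum_reindex_inj R _ _ e (fun j => (f j ^+ 2)%:E)) => // j; rewrite lee_fin sqr_ge0.
Qed.

Lemma dot_tensor I J (f f' : I -> R) (g g' : J -> R) :
  l2 f -> l2 f' -> l2 g -> l2 g' ->
  dot (fun p : I * J => f p.1 * g p.2) (fun p => f' p.1 * g' p.2) = dot f f' * dot g g'.
Proof.
move=> fl fl' gl gl'; rewrite !dotE -usum_tensor; [|exact: l2_mul_summable..].
by apply: eq_usum => p; rewrite mulrACA.
Qed.

Lemma sqnorm_prod I J (F : I * J -> R) :
  sqnorm F = (\esum_(j in [set: J]) sqnorm (fun i => F (i, j)))%E.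
Proof.
rewrite /sqnorm -(@esum_prodC R I J (fun i j => (F (i, j) ^+ 2)%:E)).
  by apply: eq_esum => -[].
by move=> i j; rewrite lee_fin sqr_ge0.
Qed.

Lemma sqnorm_prodr I J (F : I * J -> R) :
  sqnorm F = (\esum_(i in [set: I]) sqnorm (fun j => F (i, j)))%E.
Proof.
rewrite /sqnorm -(@esum_prod R I J (fun i j => (F (i, j) ^+ 2)%:E)).
  by apply: eq_esum => -[].
by move=> i j; rewrite lee_fin sqr_ge0.
Qed.

Lemma l2_tensor I J (f : I -> R) (g : J -> R) : l2 f -> l2 g ->
  l2 (fun p : I * J => f p.1 * g p.2).
Proof.
move=> fl gl; rewrite /l2/= sqnorm_prod.
under eq_esum => j _.
  rewrite (_ : (fun i => _) = (fun i => g j * f i)); last by apply/funext => i /=; rewrite mulrC.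
  rewrite sqnormZ sqnormE// muleC; over.
rewrite esumZl ?dot_ge0//; last by move=> i _; rewrite lee_fin sqr_ge0.
by rewrite lte_mul_pinfty// lee_fin dot_ge0.
Qed.

Lemma l2_col I J (F : I * J -> R) j : l2 F -> l2 (fun i => F (i, j)).
Proof. by apply: (@l2_comp_inj I _ (fun i => (i, j))) => x y []. Qed.

Lemma l2_row I J (F : I * J -> R) i : l2 F -> l2 (fun j => F (i, j)).
Proof. by apply: (@l2_comp_inj J _ (fun j => (i, j))) => x y []. Qed.

Lemma l2_dot_col I J (F : I * J -> R) (e : I -> R) : l2 F -> l2 e ->
  l2 (fun j => dot (fun i => F (i, j)) e).
Proof.
move=> Fl el; apply: (@le_lt_trans _ _ ((dot e e)%:E * sqnorm F)%E); last first.
  by rewrite lte_mul_pinfty// lee_fin dot_ge0.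
rewrite sqnorm_prod -esumZl ?dot_ge0//; last by move=> j _; exact: sqnorm_ge0.
apply: le_esum => j _; have cl := l2_col j Fl.
by rewrite sqnormE// -EFinM lee_fin mulrC cauchy_schwarz.
Qed.

End InnerProduct.

(** * Orthogonal families and singular values *)

Section OrthogonalFamily.
Context {R : realType} {I : choiceType} (K : finType).
Variables (e : K -> I -> R) (beta : pred K).
Hypothesis el : forall k, l2 (e k).
Hypothesis orth : forall k l, dot (e k) (e l) = ((k == l) && beta k)%:R.

Lemma l2_comb (b : K -> R) : l2 (fun i => \sum_k b k * e k i).
Proof. by apply: l2_sum => k _; exact: l2Z. Qed.

Lemma dot_comb_self (b : K -> R) :
  dot (fun i => \sum_k b k * e k i) (fun i => \sum_k b k * e k i) =
  \sum_k (beta k)%:R * b k ^+ 2.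
Proof.
rewrite dot_suml//; last exact: l2_comb.
apply: eq_bigr => k _; rewrite dotC dot_suml// (bigD1 k)//= big1 ?addr0.
  by rewrite orth eqxx /=; case: (beta k); rewrite /=; ring.
by move=> l lk; rewrite orth (negbTE lk) mulr0.
Qed.

(** Completing the square in each coefficient. Where [beta k] fails, [e k] has norm zero, so its
    coefficient [dot f (e k)] vanishes and the choice of [b k] is immaterial. Bessel's inequality
    and best approximation are read off from this identity. *)
Lemma dist_comb (f : I -> R) (b : K -> R) : l2 f ->
  dot (fun i => f i - \sum_k b k * e k i) (fun i => f i - \sum_k b k * e k i) =
  dot f f - \sum_k dot f (e k) ^+ 2
  + \sum_k (beta k)%:R * (b k - dot f (e k)) ^+ 2.
Proof.
move=> fl; rewrite dot_normB//; last exact: l2_comb.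
rewrite dot_comb_self dotC dot_suml// mulr_sumr -!(addrA (dot f f)); congr (_ + _).
rewrite -!sumrN -!big_split; apply: eq_bigr => k _ /=.
rewrite dotC; have [bk|bk] := boolP (beta k); first by rewrite /=; ring.
rewrite (@dot_self0r _ _ f (e k))//; first by rewrite /=; ring.
by rewrite orth eqxx (negbTE bk).
Qed.

Lemma bessel (f : I -> R) : l2 f -> \sum_k dot f (e k) ^+ 2 <= dot f f.
Proof.
move=> fl; rewrite -subr_ge0; have := @dist_comb f (fun k => dot f (e k)) fl.
rewrite [X in _ + X]big1 ?addr0; last by move=> k _; rewrite subrr expr0n mulr0.
by move=> <-; exact: dot_ge0.
Qed.

Lemma proj_best (f : I -> R) (b : K -> R) : l2 f ->
  (sqnorm (fun i => f i - \sum_k dot f (e k) * e k i)%R <=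
   sqnorm (fun i => f i - \sum_k b k * e k i)%R)%E.
Proof.
move=> fl; rewrite !sqnormE; [|by apply: l2B => //; exact: l2_comb..].
rewrite lee_fin !dist_comb// lerD2l [leLHS]big1.
  by apply: sumr_ge0 => k _; rewrite mulr_ge0// sqr_ge0.
by move=> k _; rewrite subrr expr0n mulr0.
Qed.

(* An orthogonal projection P satisfies |f - P g|^2 = |f - P f|^2 + |P (f - g)|^2. *)
Lemma proj_pyth (f g : I -> R) : l2 f -> l2 g ->
  (sqnorm (fun i => f i - \sum_k dot g (e k) * e k i)%R <=
   sqnorm (fun i => f i - \sum_k dot f (e k) * e k i)%R
   + sqnorm (fun i => f i - g i)%R)%E.
Proof.
move=> fl gl; have fgl := l2B fl gl.
rewrite !sqnormE//; [|by apply: l2B => //; exact: l2_comb..].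
rewrite -EFinD lee_fin !dist_comb// [X in _ <= _ + X + _]big1 ?addr0; last first.
  by move=> k _; rewrite subrr expr0n mulr0.
rewrite lerD2l; apply: le_trans (bessel fgl); apply: ler_sum => k _.
rewrite dotBl// -[leRHS]mul1r -[X in _ * X <= _]sqrrN opprB ler_wpM2r ?sqr_ge0//.
by case: (beta k).
Qed.

Context {J : choiceType}.

(** The squared norm is the sum over the columns, and projecting is best in each column separately,
    so coefficients that vary with the column are allowed. *)
Lemma col_best (F : I * J -> R) (z : K -> J -> R) : l2 F ->
  (sqnorm (fun p => F p - \sum_k dot (fun i => F (i, p.2)) (e k) * e k p.1)%R <=
   sqnorm (fun p => F p - \sum_k z k p.2 * e k p.1)%R)%E.
Proof.
move=> Fl; rewrite 2!sqnorm_prod; apply: le_esum => j _ /=.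
by apply: proj_best; exact: l2_col.
Qed.

Lemma col_pyth (F G : I * J -> R) : l2 F -> l2 G ->
  (sqnorm (fun p => F p - \sum_k dot (fun i => G (i, p.2)) (e k) * e k p.1)%R <=
   sqnorm (fun p => F p - \sum_k dot (fun i => F (i, p.2)) (e k) * e k p.1)%R
   + sqnorm (fun p => F p - G p)%R)%E.
Proof.
move=> Fl Gl; rewrite 3!sqnorm_prod -esumD; [|by move=> j _; exact: sqnorm_ge0..].
apply: le_esum => j _ /=.
by apply: (@proj_pyth (fun i => F (i, j)) (fun i => G (i, j))); exact: l2_col.
Qed.

End OrthogonalFamily.

Section SingularValues.
Context {R : realType} {I J : choiceType}.
Variables (M : I -> J -> R) (s : nat -> R) (U : nat -> I -> R) (V : nat -> J -> R).
Hypothesis Ml : l2 (fun p : I * J => M p.1 p.2).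
Hypothesis svd : is_svd M s U V.

Let S n (p : I * J) := \sum_(k < n) s k * U k p.1 * V k p.2.

Let ten n (k : 'I_n) (p : I * J) := U k p.1 * V k p.2.

Let ten_l2 n (k : 'I_n) : l2 (ten k).
Proof. exact: l2_tensor (svd_l2l svd k) (svd_l2r svd k). Qed.

Let ten_orth n (k l : 'I_n) : dot (ten k) (ten l) = ((k == l) && (s k != 0))%:R.
Proof.
rewrite /ten dot_tensor; [|exact: svd_l2l svd _|exact: svd_l2l svd _|
  exact: svd_l2r svd _|exact: svd_l2r svd _].
by rewrite (svd_orthol svd) (svd_orthor svd) -natrM mulnb andbb.
Qed.

Lemma svd_sum_l2 n : l2 (S n).
Proof.
rewrite (_ : S n = fun p => \sum_(k < n) s k * ten k p).
  exact: (l2_comb (@ten_l2 n)).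
by apply/funext => p; apply: eq_bigr => k _; rewrite mulrA.
Qed.

Lemma svd_close (eps : R) : 0 < eps ->
  exists N, forall n, (N <= n)%N -> (l2norm (fun p => M p.1 p.2 - S n p)%R <= eps%:E)%E.
Proof.
move=> eps0; have /fine_cvgP[[N1 _ h1] /cvgrPdist_lt/(_ _ eps0)[N2 _ h2]] := svd_cvg svd.
exists (maxn N1 N2) => n; rewrite geq_max => /andP[n1 n2].
have := h2 n n2; rewrite /= sub0r normrN => h3.
rewrite -(fineK (h1 n n1)) lee_fin (le_trans _ (ltW h3))// ler_norm//.
Qed.

(** Insert a partial sum of large order m: the remainder beyond m is arbitrarily small by
    convergence, and the terms from n to m are orthogonal rank-one tensors whose squared norms add
    up to at most the tail. *)
Lemma svd_tail n : (sqnorm (fun p => M p.1 p.2 - S n p)%R <=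
  \esum_(k in [set k | (n <= k)%N]) (s k ^+ 2)%:E)%E.
Proof.
set t := esum _ _; have t0 : (0 <= t)%E by apply: esum_ge0 => k _; rewrite lee_fin sqr_ge0.
rewrite -(lee_sqrt _ t0) -/(l2norm _); apply/lee_addgt0Pr => eps eps0.
have [N hN] := svd_close eps0.
set m := maxn N n; have nm : (n <= m)%N by rewrite leq_maxr.
apply: le_trans (l2norm_sub_trans _ (S m) _) _.
rewrite addeC; apply: leeD; last by apply: hN; rewrite leq_maxl.
rewrite /l2norm lee_sqrt//.
have -> : (fun p => S m p - S n p) =
    fun p => \sum_(k < m) (if (n <= k)%N then s k else 0) * ten k p.
  apply/funext => p; rewrite /S -!(big_mkord xpredT (fun k => s k * U k p.1 * V k p.2)).
  rewrite (big_cat_nat (leq0n n) nm)//= addrAC subrr add0r -(big_mkord xpredT (fun k => (if (n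
    <= k)%N then s k else 0) * (U k p.1 * V k p.2))).
  rewrite [RHS](big_cat_nat (leq0n n) nm)//= [X in _ = X + _](_ : _ = 0) ?add0r; last first.
    rewrite big_nat_cond big1// => k /andP[/andP[_ kn] _].
    by rewrite leqNgt kn mul0r.
  by apply: eq_big_nat => k /andP[nk _]; rewrite nk mulrA.
rewrite sqnormE; last exact: (l2_comb (@ten_l2 m)).
rewrite (dot_comb_self (@ten_l2 m) (@ten_orth m)).
rewrite /t esum_mkcond -nneseries_esumT; last first.
  by move=> k; case: ifP => // _; rewrite lee_fin sqr_ge0.
apply: le_trans (nneseries_lim_ge m _); last first.
  by move=> k _ _; case: ifP => // _; rewrite lee_fin sqr_ge0.
rewrite big_mkord -sumEFin; apply: lee_sum => k _ /=.
rewrite [_ \in _](_ : _ = (n <= k)%N); last by apply/idP/idP; rewrite inE.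
case: ifP => _; last by rewrite expr0n mulr0.
by rewrite lee_fin -[leRHS]mul1r ler_wpM2r ?sqr_ge0//; case: (s k != 0).
Qed.

(** Partial sums with more than k terms have exactly this coefficient, by orthogonality of the left
    vectors, and the Cauchy-Schwarz inequality carries it to the limit. *)
Lemma svd_col k j : dot (fun i => M i j) (U k) = s k * V k j.
Proof.
have Cl : l2 (fun i => M i j) by exact: (l2_col j Ml).
have Ul := svd_l2l svd k.
apply/eqP; rewrite -subr_eq0 -normr_le0; apply/ler_addgt0Pr => eps eps0; rewrite add0r.
have [N hN] := svd_close eps0.
set n := maxn N k.+1; have := hN n (leq_maxl _ _).
rewrite (l2norm_le_fin _ (ltW eps0)) => h.
have Sl : l2 (fun i => S n (i, j)) by exact: (l2_col j (svd_sum_l2 n)).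
have Dl := l2B Cl Sl.
have -> : s k * V k j = dot (fun i => S n (i, j)) (U k).
  rewrite (_ : (fun i => _) = (fun i => \sum_(l < n) (s l * V l j) * U l i)); last first.
    by apply/funext => i; apply: eq_bigr => l _; rewrite /= mulrAC.
  rewrite dot_suml//; last by move=> l; exact: svd_l2l svd l.
  have kn : (k < n)%N by rewrite leq_maxr.
  rewrite (bigD1 (Ordinal kn))//= big1 ?addr0.
    (* If [s k] is zero then [U k] has norm zero, but the right-hand side vanishes as well. *)
    rewrite (svd_orthol svd) eqxx /=; have [->|_] := eqVneq (s k) 0; first by rewrite !mul0r.
    by rewrite mulr1.
  move=> l lk; rewrite (svd_orthol svd) [(l : nat) == k](_ : _ = false) ?mulr0//.
  by apply: contraNF lk => /eqP lk; apply/eqP/val_inj.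
rewrite -dotBl// -(@ler_pXn2r _ 2)// ?nnegrE ?(ltW eps0)//.
rewrite real_normK ?num_real// (le_trans (cauchy_schwarz Dl Ul))//.
rewrite -lee_fin; apply: le_trans h.
apply: (@le_trans _ _ (sqnorm (fun i => M i j - S n (i, j)))).
  rewrite sqnormE// lee_fin -[leRHS]mulr1 ler_wpM2l ?dot_ge0//.
  by rewrite (svd_orthol svd) eqxx; case: (s k != 0).
rewrite sqnorm_prod -(@esum_set1 R J j (fun j => sqnorm (fun i => M i j - S n (i, j)))).
  by apply: le_esum_set => // ? _; exact: sqnorm_ge0.
exact: sqnorm_ge0.
Qed.

End SingularValues.

(** * Matrix rank and the Eckart-Young inequality *)

Section MatrixRank.
Context {R : realType} {I J : choiceType}.
Implicit Types M N : I -> J -> R.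

(** With more than m columns, the matrix of their coordinates in the m factors has a nonzero left
    kernel, and a kernel vector is a linear dependence between the columns. *)
Lemma rank_le_of_factor m M (p : 'I_m -> I -> R) (q : 'I_m -> J -> R) :
  (forall i j, M i j = \sum_k p k i * q k j) -> (matrix_rank M <= (m%:R)%:E)%E.
Proof.
move=> ME; apply: ge_ereal_sup => _ [n [c indep] <-]; rewrite lee_fin ler_nat leqNgt.
apply/negP => mn.
pose A := \matrix_(l < n, k < m) q k (c l).
have : kermx A != 0.
  by rewrite -mxrank_eq0 mxrank_ker -lt0n subn_gt0 (leq_ltn_trans (rank_leq_col A)).
move=> /eqP; apply; apply/matrixP => a l; rewrite [RHS]mxE.
apply: (indep (fun l => kermx A a l)) => i.
under eq_bigr => k _ do rewrite ME mulr_sumr.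
rewrite exchange_big big1//= => k _.
have /matrixP/(_ a k) := mulmx_ker A; rewrite !mxE => kA.
under eq_bigr => l' _ do rewrite mulrCA.
rewrite -mulr_sumr; under eq_bigr => l' _ do rewrite -[q k _](mxE matrix_key (fun l k => q k (c
  l)) l' k).
by rewrite kA mulr0.
Qed.

(** A bounded set of sizes of independent families has a maximum, and it contains 0; hence a finite
    rank is a natural number that some family attains. *)
Lemma rank_dichotomy M : matrix_rank M = +oo%E \/
  exists m, matrix_rank M = (m%:R)%:E /\ exists c : 'I_m -> J, lin_indep_cols M c.
Proof.
pose P n := `[< exists c : 'I_n -> J, lin_indep_cols M c >].
have P0 : P 0%N.
  apply/asboolP; exists (fun i : 'I_0 => False_rect _ (Bool.diff_false_true (ltn_ord i))).
  by move=> x _ [].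
have [[m mP]|unb] := pselect (exists m, forall n, P n -> (n <= m)%N).
  right; have [n Pn nmax] := ex_maxnP (ex_intro P 0%N P0) mP.
  exists n; split; last by apply/asboolP.
  apply/eqP; rewrite eq_le; apply/andP; split.
    by apply: ge_ereal_sup => _ [k kP <-]; rewrite lee_fin ler_nat nmax//; apply/asboolP.
  by apply: ereal_sup_ubound; exists n => //; apply/asboolP.
left; apply: eq_infty => r; have [n Pn rn] : exists2 n, P n & (Num.bound `|r| <= n)%N.
  apply: contrapT => h; apply: unb; exists (Num.bound `|r|) => n Pn.
  by rewrite leqNgt; apply/negP => /ltnW nr; apply: h; exists n.
apply: (@le_trans _ _ (n%:R)%:E).
  rewrite lee_fin (le_trans (ler_norm r))// ltW// (lt_le_trans (archi_boundP (normr_ge0 r)))//.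
  by rewrite ler_nat.
by apply: ereal_sup_ubound; exists n => //; apply/asboolP.
Qed.

Lemma rank_factor M m : (matrix_rank M <= (m%:R)%:E)%E ->
  exists n (c : 'I_n -> J) (a : 'I_n -> J -> R), (n <= m)%N /\
    forall i j, M i j = \sum_k M i (c k) * a k j.
Proof.
have [->//|[n [rM [c indep]]] nm] := rank_dichotomy M.
have dep j : exists a : 'I_n -> R, forall i, M i j = \sum_k M i (c k) * a k.
  pose c' (k : 'I_n.+1) := if unlift ord0 k is Some l then c l else j.
  have /existsNP[x /not_implyP[x0 /existsNP[k0 xk0]]] : ~ lin_indep_cols M c'.
    move=> ind; have : (((n.+1)%:R)%:E <= matrix_rank M :> \bar R)%E.
      by apply: ereal_sup_ubound; exists n.+1 => //; exists c'.
    by rewrite rM lee_fin ler_nat ltnn.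
  have xE i : x ord0 * M i j + \sum_(k < n) x (lift ord0 k) * M i (c k) = 0.
    rewrite -[RHS](x0 i) big_ord_recl /c' unlift_none; congr (_ + _).
    by apply: eq_bigr => k _; rewrite liftK.
  (* In a dependence of the enlarged family the new column has a nonzero coefficient; otherwise the
     dependence would be one of the maximal family [c]. *)
  have [x00|x0N] := eqVneq (x ord0) 0.
    exfalso; apply: xk0; have : forall k, x (lift ord0 k) = 0.
      by apply: indep => i; have := xE i; rewrite x00 mul0r add0r.
    by move=> xl; case: (unliftP ord0 k0) => [k|] ->.
  exists (fun k => - x (lift ord0 k) / x ord0) => i.
  apply: (mulfI x0N); have /eqP := xE i; rewrite addr_eq0 => /eqP ->.
  rewrite mulr_sumr -sumrN; apply: eq_bigr => k _; field; exact: x0N.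
have [a aE] := choice dep.
exists n, c, (fun k j => a j k); split => //.
by rewrite -(ler_nat R) -lee_fin -rM.
Qed.

(** With indicator functions for [chi] and [psi], this is the effect on a matricisation of
    restricting a tensor to a product set. *)
Lemma rank_rescale (chi : I -> R) (psi : J -> R) M N :
  (forall i j, N i j = chi i * psi j * M i j) -> (matrix_rank N <= matrix_rank M)%E.
Proof.
move=> NE; have [->|[m [rM _]]] := rank_dichotomy M; first exact: leey.
have [n [c [a [nm ME]]]] : exists n (c : 'I_n -> J) (a : 'I_n -> J -> R), (n <= m)%N /\
    forall i j, M i j = \sum_k M i (c k) * a k j by apply: rank_factor; rewrite rM.
apply: (@le_trans _ _ (n%:R)%:E); last by rewrite rM lee_fin ler_nat.
apply: (@rank_le_of_factor n N (fun k i => chi i * M i (c k)) (fun k j => psi j * a k j)) => i j.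
by rewrite NE ME mulr_sumr; apply: eq_bigr => k _; ring.
Qed.

End MatrixRank.

Section EckartYoung.
Context {R : realType}.

(** The projection is C^T (C C^T)^-1 C. The Gram matrix is invertible because x C C^T = 0 makes the
    squared norm of x C vanish; cyclicity turns the trace into that of an identity matrix. *)
Lemma row_space_projection k n (C : 'M[R]_(k, n)) : row_free C ->
  exists P : 'M[R]_n, [/\ P^T = P, P *m P = P, C *m P = C & \tr P = k%:R].
Proof.
move=> Cfree; set G := C *m C^T.
have Gu : G \in unitmx.
  rewrite -row_free_unit -kermx_eq0; apply/eqP/row_matrixP => i; rewrite row0.
  set x := row i _; have xG : x *m G = 0 by rewrite /x -row_mul mulmx_ker row0.
  have xC : x *m C = 0.
    have : (x *m C) *m (x *m C)^T = 0 by rewrite trmx_mul mulmxA -(mulmxA x) xG mul0mx.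
    move=> /matrixP/(_ 0 0); rewrite mxE [RHS]mxE => xC0.
    apply/rowP => l; rewrite [RHS]mxE; apply/eqP; rewrite -sqrf_eq0; apply/eqP.
    have := xC0; rewrite (eq_bigr (fun l => (x *m C) 0 l ^+ 2)); last first.
      by move=> ? _; rewrite [_^T _ _]mxE expr2.
    move=> /eqP; rewrite psumr_eq0; last by move=> ? _; rewrite sqr_ge0.
    by move=> /allP/(_ l); rewrite mem_index_enum => /(_ isT)/eqP.
  by apply: (row_free_inj Cfree); rewrite /= xC mul0mx.
have GT : (invmx G)^T = invmx G by rewrite trmx_inv /G trmx_mul trmxK.
exists (C^T *m (invmx G *m C)); split.
- by rewrite trmx_mul trmx_mul trmxK GT mulmxA.
- by rewrite -mulmxA -(mulmxA _ C) (mulmxA C) -/G mulKmx.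
- by rewrite mulmxA -/G mulKVmx.
- by rewrite mxtrace_mulC -mulmxA -/G mulVmx// mxtrace1.
Qed.

Lemma col_space_projection n r (B : 'M[R]_(n, r)) :
  exists P : 'M[R]_n, [/\ P^T = P, P *m P = P, P *m B = B & \tr P <= r%:R].
Proof.
have [P [PT PP CP Ptr]] := row_space_projection (row_base_free B^T).
exists P; split => //; last by rewrite Ptr ler_nat mxrank_tr rank_leq_col.
have /submxP[X BX] : (B^T <= row_base B^T)%MS by rewrite eq_row_base.
by apply: trmx_inj; rewrite trmx_mul PT BX -mulmxA CP.
Qed.

(** The cheapest weights put their total deficit m on the m largest values. Formally, [q k] minus
    the indicator of m <= k is non-negative for k < m and non-positive afterwards, so replacing
    [t k] by [t m] only decreases each term, and the resulting sum is non-negative by the bound on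
    the deficit. *)
Lemma sum_below_weights n m (t q : nat -> R) :
  (forall k l, (k <= l)%N -> t l <= t k) -> (forall k, 0 <= t k) ->
  (forall k, (k < n)%N -> 0 <= q k <= 1) -> \sum_(k < n) (1 - q k) <= m%:R ->
  \sum_(k < n | (m <= k)%N) t k <= \sum_(k < n) t k * q k.
Proof.
move=> tdec t0 q01 qm; have [nm|mn] := leqP n m.
  rewrite big1; last first.
    by move=> k mk; have := leq_trans (ltn_ord k) nm; rewrite ltnNge mk.
  by apply: sumr_ge0 => k _; rewrite mulr_ge0//; have /andP[] := q01 k (ltn_ord k).
rewrite big_mkcond/= -subr_ge0 -sumrB.
apply: (@le_trans _ _ (\sum_(k < n) t m * (q k - (m <= k)%N%:R))); last first.
  apply: ler_sum => k _; have /andP[qk0 qk1] := q01 k (ltn_ord k).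
  have [mk|km] := leqP m k.
    by rewrite mulr1n; have := tdec _ _ mk; nra.
  by rewrite mulr0n !subr0 ler_wpM2r// tdec// ltnW.
rewrite -mulr_sumr mulr_ge0//.
have -> : \sum_(k < n) (q k - (m <= k)%N%:R) = \sum_(k < n) (k < m)%N%:R - \sum_(k < n) (1 - q k).
  by rewrite -sumrB; apply: eq_bigr => k _; rewrite ltnNge; case: (m <= k)%N => /=; ring.
rewrite subr_ge0 (le_trans qm)// -natr_sum ler_nat.
rewrite -(big_mkord xpredT (fun k => (k < m)%N : nat)) (big_cat_nat (leq0n m) (ltnW mn))/=.
rewrite (leq_trans _ (leq_addr _ _))// big_nat_cond (eq_bigr (fun=> 1%N)).
  by rewrite -big_nat_cond sum_nat_const_nat subn0 muln1.
by move=> k /andP[/andP[_ ->]].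
Qed.

Context {I J : choiceType}.
Variables (M N : I -> J -> R) (s : nat -> R) (U : nat -> I -> R) (V : nat -> J -> R).
Hypothesis Ml : l2 (fun p : I * J => M p.1 p.2).
Hypothesis Nl : l2 (fun p : I * J => N p.1 p.2).
Hypothesis svd : is_svd M s U V.

(** Take coordinates with respect to the first n left singular vectors. The columns of [N] land in a
    space of dimension at most r <= m; let Q be the projection onto its orthogonal complement. Since
    Q annihilates them, Bessel's inequality bounds |M - N|^2 below by the sum over columns of |Q
    z|^2, where z has the entries [s k * V k j]. By orthogonality of the right vectors this is the
    sum of [s l ^+ 2 * Q l l], with diagonal entries in [0, 1] and deficit tr P <= m. *)
Lemma eckart_young m : (matrix_rank N <= (m%:R)%:E)%E ->
  (\esum_(k in [set k | (m <= k)%N]) (s k ^+ 2)%:E <=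
   sqnorm (fun p : I * J => M p.1 p.2 - N p.1 p.2)%R)%E.
Proof.
move=> /rank_factor[r [c [a [rm NE]]]].
have MNl := l2B Ml Nl.
suff fin n : ((\sum_(k < n | (m <= k)%N) s k ^+ 2)%:E <=
    sqnorm (fun p : I * J => M p.1 p.2 - N p.1 p.2)%R)%E.
  rewrite esum_mkcond -nneseries_esumT; last first.
    by move=> k; case: ifP => // _; rewrite lee_fin sqr_ge0.
  apply: lime_le; first by apply: is_cvg_nneseries => k _ _; case: ifP => // _;
    rewrite lee_fin sqr_ge0.
  near=> n; apply: le_trans (fin n); rewrite -sumEFin big_mkord [leRHS]big_mkcond/=.
  apply: lee_sum => k _; rewrite [_ \in _](_ : _ = (m <= k)%N)//.
  by apply/idP/idP; rewrite inE.
have el (k : 'I_n) : l2 (U k) := svd_l2l svd k.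
have eorth (k l : 'I_n) : dot (U k) (U l) = ((k == l) && (s k != 0))%:R.
  by rewrite (svd_orthol svd).
have vl (k : 'I_n) : l2 (V k) := svd_l2r svd k.
have vorth (k l : 'I_n) : dot (V k) (V l) = ((k == l) && (s k != 0))%:R.
  by rewrite (svd_orthor svd).
have [P [PT PP PB Ptr]] := col_space_projection (\matrix_(k < n, q < r) dot (fun i => N i (c q))
  (U k)).
pose Q : 'M[R]_n := 1%:M - P.
have QT : Q^T = Q by rewrite /Q linearB/= trmx1 PT.
have QQ : Q *m Q = Q.
  by rewrite /Q mulmxBl !mulmxBr !mul1mx !mulmx1 PP subrr subr0.
have Qd k : Q k k = 1 - P k k by rewrite /Q !mxE eqxx mulr1n.
have diagE (A : 'M[R]_n) k : A^T = A -> A *m A = A -> A k k = \sum_l A l k ^+ 2.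
  move=> AT AA; rewrite -{1}AA mxE; apply: eq_bigr => l _.
  by rewrite -{1}AT mxE expr2.
have diag0 (A : 'M[R]_n) k : A^T = A -> A *m A = A -> 0 <= A k k.
  by move=> AT AA; rewrite diagE// sumr_ge0// => l _; rewrite sqr_ge0.
apply: (@le_trans _ _ (\sum_(l < n) s l ^+ 2 * Q l l)%:E).
  rewrite lee_fin.
  (* The diagonal of Q, continued by zero, as the weights are functions on all natural numbers. *)
  pose q k := if (insub k : option 'I_n) is Some l then Q l l else 0.
  have qE (l : 'I_n) : q l = Q l l by rewrite /q valK.
  under [leRHS]eq_bigr do rewrite -qE.
  apply: (@sum_below_weights n m (fun k => s k ^+ 2)).
  - by move=> k l kl; rewrite lerXn2r ?nnegrE ?(svd_ge0 svd)//; exact: svd_noninc svd _ _ kl.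
  - by move=> k; rewrite sqr_ge0.
  - move=> k kn; rewrite -[k]/(nat_of_ord (Ordinal kn)) qE diag0//= -subr_ge0.
    have := diag0 P (Ordinal kn) PT PP; by rewrite Qd opprB addrC subrK.
  - under eq_bigr do rewrite qE.
    apply: le_trans (_ : r%:R <= _); last by rewrite ler_nat.
    apply: le_trans Ptr; rewrite /mxtrace le_eqVlt; apply/orP; left; apply/eqP.
    by apply: eq_bigr => k _; rewrite Qd opprB addrC subrK.
have -> : (\sum_(l < n) s l ^+ 2 * Q l l)%:E =
    (\sum_(k < n) sqnorm (fun j => \sum_(l < n) (Q k l * s l) * V l j)%R)%E.
  under [RHS]eq_bigr => k _.
    rewrite sqnormE; last exact: (l2_comb vl).
    rewrite (dot_comb_self vl vorth); over.
  rewrite sumEFin; congr EFin; rewrite exchange_big; apply: eq_bigr => l _.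
  rewrite diagE// mulr_sumr; apply: eq_bigr => k _.
  by have [->|_] := eqVneq (s l) 0; rewrite /= ?mul1r; ring.
rewrite sqnorm_prod /sqnorm -esum_sum; last by move=> *; rewrite lee_fin sqr_ge0.
apply: le_esum => j _.
have Cl := l2_col j MNl.
rewrite -/(sqnorm (fun i => M i j - N i j)) (sqnormE Cl) sumEFin lee_fin.
apply: le_trans (bessel el eorth Cl).
have Mc : l2 (fun i => M i j) := l2_col j Ml.
have Nc : l2 (fun i => N i j) := l2_col j Nl.
pose z : 'cV[R]_n := \col_k (s k * V k j).
pose y : 'cV[R]_n := \col_k dot (fun i => N i j) (U k).
have zyE (k : 'I_n) : dot (fun i => M i j - N i j) (U k) = (z - y) k 0.
  by rewrite dotBl// !mxE (svd_col Ml svd).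
have Qy : Q *m y = 0.
  have -> : y = (\matrix_(k < n, q < r) dot (fun i => N i (c q)) (U k)) *m (\col_q a q j).
    apply/colP => k; rewrite !mxE.
    rewrite (_ : (fun i => N i j) = (fun i => \sum_q a q j * N i (c q))); last first.
      by apply/funext => i; rewrite NE; apply: eq_bigr => q _; rewrite mulrC.
    rewrite dot_suml//; last by move=> q; exact: (l2_col (c q) Nl).
    by apply: eq_bigr => q _; rewrite !mxE mulrC.
  by rewrite mulmxA /Q mulmxBl mul1mx PB subrr mul0mx.
under eq_bigr => k _.
  rewrite (_ : \sum_(l < n) _ = (Q *m (z - y)) k 0); last first.
    rewrite mulmxBr Qy subr0 mxE; apply: eq_bigr => l _.
    by rewrite !mxE mulrA.
  over.
under [leRHS]eq_bigr => k _ do rewrite zyE.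
move: (z - y) => x.
have nrm (u : 'cV[R]_n) : \sum_k u k 0 ^+ 2 = (u^T *m u) 0 0.
  by rewrite mxE; apply: eq_bigr => k _; rewrite mxE expr2.
rewrite !nrm -subr_ge0.
(* x = P x + Q x is an orthogonal splitting, so |x|^2 - |Q x|^2 = |P x|^2. *)
have -> : (x^T *m x) 0 0 - ((Q *m x)^T *m (Q *m x)) 0 0 = ((P *m x)^T *m (P *m x)) 0 0.
  rewrite !trmx_mul QT PT !mulmxA -!(mulmxA x^T) QQ PP /Q.
  have subK1 (A A' : 'M[R]_1) : A 0 0 - (A - A') 0 0 = A' 0 0 by rewrite !mxE; ring.
  by rewrite mulmxBl mul1mx mulmxBr subK1.
by rewrite -nrm sumr_ge0// => k _; rewrite sqr_ge0.
Unshelve. all: by end_near.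
Qed.

End EckartYoung.

(** * Dimension trees *)

Section DimensionTrees.
Variables (d : nat) (T : {set {set 'I_d}}).
Implicit Types a b c x y : {set 'I_d}.
Hypothesis hT : dimension_tree T.
Local Open Scope set_scope.

Definition descendants a : {set {set 'I_d}} := [set x in T | x \proper a].

Lemma root_in_tree : [set: 'I_d] \in T.
Proof. by case: hT. Qed.

Lemma in_children a b : b \in children T a -> b \in T /\ b \proper a.
Proof. by rewrite inE => /and3P[]. Qed.

Lemma leaf_card a : a \in T -> children T a = finset.set0 -> #|a| = 1%N.
Proof.
move=> aT a0; have : a \in [set a in T | children T a == finset.set0] by rewrite inE aT a0 eqxx.
by case: hT => _ _ ->; case/imsetP => i _ ->; rewrite cards1.
Qed.

(** An empty member has no proper subset, hence no children, and would be a leaf; but leaves are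
    singletons. *)
Lemma tree_card_gt0 a : a \in T -> (0 < #|a|)%N.
Proof.
move=> aT; rewrite lt0n cards_eq0; apply/eqP => a0.
have : #|a| = 1%N.
  apply: leaf_card => //; apply/finset.setP => x; rewrite a0 !inE properE finset.subset0.
  by case: eqP => [->|]; rewrite ?finset.sub0set !andbF.
by rewrite a0 cards0.
Qed.

Lemma tree_cases a : a \in T ->
  children T a = finset.set0 \/
  exists b c, [/\ b != c, children T a = [set b; c],
                  b :&: c = finset.set0 & b :|: c = a].
Proof.
move=> aT; have [->|aN0] := eqVneq (children T a) finset.set0; first by left.
right; case: hT => _ h hl; apply: h => //.
rewrite ltn_neqAle eq_sym tree_card_gt0// andbT; apply: contra aN0 => /cards1P[i ai].
have : a \in [set [set i] | i in 'I_d] by rewrite ai imset_f.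
by rewrite -hl inE => /andP[].
Qed.

(** A largest member of the tree containing x and properly contained in a admits no member in
    between, so it is a child. Dually, a smallest proper superset is a parent. *)
Lemma sub_child a x : a \in T -> x \in T -> x \proper a ->
  exists2 b, b \in children T a & x \subset b.
Proof.
move=> aT xT xa.
pose P b := [&& b \in T, x \subset b & b \proper a].
have Px : P x by rewrite /P xT subxx.
case: (@arg_maxnP _ x P (fun b => #|b|) Px) => b /and3P[bT xb ba] bmax.
exists b => //; rewrite inE bT ba /=; apply/existsP => -[c /and3P[cT bc ca]].
have := bmax c; rewrite /P cT ca (fintype.subset_trans xb (proper_sub bc)) => /(_ isT).
by rewrite /= leqNgt proper_card.
Qed.

Lemma parent_exists a : a \in T -> a != [set: 'I_d] ->
  exists2 p, p \in T & a \in children T p.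
Proof.
move=> aT aN; pose P p := (p \in T) && (a \proper p).
have PT : P [set: 'I_d] by rewrite /P root_in_tree finset.properEneq aN finset.subsetT.
case: (@arg_minnP _ _ P (fun b => #|b|) PT) => p /andP[pT ap] pmin.
exists p => //; rewrite inE aT ap /=; apply/existsP => -[c /and3P[cT ac cp]].
have := pmin c; rewrite /P cT ac => /(_ isT).
by rewrite /= leqNgt proper_card.
Qed.

Section Branching.
Variables a b c : {set 'I_d}.
Hypotheses (aT : a \in T) (ch : children T a = [set b; c])
  (bIc : b :&: c = finset.set0).

Lemma children_tree : [/\ b \in T, c \in T, b \proper a & c \proper a].
Proof.
have [bT ba] : b \in T /\ b \proper a by apply: in_children; rewrite ch !inE eqxx.
have [cT ca] : c \in T /\ c \proper a by apply: in_children; rewrite ch !inE eqxx orbT.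
by [].
Qed.

Lemma sub_both x : x \in T -> x \subset b -> x \subset c -> False.
Proof.
move=> xT xb xc; have := tree_card_gt0 xT.
have : x \subset b :&: c by rewrite finset.subsetI xb xc.
by rewrite bIc finset.subset0 => /eqP ->; rewrite cards0.
Qed.

(** Members are nonempty and the children disjoint, so each descendant lies below exactly one child.
    The monoid is arbitrary because both the number of edges and the truncation error are computed
    this way. *)
Lemma big_descendants (S : Type) (idx : S) (op : Monoid.com_law idx) (F : {set 'I_d} -> S) :
  \big[op/idx]_(x in descendants a) F x =
  op (op (F b) (\big[op/idx]_(x in descendants b) F x))
     (op (F c) (\big[op/idx]_(x in descendants c) F x)).
Proof.
have [bT cT ba ca] := children_tree.
rewrite (bigID (fun x => x \subset b))/= (bigD1 b)/=; last by rewrite inE bT ba subxx.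
rewrite [X in op _ X](bigD1 c)/=; last first.
  rewrite inE cT ca; apply/negP => cb; exact: (sub_both cT cb (subxx c)).
congr (op (op _ _) (op _ _)); apply: eq_bigl => x.
  rewrite !inE; case xT: (x \in T) => //=.
  rewrite [x \proper b]finset.properEneq [RHS]andbC; case xb: (x \subset b);
    rewrite ?andbF//= andbT.
  by rewrite (sub_proper_trans xb ba).
rewrite !inE; case xT: (x \in T) => //=; apply/idP/idP.
  move=> /andP[/andP[xa xb] xc]; rewrite finset.properEneq xc /=.
  have [z] := sub_child aT xT xa; rewrite ch !inE => /orP[] /eqP -> //.
  by move=> xb'; rewrite xb' in xb.
move=> xc; rewrite (proper_trans xc ca) (proper_neq xc) andbT /=.
by apply/negP => xb; apply: (sub_both xT xb (proper_sub xc)).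
Qed.

End Branching.

(** A full binary tree with [#|a|] leaves has 2 [#|a|] - 1 nodes, one of which is its root; the form
    with + 2 avoids truncated subtraction. *)
Lemma card_descendants a : a \in T -> (#|descendants a| + 2 = 2 * #|a|)%N.
Proof.
elim: {a}_.+1 {-2}a (ltnSn #|a|) => // n IHn a; rewrite ltnS => an aT.
have [a0|[b [c [bc ch bIc bUc]]]] := tree_cases aT.
  rewrite (leaf_card aT a0); suff -> : descendants a = finset.set0 by rewrite cards0.
  apply/finset.setP => x; rewrite !inE; apply/negP => /andP[xT xa].
  by have [b] := sub_child aT xT xa; rewrite a0 inE.
have [bT cT ba ca] := children_tree ch.
have cb := IHn b (leq_trans (proper_card ba) an) bT.
have cc := IHn c (leq_trans (proper_card ca) an) cT.
have : #|a| = (#|b| + #|c|)%N by rewrite -bUc cardsU bIc cards0 subn0.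
move=> ->; rewrite -sum1_card (big_descendants aT ch bIc) !sum1_card.
by move: cb cc => /=; lia.
Qed.

Variable rep : {set {set 'I_d}} -> {set 'I_d}.
Hypothesis hrep : edge_representer T rep.
Hypothesis hd : (2 <= d)%N.

Lemma edgeC a : edge (~: a) = edge a.
Proof. by apply/finset.setP => x; rewrite !inE finset.setCK orbC. Qed.

Lemma edge_in a : a \in T -> a != [set: 'I_d] -> edge a \in edges T.
Proof. by move=> aT aN; apply: imset_f; rewrite !inE aN. Qed.

Lemma rep_edge a : a \in T -> a != [set: 'I_d] ->
  (rep (edge a) = a \/ rep (edge a) = ~: a) /\ rep (edge a) \in T.
Proof.
move=> aT aN; have [re reT] := hrep (edge_in aT aN); split => //.
by move: re; rewrite !inE => /orP[] /eqP ->; [left|right].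
Qed.

Lemma edge_rep e : e \in edges T -> edge (rep e) = e.
Proof.
move=> eT; have [re _] := hrep eT; move: eT re => /imsetP[a _ ->].
by rewrite !inE => /orP[] /eqP ->; rewrite ?edgeC.
Qed.

Lemma rep_not_root e : e \in edges T -> rep e != [set: 'I_d].
Proof.
move=> eT; have [re reT] := hrep eT; move: eT re reT => /imsetP[a].
rewrite !inE => /andP[aN aT] ->; rewrite !inE => /orP[] /eqP -> // _; apply/eqP => aC;
  have := tree_card_gt0 aT.
by rewrite -(finset.setCK a) aC finset.setCT cards0.
Qed.

(** The children of the root are complementary and share one edge; [b] is taken to be the one that
    represents it. *)
Lemma root_children : exists b, [/\ children T [set: 'I_d] = [set b; ~: b],
  rep (edge b) = b, b != ~: b, b \in T & ~: b \in T].
Proof.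
have [r0|[b [c [bc ch bIc bUc]]]] := tree_cases root_in_tree.
  have := leaf_card root_in_tree r0; rewrite cardsT card_ord => /eqP.
  by rewrite gtn_eqF.
have [bT cT ba ca] := children_tree ch.
have cE : c = ~: b.
  apply/finset.setP => i; have /finset.setP/(_ i) := bIc; have /finset.setP/(_ i) := bUc.
  by rewrite !inE; case: (i \in b); case: (i \in c).
have bN : b != [set: 'I_d] by rewrite proper_neq.
have [[rb|rc] reT] := rep_edge bT bN.
  by exists b; rewrite -cE; split.
exists c; have bE : b = ~: c by rewrite cE finset.setCK.
rewrite -bE; split => //; last by rewrite eq_sym.
  by rewrite ch finset.setUC.
by rewrite bE edgeC finset.setCK in rc.
Qed.

Section Edges.
Variable b : {set 'I_d}.
Hypotheses (ch : children T [set: 'I_d] = [set b; ~: b]) (rb : rep (edge b) = b).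
Hypothesis bN : b != ~: b.

Let bI : b :&: ~: b = finset.set0. Proof. exact: finset.setICr. Qed.

Let A := [set x in descendants [set: 'I_d] | x != ~: b].

Let in_A x : x \in A -> [/\ x \in T, x != [set: 'I_d] & (x \subset b) || (x \proper ~: b)].
Proof.
rewrite !inE => /andP[/andP[xT xa] xN]; split => //; first by rewrite proper_neq.
have [z] := sub_child root_in_tree xT xa; rewrite ch !inE => /orP[] /eqP -> xz.
  by rewrite xz.
by rewrite finset.properEneq xN xz orbT.
Qed.

Let nb : ~ b \subset ~: b.
Proof.
have [bT cT _ _] := children_tree ch.
by move=> h; exact: (sub_both bI bT (subxx b) h).
Qed.

Let nc : ~ ~: b \subset b.
Proof.
have [bT cT _ _] := children_tree ch.
by move=> h; exact: (sub_both bI cT h (subxx _)).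
Qed.

(** Makes [edge] injective on [A], which holds one node per edge. Complements reverse inclusion:
    that of a member below [b] contains [~: b], and that of a member strictly below [~: b] strictly
    contains [b], so neither lies in [A]. *)
Let A_compl x y : x \in A -> y \in A -> y <> ~: x.
Proof.
move=> /in_A[xT xN xs] /in_A[yT yN ys] yx; subst y.
case/orP: xs => [xb|xc].
  have cb : ~: b \subset ~: x by rewrite finset.setCS.
  case/orP: ys => [h|h]; first exact: nc (fintype.subset_trans cb h).
  by have := sub_proper_trans cb h; rewrite fintype.properxx.
have bx : b \proper ~: x by rewrite -finset.properC finset.setCK.
case/orP: ys => [h|h]; first by have := proper_sub_trans bx h; rewrite fintype.properxx.
exact: nb (fintype.subset_trans (proper_sub bx) (proper_sub h)).
Qed.

Lemma big_edges (S : Type) (idx : S) (op : Monoid.com_law idx) (F : {set 'I_d} -> S) :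
  \big[op/idx]_(e in edges T) F (rep e) =
  op (op (F b) (\big[op/idx]_(x in descendants b) F x))
     (\big[op/idx]_(x in descendants (~: b)) F x).
Proof.
have [bT cT ba ca] := children_tree ch.
have bNT : b != [set: 'I_d] by rewrite proper_neq.
have edgesE : edges T = [set edge x | x in A].
  apply/finset.setP => e; apply/imsetP/imsetP => -[x]; rewrite !inE.
    move=> /andP[xN xT] ->; have [->|xb] := eqVneq x (~: b).
      by exists b; rewrite ?edgeC// !inE bT ba.
    by exists x => //; rewrite !inE xT finset.properEneq xN finset.subsetT.
  by move=> /andP[/andP[xT xa] xb] ->; exists x => //; rewrite !inE xT proper_neq.
rewrite edgesE big_imset/=; last first.
  move=> x y xA yA exy.
  have : y \in edge x by rewrite exy !inE eqxx.
  by rewrite !inE => /orP[] /eqP // yx; have := A_compl xA yA yx.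
rewrite (eq_bigr F); last first.
  move=> x xA; congr F; have [xT xN xs] := in_A xA.
  (* A representer other than x would be its complement, again a member of [A] unless x = b; for b
     the representer is fixed by [rb]. *)
  have [[//|rx] rT] := rep_edge xT xN; have [xb|xb] := eqVneq x b; first by rewrite xb.
  exfalso; apply: (A_compl xA _ rx); rewrite !inE rT.
  rewrite finset.properEneq rx finset.subsetT andbT; apply/andP; split.
    apply/eqP => aC; have := tree_card_gt0 xT.
    by rewrite -(finset.setCK x) aC finset.setCT cards0.
  by apply: contra xb => /eqP/(congr1 (@finset.setC _)); rewrite !finset.setCK => ->.
have := big_descendants root_in_tree ch bI op (fun x => if x == ~: b then idx else F x).
rewrite eqxx (negbTE bN) Monoid.mul1m.
have same x y : x \in descendants y -> y = b \/ y = ~: b -> (x == ~: b) = false.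
  rewrite inE => /andP[xT xy] yb; apply/negbTE/eqP => xE; subst x.
  case: yb => yE; subst y; last by rewrite fintype.properxx in xy.
  exact: nc (proper_sub xy).
rewrite [in X in _ = op _ X](eq_bigr F); last by move=> x xd; rewrite (same _ _ xd)//; right.
rewrite [in X in _ = op X _](eq_bigr F); last by move=> x xd; rewrite (same _ _ xd)//; left.
move=> <-; rewrite big_mkcond/= [RHS]big_mkcond/=; apply: eq_bigr => x _.
by rewrite inE; case: (x \in descendants _) => //=; case: (x == _).
Qed.

End Edges.

(** 1 + (2 [#|b|] - 2) + (2 [#|~: b|] - 2) = 2d - 3, the shared root edge being counted once. *)
Lemma card_edges : (#|edges T| + 3 = 2 * d)%N.
Proof.
have [b [ch rb bN bT cT]] := root_children.
rewrite -sum1_card (big_edges ch rb bN _ (fun=> 1%N)) /= !sum1_card.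
have := card_descendants bT; have := card_descendants cT; have := cardsC b.
rewrite card_ord; move: #|b| #|~: b| #|descendants b| #|descendants (~: b)|; lia.
Qed.

End DimensionTrees.

(** * Mode projections *)

Section ProductCoordinates.
Context {R : realType} {X Y Z : choiceType}.
Variables (phi : X * Y -> Z) (p : Z -> X) (q : Z -> Y).
Hypotheses (pphi : forall x y, p (phi (x, y)) = x) (qphi : forall x y, q (phi (x, y)) = y)
  (phipq : forall z, phi (p z, q z) = z).

Lemma product_coordinates_bij : set_bij setT setT phi.
Proof.
split => //.
- move=> [x y] [x' y'] _ _ e; congr (_, _).
    by rewrite -(pphi x y) e pphi.
  by rewrite -(qphi x y) e qphi.
- by move=> z _; exists (p z, q z).
Qed.

Lemma sqnorm_product_coordinates (F : Z -> R) : sqnorm F = sqnorm (F \o phi).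
Proof.
by rewrite /sqnorm (@reindex_esum R _ _ setT setT phi _ product_coordinates_bij).
Qed.

Lemma dot_product_coordinates (f f' : X -> R) (g g' : Y -> R) :
  l2 f -> l2 f' -> l2 g -> l2 g' ->
  dot (fun z => f (p z) * g (q z)) (fun z => f' (p z) * g' (q z)) = dot f f' * dot g g'.
Proof.
move=> fl fl' gl gl'; rewrite -dot_tensor// !dotE (usum_reindex _ product_coordinates_bij).
by apply: eq_usum => -[x y] /=; rewrite pphi qphi.
Qed.

Lemma l2_product_coordinates (f : X -> R) (g : Y -> R) : l2 f -> l2 g ->
  l2 (fun z => f (p z) * g (q z)).
Proof.
move=> fl gl; rewrite /l2/= sqnorm_product_coordinates.
rewrite (_ : _ \o phi = fun s => f s.1 * g s.2); first exact: l2_tensor.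
by apply/funext => -[x y] /=; rewrite pphi qphi.
Qed.

End ProductCoordinates.

(** * Splitting and gluing of multi-indices *)

Section Multiindices.
Context {d : nat} {v1 : countType}.
Implicit Types a b c : {set 'I_d}.

Lemma midx_glue_in a (mu : pindex v1 a) (nu : pindex v1 (~: a)%SET) i (ia : i \in a) :
  midx_glue mu nu i = mu (exist _ i ia).
Proof.
by rewrite ffunE; case: {-}_ / idP => [h|//]; congr (mu _); exact: val_inj.
Qed.

Lemma midx_glue_out a (mu : pindex v1 a) (nu : pindex v1 (~: a)%SET) i
    (ia : i \in (~: a)%SET) :
  midx_glue mu nu i = nu (exist _ i ia).
Proof.
rewrite ffunE; case: {-}_ / idP => [h|h]; first by exfalso; move: ia; rewrite inE h.
by congr (nu _); exact: val_inj.
Qed.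

Lemma midx_restr_glue a (mu : pindex v1 a) (nu : pindex v1 (~: a)%SET) :
  midx_restr a (midx_glue mu nu) = mu.
Proof.
apply/ffunP => i; have ia : val i \in a by exact: valP i.
by rewrite ffunE (midx_glue_in _ _ ia); congr (mu _); exact: val_inj.
Qed.

Lemma midx_restrC_glue a (mu : pindex v1 a) (nu : pindex v1 (~: a)%SET) :
  midx_restr (~: a)%SET (midx_glue mu nu) = nu.
Proof.
apply/ffunP => i; have ia : val i \in (~: a)%SET by exact: valP i.
by rewrite ffunE (midx_glue_out _ _ ia); congr (nu _); exact: val_inj.
Qed.

Lemma midx_glue_restr a (nu : mindex d v1) :
  midx_glue (midx_restr a nu) (midx_restr (~: a)%SET nu) = nu.
Proof.
apply/ffunP => i; have [ia|ia] := boolP (i \in a).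
  by rewrite (midx_glue_in _ _ ia) ffunE.
have iaC : i \in (~: a)%SET by rewrite inE.
by rewrite (midx_glue_out _ _ iaC) ffunE.
Qed.

Lemma pidx_restrK a b (h : b \subset a) (nu : mindex d v1) :
  pidx_restr h (midx_restr a nu) = midx_restr b nu.
Proof. by apply/ffunP => i; rewrite !ffunE. Qed.

Lemma midx_restrP a (nu nu' : mindex d v1) : (forall i, i \in a -> nu i = nu' i) ->
  midx_restr a nu = midx_restr a nu'.
Proof. by move=> e; apply/ffunP => i; rewrite !ffunE e//; exact: valP i. Qed.

Section PartialGlue.
Variables a b c : {set 'I_d}.
Hypotheses (hb : b \subset a) (hc : c \subset a)
  (bIc : (b :&: c)%SET = finset.set0) (bUc : (b :|: c)%SET = a).

Lemma subcoord_other (i : subcoord a) : ~ (val i \in b) -> val i \in c.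
Proof.
move=> ib; have ia : val i \in a by exact: valP i.
have : val i \in (b :|: c)%SET by rewrite bUc.
by rewrite inE => /orP[].
Qed.

Definition pidx_glue (p : pindex v1 b * pindex v1 c) : pindex v1 a :=
  [ffun i => match @idP (val i \in b) with
             | ReflectT h => p.1 (exist _ (val i) h)
             | ReflectF h => p.2 (exist _ (val i) (subcoord_other h))
             end].

Lemma pidx_glueb x y (i : subcoord a) (ib : val i \in b) :
  pidx_glue (x, y) i = x (exist _ (val i) ib).
Proof.
by rewrite ffunE /=; case: {-}_ / idP => [h|//]; congr (x _); exact: val_inj.
Qed.

Lemma pidx_gluec x y (i : subcoord a) (ic : val i \in c) :
  pidx_glue (x, y) i = y (exist _ (val i) ic).
Proof.
rewrite ffunE /=; case: {-}_ / idP => [h|h]; last by congr (y _); exact: val_inj.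
exfalso; have /finset.setP/(_ (val i)) := bIc.
by rewrite !inE h ic.
Qed.

Lemma pidx_restr_glueb x y : pidx_restr hb (pidx_glue (x, y)) = x.
Proof.
apply/ffunP => i; have ib : val i \in b by exact: valP i.
by rewrite ffunE (pidx_glueb _ _ (i := subcoord_incl hb i) ib); congr (x _); exact: val_inj.
Qed.

Lemma pidx_restr_gluec x y : pidx_restr hc (pidx_glue (x, y)) = y.
Proof.
apply/ffunP => i; have ic : val i \in c by exact: valP i.
by rewrite ffunE (pidx_gluec _ _ (i := subcoord_incl hc i) ic); congr (y _); exact: val_inj.
Qed.

Lemma pidx_glue_restr z : pidx_glue (pidx_restr hb z, pidx_restr hc z) = z.
Proof.
apply/ffunP => i; have [ib|ib] := boolP (val i \in b).
  by rewrite (pidx_glueb _ _ ib) ffunE; congr (z _); exact: val_inj.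
have ic := subcoord_other (negP ib).
by rewrite (pidx_gluec _ _ ic) ffunE; congr (z _); exact: val_inj.
Qed.

(** Overwriting the coordinates in c and then those in b amounts to overwriting those in a. This is
    what allows projections in two child modes to be composed. *)
Lemma glue_glue (x : pindex v1 b) (y : pindex v1 c) (nu : mindex d v1) :
  midx_glue x (midx_restr (~: b)%SET (midx_glue y (midx_restr (~: c)%SET nu))) =
  midx_glue (pidx_glue (x, y)) (midx_restr (~: a)%SET nu).
Proof.
set m := midx_glue (pidx_glue _) _.
have mb : midx_restr b m = x by rewrite -(pidx_restrK hb) midx_restr_glue pidx_restr_glueb.
have mc : midx_restr c m = y by rewrite -(pidx_restrK hc) midx_restr_glue pidx_restr_gluec.
rewrite -[x in LHS]mb -[y in LHS]mc -[RHS](midx_glue_restr b); congr midx_glue.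
apply: midx_restrP => i ib.
rewrite -[in RHS](midx_glue_restr c m).
have [ic|ic] := boolP (i \in c); first by rewrite !(midx_glue_in _ _ ic).
have icC : i \in (~: c)%SET by rewrite inE.
rewrite !(midx_glue_out _ _ icC) ffunE [RHS]ffunE /= /m.
have iaC : i \in (~: a)%SET by move: ib ic; rewrite -bUc !inE => /negbTE -> /negbTE ->.
by rewrite (midx_glue_out _ _ iaC) ffunE.
Qed.

End PartialGlue.
End Multiindices.

Section ModeProjections.
Context {R : realType} {d : nat} {v1 : countType}.
Implicit Types (a b c : {set 'I_d}) (w : mindex d v1 -> R).

Let glue a (p : pindex v1 a * pindex v1 (~: a)%SET) := midx_glue p.1 p.2.

Lemma sqnorm_mat a w :
  sqnorm w = sqnorm (fun p : pindex v1 a * pindex v1 (~: a)%SET => mat a w p.1 p.2).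
Proof.
exact: (@sqnorm_product_coordinates R _ _ _ (@glue a) (midx_restr a) (midx_restr (~: a)%SET)
  (@midx_restr_glue _ _ a) (@midx_restrC_glue _ _ a) (@midx_glue_restr _ _ a) w).
Qed.

Lemma l2_mat a w : l2 w ->
  l2 (fun p : pindex v1 a * pindex v1 (~: a)%SET => mat a w p.1 p.2).
Proof. by rewrite /l2/= (sqnorm_mat a). Qed.

(** For an orthogonal family of vectors of norm one or zero, the orthogonal projection onto its
    span, applied to every column of [mat a y]. It acts on tensors rather than matrices so that
    projections for different nodes can be compared. *)
Definition mode_proj a (K : finType) (e : K -> pindex v1 a -> R)
    (y : mindex d v1 -> R) : mindex d v1 -> R :=
  fun nu => \sum_k dot (fun mu => y (midx_glue mu (midx_restr (~: a)%SET nu))) (e k)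
                   * e k (midx_restr a nu).

Section Family.
Variables (a : {set 'I_d}) (K : finType) (e : K -> pindex v1 a -> R) (beta : pred K).
Hypothesis el : forall k, l2 (e k).
Hypothesis orth : forall k l, dot (e k) (e l) = ((k == l) && beta k)%:R.

Lemma mode_best w (z : K -> pindex v1 (~: a)%SET -> R) : l2 w ->
  (sqnorm (fun nu => w nu - mode_proj e w nu)%R <=
   sqnorm (fun nu => w nu - \sum_k z k (midx_restr (~: a)%SET nu) * e k (midx_restr a nu))%R)%E.
Proof.
move=> wl; rewrite 2!(sqnorm_mat a).
have := col_best el orth z (l2_mat a wl); congr (_ <= _)%E; apply: eq_sqnorm => -[mu nu].
  by rewrite /mat /mode_proj midx_restr_glue midx_restrC_glue.
by rewrite /mat /= midx_restr_glue midx_restrC_glue.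
Qed.

Lemma mode_pyth w (y : mindex d v1 -> R) : l2 w -> l2 y ->
  (sqnorm (fun nu => w nu - mode_proj e y nu)%R <=
   sqnorm (fun nu => w nu - mode_proj e w nu)%R + sqnorm (fun nu => w nu - y nu)%R)%E.
Proof.
move=> wl yl; rewrite 3!(sqnorm_mat a).
have := col_pyth el orth (l2_mat a wl) (l2_mat a yl); congr (_ <= _ + _)%E;
  apply: eq_sqnorm => -[mu nu].
  by rewrite /mat /mode_proj midx_restr_glue midx_restrC_glue.
by rewrite /mat /mode_proj midx_restr_glue midx_restrC_glue.
Qed.

(** The Pythagorean inequality at w = 0 says that a projection does not increase the norm. *)
Lemma l2_mode_proj (y : mindex d v1 -> R) : l2 y -> l2 (mode_proj e y).
Proof.
move=> yl; have := mode_pyth (@l20 R (mindex d v1)) yl.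
rewrite (_ : (fun nu => 0 - mode_proj e (fun=> 0) nu) = fun=> 0); last first.
  apply/funext => nu; rewrite /mode_proj big1 ?subr0// => k _.
  by rewrite dot0l mul0r.
rewrite sqnorm0 add0e (_ : (fun nu => 0 - y nu) = fun nu => - y nu); last first.
  by apply/funext => nu; rewrite sub0r.
rewrite (_ : (fun nu => 0 - _) = fun nu => - mode_proj e y nu); last first.
  by apply/funext => nu; rewrite sub0r.
by rewrite !sqnormN => h; exact: le_lt_trans h yl.
Qed.

End Family.

Lemma mode_svd a w (s : nat -> R) U V n : l2 w -> is_svd (mat a w) s U V ->
  (sqnorm (fun nu => w nu - mode_proj (fun k : 'I_n => U k) w nu)%R <=
   \esum_(k in [set k | (n <= k)%N]) (s k ^+ 2)%:E)%E.
Proof.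
move=> wl svd; have tail := svd_tail svd n; apply: le_trans tail.
have el (k : 'I_n) : l2 (U k) := svd_l2l svd k.
have orth (k l : 'I_n) : dot (U k) (U l) = ((k == l) && (s k != 0))%:R.
  by rewrite (svd_orthol svd).
apply: le_trans (mode_best el orth (fun (k : 'I_n) nu => s k * V k nu) wl) _.
rewrite (sqnorm_mat a) le_eqVlt; apply/orP; left; apply/eqP; apply: eq_sqnorm => -[mu nu].
rewrite /mat /= midx_restr_glue midx_restrC_glue; congr (_ - _).
by apply: eq_bigr => k _; ring.
Qed.

Section TwoModes.
Variables (a b c : {set 'I_d}) (hb : b \subset a) (hc : c \subset a).
Hypotheses (bIc : (b :&: c)%SET = finset.set0) (bUc : (b :|: c)%SET = a).
Variables (K L : finType) (e : K -> pindex v1 b -> R) (f : L -> pindex v1 c -> R)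
  (beta : pred K) (delta : pred L).
Hypotheses (el : forall k, l2 (e k)) (fl : forall k, l2 (f k)).
Hypothesis eorth : forall k l, dot (e k) (e l) = ((k == l) && beta k)%:R.
Hypothesis forth : forall k l, dot (f k) (f l) = ((k == l) && delta k)%:R.

Definition pair_family (k : K * L) (nu : pindex v1 a) : R :=
  e k.1 (pidx_restr hb nu) * f k.2 (pidx_restr hc nu).

Let phi := pidx_glue (v1 := v1) bUc.
Let phib x y : pidx_restr hb (phi (x, y)) = x. Proof. exact: pidx_restr_glueb. Qed.
Let phic x y : pidx_restr hc (phi (x, y)) = y. Proof. exact: pidx_restr_gluec. Qed.
Let phiK z : phi (pidx_restr hb z, pidx_restr hc z) = z. Proof. exact: pidx_glue_restr. Qed.

Lemma pair_family_l2 k : l2 (pair_family k).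
Proof. exact: (l2_product_coordinates phib phic phiK). Qed.

Lemma pair_family_orth k l :
  dot (pair_family k) (pair_family l) = ((k == l) && (beta k.1 && delta k.2))%:R.
Proof.
rewrite /pair_family (dot_product_coordinates phib phic phiK)// eorth forth.
by case: k l => [k k'] [l l'] /=; rewrite xpair_eqE -natrM mulnb andbACA.
Qed.

(** The composition of the two child projections lies in the span of the pair family, so the
    projection onto that span is at least as good; the Pythagorean inequality bounds the error of
    the composition by the two separate errors. *)
Lemma pair_proj w : l2 w ->
  (sqnorm (fun nu => w nu - mode_proj pair_family w nu)%R <=
   sqnorm (fun nu => w nu - mode_proj e w nu)%R
   + sqnorm (fun nu => w nu - mode_proj f w nu)%R)%E.
Proof.
move=> wl; rewrite addeC.
apply: le_trans (mode_pyth fl forth wl (l2_mode_proj el eorth wl)).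
(* The coefficients of the composition: first inner products in mode b, then in mode c. *)
pose z (k : K * L) (n : pindex v1 (~: a)%SET) : R :=
  dot (fun y => dot (fun x => w (midx_glue (phi (x, y)) n)) (e k.1)) (f k.2).
apply: le_trans (mode_best pair_family_l2 pair_family_orth z wl) _.
rewrite le_eqVlt; apply/orP; left; apply/eqP; apply: eq_sqnorm => nu; congr (_ - _).
have Fl n : l2 (fun p => w (midx_glue (phi p) n)).
  apply: (@l2_comp_inj R _ _ (fun p => midx_glue (phi p) n)) => // -[x y] [x' y'].
  move=> /(congr1 (midx_restr a)); rewrite !midx_restr_glue => e1.
  congr (_, _); first by rewrite -(phib x y) e1 phib.
  by rewrite -(phic x y) e1 phic.
rewrite [RHS](_ : _ = \sum_l dot (fun mu => mode_proj e w
    (midx_glue mu (midx_restr (~: c)%SET nu))) (f l) * f l (midx_restr c nu))//.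
rewrite -(pair_bigA _ (fun k l => z (k, l) (midx_restr (~: a)%SET nu) * pair_family (k, l)
  (midx_restr a nu)))/=.
rewrite exchange_big/=; apply: eq_bigr => l _.
rewrite (_ : (fun mu => mode_proj e w _) = fun mu => \sum_k e k (midx_restr b nu) *
    dot (fun x => w (midx_glue (phi (x, mu)) (midx_restr (~: a)%SET nu))) (e k)); last first.
  apply/funext => mu; apply: eq_bigr => k _; rewrite [RHS]mulrC.
  have -> : midx_restr b (midx_glue mu (midx_restr (~: c)%SET nu)) = midx_restr b nu.
    apply: midx_restrP => i ib; have icC : i \in (~: c)%SET.
      by have /finset.setP/(_ i) := bIc; rewrite !inE ib /= => ->.
    by rewrite (midx_glue_out _ _ icC) ffunE.
  congr (_ * _); rewrite !dotE; apply: eq_usum => x.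
  by rewrite (glue_glue hb hc bIc bUc).
rewrite dot_suml//; last first.
  by move=> k; exact: (l2_dot_col (Fl _) (el k)).
rewrite mulr_suml; apply: eq_bigr => k _.
rewrite /pair_family /z /= !pidx_restrK; ring.
Qed.

End TwoModes.
End ModeProjections.

(** * Hierarchical singular value truncation *)

Lemma sum_below_nat (R : realType) (r1 r2 : nat) (F : nat -> nat -> R) :
  sum_below (r1%:R)%:E (r2%:R)%:E F = \sum_(i < r1) \sum_(j < r2) F i j.
Proof.
apply: lim_near_cst => //; near=> n.
have r1n : (r1 <= n)%N by near: n; exact: nbhs_infty_ge.
have r2n : (r2 <= n)%N by near: n; exact: nbhs_infty_ge.
rewrite (big_ord_widen n (fun i => \sum_(j < r2) F i j) r1n).
apply: eq_big => [i|i _]; first by rewrite lte_fin ltr_nat.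
rewrite (big_ord_widen n (fun j => F i j) r2n).
by apply: eq_bigl => j; rewrite lte_fin ltr_nat.
Unshelve. all: by end_near.
Qed.

Section NestedRepresentation.
Context {R : realType} {d : nat} {v1 : countType}.
Implicit Types (a b c : {set 'I_d}) (w : mindex d v1 -> R).

(** A tensor seen from node a, with coefficients that depend on the coordinates outside a.
    Exchanging the frame [U a] for the generated frame [W a] with [g] fixed performs the truncation
    in the subtree of a. *)
Definition frame_comb a n (X : nat -> pindex v1 a -> R)
    (g : nat -> pindex v1 (~: a)%SET -> R) (nu : mindex d v1) : R :=
  \sum_(k < n) g k (midx_restr (~: a)%SET nu) * X k (midx_restr a nu).

Lemma rank_frame_comb a n X g :
  (matrix_rank (mat a (@frame_comb a n X g)) <= (n%:R)%:E)%E.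
Proof.
apply: (@rank_le_of_factor _ _ _ _ _ (fun k : 'I_n => X k) (fun k : 'I_n => g k)) => mu nu.
rewrite /mat /frame_comb midx_restr_glue midx_restrC_glue.
by apply: eq_bigr => k _; rewrite mulrC.
Qed.

Section Branch.
Variables a b c : {set 'I_d}.
Hypotheses (hb : b \subset a) (hc : c \subset a)
  (bIc : (b :&: c)%SET = finset.set0) (bUc : (b :|: c)%SET = a).
Variables (na nb nc : nat) (t : nat -> nat -> nat -> R).
Variable g : nat -> pindex v1 (~: a)%SET -> R.

Definition branch_comb (Xb : nat -> pindex v1 b -> R) (Xc : nat -> pindex v1 c -> R)
    (nu : mindex d v1) : R :=
  \sum_(i < nb) \sum_(j < nc) \sum_(k < na) t k i j * g k (midx_restr (~: a)%SET nu)
    * Xb i (midx_restr b nu) * Xc j (midx_restr c nu).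

Let cCb : c \subset (~: b)%SET.
Proof. by rewrite -finset.disjoints_subset -finset.setI_eq0 finset.setIC bIc. Qed.

Let bCc : b \subset (~: c)%SET.
Proof. by rewrite -finset.disjoints_subset -finset.setI_eq0 bIc. Qed.

Let aCb : (~: a)%SET \subset (~: b)%SET. Proof. by rewrite finset.setCS. Qed.
Let aCc : (~: a)%SET \subset (~: c)%SET. Proof. by rewrite finset.setCS. Qed.

(** The order of quantifiers is the point: [h] does not depend on [Xb], so the same coefficients
    serve before and after the frame of b is exchanged. *)
Lemma branch_comb_left Xc : exists h, forall Xb,
  branch_comb Xb Xc = frame_comb nb Xb h.
Proof.
exists (fun i m => \sum_(j < nc) \sum_(k < na) t k i j * g k (pidx_restr aCb m) * Xc j
  (pidx_restr cCb m)).
move=> Xb; apply/funext => nu; apply: eq_bigr => i _; rewrite mulr_suml.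
apply: eq_bigr => j _; rewrite mulr_suml; apply: eq_bigr => k _.
by rewrite !pidx_restrK mulrAC.
Qed.

Lemma branch_comb_right Xb : exists h, forall Xc,
  branch_comb Xb Xc = frame_comb nc Xc h.
Proof.
exists (fun j m => \sum_(i < nb) \sum_(k < na) t k i j * g k (pidx_restr aCc m) * Xb i
  (pidx_restr bCc m)).
move=> Xc; apply/funext => nu; rewrite /branch_comb exchange_big.
apply: eq_bigr => j _; rewrite mulr_suml.
apply: eq_bigr => i _; rewrite mulr_suml; apply: eq_bigr => k _.
by rewrite !pidx_restrK.
Qed.

Lemma branch_comb_parent (Xb : nat -> pindex v1 b -> R) (Xc : nat -> pindex v1 c -> R)
    (Xa : nat -> pindex v1 a -> R) :
  (forall k nu, Xa k nu = \sum_(i < nb) \sum_(j < nc)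
     t k i j * Xb i (pidx_restr hb nu) * Xc j (pidx_restr hc nu)) ->
  branch_comb Xb Xc = frame_comb na Xa g.
Proof.
move=> XaE; apply/funext => nu; rewrite /branch_comb /frame_comb.
under [RHS]eq_bigr => k _ do rewrite XaE mulr_sumr.
rewrite [RHS]exchange_big; apply: eq_bigr => i _.
under [RHS]eq_bigr => k _ do rewrite mulr_sumr.
rewrite [RHS]exchange_big; apply: eq_bigr => j _; apply: eq_bigr => k _.
by rewrite !pidx_restrK; ring.
Qed.

(** The transfer coefficients are inner products with the retained pairs of child vectors, so
    deleting the other pairs is an orthogonal projection. *)
Lemma branch_comb_proj (Ua : nat -> pindex v1 a -> R) Ub Uc :
  (forall k, l2 (Ua k)) -> (forall k, l2 (Ub k)) -> (forall k, l2 (Uc k)) ->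
  (forall k i j, t k i j = dot (Ua k)
     (fun nu => Ub i (pidx_restr hb nu) * Uc j (pidx_restr hc nu))) ->
  mode_proj (pair_family hb hc (fun i : 'I_nb => Ub i) (fun j : 'I_nc => Uc j))
    (frame_comb na Ua g) = branch_comb Ub Uc.
Proof.
move=> Ual Ubl Ucl tE; apply/funext => nu; rewrite /mode_proj /branch_comb pair_bigA.
apply: eq_bigr => -[i j] _ /=.
rewrite (_ : (fun mu => _) = fun mu => \sum_(k < na) g k (midx_restr (~: a)%SET nu) * Ua k mu);
  last first.
  by apply/funext => mu; rewrite /frame_comb midx_restr_glue midx_restrC_glue.
rewrite dot_suml//; last first.
  by apply: (@pair_family_l2 _ _ _ _ _ _ hb hc bIc bUc _ _ (fun i : 'I_nb => Ub i) (fun j :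
    'I_nc => Uc j)).
rewrite mulr_suml; apply: eq_bigr => k _.
by rewrite tE /pair_family /= !pidx_restrK; ring.
Qed.

End Branch.
End NestedRepresentation.

Section HSVDTruncation.
Context {R : realType} {d : nat} {v1 : countType}.
Variables (T : {set {set 'I_d}}) (rep : {set {set 'I_d}} -> {set 'I_d}).
Hypotheses (hT : dimension_tree T) (hrep : edge_representer T rep) (hd : (2 <= d)%N).
Implicit Types (a b c : {set 'I_d}).
Variables (w x : mindex d v1 -> R) (U W : forall a, nat -> pindex v1 a -> R).
Arguments U : clear implicits.
Arguments W : clear implicits.
Variable rho : {set {set 'I_d}} -> nat.
Hypothesis wl : l2 w.
Hypothesis frames : hsvd_frames T w U.
Hypothesis leafW : forall a, a \in T -> children T a = finset.set0 ->
  forall k, W a k = U a k.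
Hypothesis branchW : forall a b c (hb : b \subset a) (hc : c \subset a),
  a \in T -> a != [set: 'I_d]%SET -> children T a = [set b; c]%SET ->
  forall k nu, W a k nu = \sum_(i < rho (edge b)) \sum_(j < rho (edge c))
    transfer U hb hc k i j * W b i (pidx_restr hb nu) * W c j (pidx_restr hc nu).
Hypothesis rootx : forall b c, children T [set: 'I_d]%SET = [set b; c]%SET ->
  forall nu, x nu = \sum_(i < rho (edge b)) \sum_(j < rho (edge c))
    root_transfer w U b c i j * W b i (midx_restr b nu) * W c j (midx_restr c nu).

Let n a := rho (edge a).

Definition discarded a : \bar R :=
  (\esum_(k in [set k | (rho (edge a) <= k)%N]) (sing_vals (mat a w) k ^+ 2)%:E)%E.

Lemma discarded_ge0 a : (0 <= discarded a)%E.
Proof. by apply: esum_ge0 => k _; rewrite lee_fin sqr_ge0. Qed.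

Lemma frame_l2 a k : a \in T -> a != [set: 'I_d]%SET -> l2 (U a k).
Proof. by move=> aT aN; have [V svd] := frames.1 a aT aN; exact: svd_l2l svd k. Qed.

Lemma frame_orth a m (k l : 'I_m) : a \in T -> a != [set: 'I_d]%SET ->
  dot (U a k) (U a l) = ((k == l) && (sing_vals (mat a w) k != 0))%:R.
Proof.
move=> aT aN; have [V svd] := frames.1 a aT aN.
by rewrite (svd_orthol svd).
Qed.

Lemma proj_discarded a : a \in T -> a != [set: 'I_d]%SET ->
  (sqnorm (fun nu => w nu - mode_proj (fun k : 'I_(n a) => U a k) w nu)%R <= discarded a)%E.
Proof. by move=> aT aN; have [V svd] := frames.1 a aT aN; exact: mode_svd wl svd. Qed.

(* Passing from a node to its children projects onto the spans of the two child
   frames, which costs at most the singular values discarded there. *)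
Lemma nested_error a g : a \in T -> a != [set: 'I_d]%SET ->
  l2 (frame_comb (n a) (U a) g) ->
  l2 (frame_comb (n a) (W a) g) /\
  (sqnorm (fun nu => w nu - frame_comb (n a) (W a) g nu)%R <=
   sqnorm (fun nu => w nu - frame_comb (n a) (U a) g nu)%R
   + \sum_(y in descendants T a) discarded y)%E.
Proof.
elim: {a}_.+1 {-2}a (ltnSn #|a|) g => // m IHm a; rewrite ltnS => am g aT aN yl.
have [a0|[b [c [bc ch bIc bUc]]]] := tree_cases hT aT.
  have -> : frame_comb (n a) (W a) g = frame_comb (n a) (U a) g.
    by apply/funext => nu; apply: eq_bigr => k _; rewrite leafW.
  by split => //; rewrite leeDl// sume_ge0// => y _; exact: discarded_ge0.
have [bT cT ba ca] := children_tree ch.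
have bN : b != [set: 'I_d]%SET.
  by apply: contraTneq ba => ->; rewrite fintype.properE finset.subsetT andbF.
have cN : c != [set: 'I_d]%SET.
  by apply: contraTneq ca => ->; rewrite fintype.properE finset.subsetT andbF.
have hb := proper_sub ba; have hc := proper_sub ca.
pose t k i j := transfer U hb hc k i j.
pose B (Xb : nat -> pindex v1 b -> R) (Xc : nat -> pindex v1 c -> R) :=
  branch_comb (n a) (n b) (n c) t g Xb Xc.
have Ual k := frame_l2 k aT aN; have Ubl k := frame_l2 k bT bN; have Ucl k := frame_l2 k cT cN.
have el (i : 'I_(n b)) := Ubl i; have fl (j : 'I_(n c)) := Ucl j.
have eo (k l : 'I_(n b)) := frame_orth k l bT bN.
have fo (k l : 'I_(n c)) := frame_orth k l cT cN.
have pl := pair_family_l2 hb hc bIc bUc el fl.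
have po := pair_family_orth hb hc bIc bUc el fl eo fo.
have y1E := branch_comb_proj (hb := hb) (hc := hc) (t := t) bIc bUc (n a) (n b) (n c) g
  Ual Ubl Ucl (fun _ _ _ => erefl).
have y1l : l2 (B (U b) (U c)) by rewrite /B -y1E; exact: (l2_mode_proj pl po).
have e1 : (sqnorm (fun nu => w nu - B (U b) (U c) nu)%R <=
    (discarded b + discarded c) + sqnorm (fun nu => w nu - frame_comb (n a) (U a) g nu)%R)%E.
  rewrite /B -y1E; apply: le_trans (mode_pyth pl po wl yl) _.
  apply: leeD => //; apply: le_trans (pair_proj hb hc bIc bUc el fl eo fo wl) _.
  by apply: leeD; exact: proj_discarded.
(* The child frames are exchanged one at a time, b while c keeps [U c], then c while b already has
   [W b]; each exchange is an instance of the induction hypothesis. *)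
have [h hE] := branch_comb_left hb bIc (n a) (n b) (n c) t g (U c).
have [h' hE'] := branch_comb_right hc bIc (n a) (n b) (n c) t g (W b).
have := IHm b (leq_trans (proper_card ba) am) h bT bN.
rewrite -!hE => /(_ y1l)[y2l e2].
have := IHm c (leq_trans (proper_card ca) am) h' cT cN.
rewrite -!hE' => /(_ y2l)[y3l e3].
rewrite -(branch_comb_parent (n a) g (branchW hb hc aT aN ch)).
split => //; apply: le_trans e3 _.
rewrite (big_descendants hT aT ch bIc) /=.
apply: (@le_trans _ _ ((discarded b + discarded c
    + sqnorm (fun nu => w nu - frame_comb (n a) (U a) g nu)%R)
    + \sum_(y in descendants T b) discarded y + \sum_(y in descendants T c) discarded y)%E).
  by apply: leeD => //; apply: le_trans e2 _; apply: leeD.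
have ac (p q s P Q : \bar R) : (p + q + s + P + Q = s + ((p + P) + (q + Q)))%E.
  by rewrite (addeC (p + q)) -!addeA (addeCA q).
by rewrite le_eqVlt; apply/orP; left; apply/eqP; exact: ac.
Qed.

Lemma root_comb_left b (Xc : nat -> pindex v1 (~: b)%SET -> R) (t : nat -> nat -> R) m p :
  exists h, forall Xb : nat -> pindex v1 b -> R,
    (fun nu => \sum_(i < m) \sum_(j < p) t i j * Xb i (midx_restr b nu)
       * Xc j (midx_restr (~: b)%SET nu)) = frame_comb m Xb h.
Proof.
exists (fun i mu => \sum_(j < p) t i j * Xc j mu) => Xb; apply/funext => nu.
by apply: eq_bigr => i _; rewrite mulr_suml; apply: eq_bigr => j _; rewrite mulrAC.
Qed.

Lemma root_comb_right b (Xb : nat -> pindex v1 b -> R) (t : nat -> nat -> R) m p :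
  exists h, forall Xc : nat -> pindex v1 (~: b)%SET -> R,
    (fun nu => \sum_(i < m) \sum_(j < p) t i j * Xb i (midx_restr b nu)
       * Xc j (midx_restr (~: b)%SET nu)) = frame_comb p Xc h.
Proof.
(* The double complement of b equals b without being convertible to it, so indices are carried over
   by restriction along an inclusion. *)
have bCC : b \subset (~: ~: b)%SET by rewrite finset.setCK.
exists (fun j mu => \sum_(i < m) t i j * Xb i (pidx_restr bCC mu)) => Xc.
apply/funext => nu; rewrite exchange_big; apply: eq_bigr => j _.
by rewrite mulr_suml; apply: eq_bigr => i _; rewrite pidx_restrK.
Qed.

(* The frames of the two children of the root belong to one decomposition, so
   the root step truncates a singular value decomposition once. *)
Lemma root_error b : b \in T -> (~: b)%SET \in T ->
  let y nu := \sum_(i < n b) \sum_(j < n b) root_transfer w U b (~: b)%SET i j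
    * U b i (midx_restr b nu) * U (~: b)%SET j (midx_restr (~: b)%SET nu) in
  l2 y /\ (sqnorm (fun nu => w nu - y nu)%R <= discarded b)%E.
Proof.
move=> bT cT y; have svd := frames.2 b bT cT.
have Ubl k : l2 (U b k) := svd_l2l svd k.
have Ucl k : l2 (U (~: b)%SET k) := svd_l2r svd k.
pose e (k : 'I_(n b) * 'I_(n b)) (nu : mindex d v1) :=
  U b k.1 (midx_restr b nu) * U (~: b)%SET k.2 (midx_restr (~: b)%SET nu).
pose glue (q : pindex v1 b * pindex v1 (~: b)%SET) := midx_glue q.1 q.2.
have g1 x' y' : midx_restr b (glue (x', y')) = x' by exact: midx_restr_glue.
have g2 x' y' : midx_restr (~: b)%SET (glue (x', y')) = y' by exact: midx_restrC_glue.
have g3 z : glue (midx_restr b z, midx_restr (~: b)%SET z) = z by exact: midx_glue_restr.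
have el k : l2 (e k) by exact: (l2_product_coordinates g1 g2 g3).
pose beta (k : 'I_(n b) * 'I_(n b)) :=
  (sing_vals (mat b w) k.1 != 0) && (sing_vals (mat b w) k.2 != 0).
have eo k l : dot (e k) (e l) = ((k == l) && beta k)%:R.
  rewrite /e (dot_product_coordinates g1 g2 g3)// (svd_orthol svd) (svd_orthor svd).
  by case: k l => [k k'] [l l'] /=; rewrite xpair_eqE -natrM mulnb andbACA.
have yE : y = fun nu => \sum_k dot w (e k) * e k nu.
  apply/funext => nu; rewrite /y pair_bigA; apply: eq_bigr => -[i j] _.
  by rewrite /root_transfer /e /= mulrA.
split; first by rewrite yE; exact: (l2_comb el).
pose s := sing_vals (mat b w).
(* The competitor is the truncated singular value decomposition, whose coefficients on pairs of
   singular vectors are diagonal. *)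
have best := proj_best el eo (fun k => if k.1 == k.2 then s k.1 else 0) wl.
have -> : (fun nu => w nu - y nu) = (fun nu => w nu - \sum_k dot w (e k) * e k nu).
  by rewrite yE.
apply: le_trans best _; apply: le_trans (svd_tail svd (n b)).
rewrite (sqnorm_mat b) le_eqVlt; apply/orP; left; apply/eqP; apply: eq_sqnorm => -[mu nu] /=.
rewrite /mat; congr (_ - _).
rewrite -(pair_bigA _ (fun i j : 'I_(n b) => (if i == j then s i else 0) * e (i, j) (midx_glue
  mu nu)))/=.
apply: eq_bigr => i _; rewrite (bigD1 i)//= eqxx big1 ?addr0; last first.
  by move=> j ji; rewrite eq_sym (negbTE ji) mul0r.
by rewrite /e /= midx_restr_glue midx_restrC_glue mulrA.
Qed.

Lemma hsvd_truncation_error :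
  (sqnorm (fun nu => w nu - x nu)%R <= \sum_(e in edges T)
     \esum_(k in [set k | (rho e <= k)%N]) (sing_vals (mat (rep e) w) k ^+ 2)%:E)%E.
Proof.
have [b [ch rb bN bT cT]] := root_children hT hrep hd.
have [_ _ ba ca] := children_tree ch.
have bR : b != [set: 'I_d]%SET.
  by apply: contraTneq ba => ->; rewrite fintype.properE finset.subsetT andbF.
have cR : (~: b)%SET != [set: 'I_d]%SET.
  by apply: contraTneq ca => ->; rewrite fintype.properE finset.subsetT andbF.
have [y0l e0] := root_error bT cT.
have [h hE] := root_comb_left (U (~: b)%SET) (root_transfer w U b (~: b)%SET) (n b) (n b).
have [h' hE'] := root_comb_right (W b) (root_transfer w U b (~: b)%SET) (n b) (n b).
have := @nested_error b h bT bR; rewrite -!hE => /(_ y0l)[y1l e1].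
have := @nested_error (~: b)%SET h' cT cR.
rewrite /n edgeC -/(n b) -!hE' => /(_ y1l)[_ e2].
have -> : (fun nu => w nu - x nu) = (fun nu => w nu - \sum_(i < n b) \sum_(j < n b)
    root_transfer w U b (~: b)%SET i j * W b i (midx_restr b nu)
    * W (~: b)%SET j (midx_restr (~: b)%SET nu)).
  by apply/funext => nu; rewrite (rootx ch) /n edgeC.
apply: le_trans e2 _.
rewrite (eq_bigr (fun e => discarded (rep e))); last first.
  by move=> e eT; rewrite /discarded (edge_rep hrep eT).
rewrite (big_edges hT hrep ch rb bN _ discarded) /=; apply: leeD => //.
by apply: le_trans e1 _; apply: leeD.
Qed.

(** By descent from the root: the parent's frame expands in the frames of its children. Hence at
    each node x is a combination of as many vectors as the rank bound allows, which bounds its rank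
    there. *)
Lemma truncation_frame_comb a : a \in T -> a != [set: 'I_d]%SET ->
  exists g, x = frame_comb (n a) (W a) g.
Proof.
elim: {a}_.+1 {-2}a (ltnSn (d - #|a|)) => // m IHm a; rewrite ltnS => am aT aN.
have [p pT ap] := parent_exists hT aT aN.
have [p0|[b [c [bc ch bIc bUc]]]] := tree_cases hT pT; first by rewrite p0 inE in ap.
have [bT cT bp cp] := children_tree ch.
have [pR|pN] := eqVneq p [set: 'I_d]%SET.
  have cE : c = (~: b)%SET.
    apply/finset.setP => i; have /finset.setP/(_ i) := bIc; have /finset.setP/(_ i) := bUc.
    by rewrite pR !inE; case: (i \in b); case: (i \in c).
  rewrite pR in ch; rewrite cE in ch; have xE := rootx ch; rewrite /n edgeC in xE *.
  have {}xE : x = fun nu => \sum_(i < n b) \sum_(j < n b)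
    root_transfer w U b (~: b)%SET i j * W b i (midx_restr b nu)
    * W (~: b)%SET j (midx_restr (~: b)%SET nu) by apply/funext => nu; exact: xE.
  move: ap; rewrite pR ch !inE => /orP[] /eqP ->.
    have [h hE] := root_comb_left (W (~: b)%SET) (root_transfer w U b (~: b)%SET) (n b) (n b).
    by exists h; rewrite xE hE.
  have [h hE] := root_comb_right (W b) (root_transfer w U b (~: b)%SET) (n b) (n b).
  by exists h; rewrite edgeC xE hE.
have hb := proper_sub bp; have hc := proper_sub cp.
have [g xE] : exists g, x = frame_comb (n p) (W p) g.
  apply: IHm => //; apply: leq_trans am.
  have /in_children[_ /proper_card] := ap; have := subset_leq_card (finset.subsetT p).
  rewrite cardsT card_ord => pd ap'; apply: ltn_sub2l => //.
  exact: leq_trans ap' pd.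
rewrite xE -(branch_comb_parent (n p) g (branchW hb hc pT pN ch)).
move: ap; rewrite ch !inE => /orP[] /eqP ->.
  have [h hE] := branch_comb_left hb bIc (n p) (n b) (n c) (fun k i j => transfer U hb hc k i j)
    g (W c).
  by exists h; rewrite -hE.
have [h hE] := branch_comb_right hc bIc (n p) (n b) (n c) (fun k i j => transfer U hb hc k i j)
  g (W b).
by exists h; rewrite -hE.
Qed.

Lemma hsvd_truncation_rank e : e \in edges T ->
  (hrank rep x e <= ((rho e)%:R)%:E)%E.
Proof.
move=> eT; have [_ reT] := hrep eT.
have [g ->] := truncation_frame_comb reT (rep_not_root hT hrep eT).
by rewrite /hrank /n (edge_rep hrep eT); exact: rank_frame_comb.
Qed.

End HSVDTruncation.

Section HSVDTruncationBounds.
Context {R : realType} {d : nat} {v1 : countType}.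
Variables (T : {set {set 'I_d}}) (rep : {set {set 'I_d}} -> {set 'I_d}).
Hypotheses (hT : dimension_tree T) (hrep : edge_representer T rep) (hd : (2 <= d)%N).
Variables (w x : mindex d v1 -> R) (r : @rankvec R d) (rho : {set {set 'I_d}} -> nat).
Hypothesis rE : forall e, e \in edges T -> r e = ((rho e)%:R)%:E.

Let unfold_truncation : hsvd_truncation T r w x ->
  exists U W : forall a, nat -> pindex v1 a -> R,
  [/\ hsvd_frames T w U,
      (forall a : {set 'I_d}, a \in T -> children T a = finset.set0 ->
         forall k, W a k = U a k),
      (forall (a b c : {set 'I_d}) (hb : b \subset a) (hc : c \subset a),
         a \in T -> a != [set: 'I_d]%SET -> children T a = [set b; c]%SET ->
         forall k nu, W a k nu = \sum_(i < rho (edge b)) \sum_(j < rho (edge c))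
           transfer U hb hc k i j * W b i (pidx_restr hb nu) * W c j (pidx_restr hc nu)) &
      (forall b c, children T [set: 'I_d]%SET = [set b; c]%SET ->
         forall nu, x nu = \sum_(i < rho (edge b)) \sum_(j < rho (edge c))
           root_transfer w U b c i j * W b i (midx_restr b nu) * W c j (midx_restr c nu))].
Proof.
have redge (a b c : {set 'I_d}) : a \in T -> children T a = [set b; c]%SET ->
    r (edge b) = ((rho (edge b))%:R)%:E /\ r (edge c) = ((rho (edge c))%:R)%:E.
  move=> aT ch; have [bT cT ba ca] := children_tree ch.
  split; apply: rE; apply: edge_in => //.
    by apply: contraTneq ba => ->; rewrite fintype.properE finset.subsetT andbF.
  by apply: contraTneq ca => ->; rewrite fintype.properE finset.subsetT andbF.
move=> [U [W [h1 h2 h3 h4]]]; exists U, W; split => //.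
- move=> a b c hb hc aT aN ch k nu; rewrite (h3 a b c hb hc aT aN ch).
  have [-> ->] := redge a b c aT ch.
  exact: sum_below_nat.
- move=> b c ch nu; rewrite (h4 b c ch).
  have [-> ->] := redge _ b c (root_in_tree hT) ch.
  exact: sum_below_nat.
Qed.

Lemma truncation_error : l2 w -> hsvd_truncation T r w x ->
  (sqnorm (fun nu => w nu - x nu)%R <= \sum_(e in edges T)
     \esum_(k in [set k : nat | (r e <= (k%:R)%:E)%E])
       (sing_vals (mat (rep e) w) k ^+ 2)%:E)%E.
Proof.
move=> wl /unfold_truncation[U [W [h1 h2 h3 h4]]].
apply: le_trans (hsvd_truncation_error hT hrep hd wl h1 h2 h3 h4) _.
apply: lee_sum => e eT; apply: le_esum_set => [k _|k /=].
  by rewrite lee_fin sqr_ge0.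
by rewrite rE// lee_fin ler_nat.
Qed.

Lemma truncation_rank e : hsvd_truncation T r w x -> e \in edges T ->
  (hrank rep x e <= r e)%E.
Proof.
move=> /unfold_truncation[U [W [h1 h2 h3 h4]]] eT; rewrite rE//.
exact: (hsvd_truncation_rank hT hrep h3 h4 eT).
Qed.

Lemma truncation_svd (a : {set 'I_d}) : hsvd_truncation T r w x -> a \in T -> a != [set:
  'I_d]%SET ->
  exists U V, is_svd (mat a w) (sing_vals (mat a w)) U V.
Proof.
by move=> [U [W [[h _] _ _ _]]] aT aN; have [V svd] := h a aT aN; exists (U a), V.
Qed.

End HSVDTruncationBounds.

(** * Contractions and coarsening *)

Section FiniteEsums.
Context {R : realType} {J : choiceType}.

Lemma esum_seq (s : seq J) (a : J -> \bar R) : uniq s -> (forall j, (0 <= a j)%E) ->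
  (\esum_(j in [set` s]) a j = \sum_(j <- s) a j)%E.
Proof.
move=> us a0; rewrite esum_fset; [|exact: finite_seq|by move=> j _; exact: a0].
by rewrite -fsbig_seq.
Qed.

Lemma counting_seq (r : seq J) (A : set J) : A `<=` [set` r] ->
  (counting A <= ((size r)%:R)%:E :> \bar R)%E.
Proof.
move=> Ar; have finA : finite_set A by apply: sub_finite_set Ar _; exact: finite_seq.
rewrite /counting asboolT// lee_fin ler_nat.
apply: leq_trans (size_undup r); apply: uniq_leq_size.
  exact: finmap.fset_uniq.
by move=> x; rewrite in_fset_set// inE mem_undup => /Ar.
Qed.

End FiniteEsums.

Lemma esum_ord (R : realType) n (F : 'I_n -> \bar R) : (forall i, (0 <= F i)%E) ->
  (\esum_(i in [set: 'I_n]) F i = \sum_(i < n) F i)%E.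
Proof.
move=> F0; rewrite (_ : [set: 'I_n] = [set` index_enum 'I_n]); last first.
  by apply/seteqP; split => i //= _; rewrite mem_index_enum.
by rewrite esum_seq// index_enum_uniq.
Qed.

Section Arrangements.
Context {R : realType} {J : choiceType}.
Variables (a : J -> R) (f : nat -> option J).
Hypothesis a0 : forall j, 0 <= a j.
Hypothesis arr : arrangement a f.

Definition listed (N : nat) : set J := [set j | exists2 n, (n < N)%N & f n = Some j].

Definition listing (N : nat) : seq J := pmap f (iota 0 N).

Lemma mem_listing N j : (j \in listing N) = `[< listed N j >].
Proof.
rewrite mem_pmap; apply/mapP/asboolP => [[n]|[n nN fn]].
  by rewrite mem_iota add0n => nN fn; exists n.
by exists n => //; rewrite mem_iota.
Qed.

Lemma listing_uniq N : uniq (listing N).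
Proof.
rewrite /listing; elim: N => // N IHN.
rewrite -addn1 iotaD pmap_cat cat_uniq IHN add0n /=.
case fN: (f N) => [j|] //=; rewrite orbF andbT mem_listing; apply/asboolP => -[n nN fn].
by have nE := arr_inj arr fn fN; rewrite nE ltnn in nN.
Qed.

Lemma size_listing N : (size (listing N) <= N)%N.
Proof. by rewrite size_pmap (leq_trans (count_size _ _))// size_iota. Qed.

(* The value tau of the first element not listed separates listed from unlisted
   values; exchanging elements of a competing set of at most M indices for listed
   ones can therefore only decrease the remainder. *)
Lemma listed_best M (l : seq J) : (size l <= M)%N ->
  (\esum_(j in ~` listed M) (a j ^+ 2)%:E <= \esum_(j in ~` [set` l]) (a j ^+ 2)%:E)%E.
Proof.
move=> lM; set s := listing M; set l' := undup l.
have sE : listed M = [set` s].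
  by apply/seteqP; split => j /=; rewrite mem_listing => /asboolP.
have lE : [set` l] = [set` l'] by apply/seteqP; split => j /=; rewrite mem_undup.
have ul : uniq l' by exact: undup_uniq.
have us : uniq s by exact: listing_uniq.
have sl : (size l' <= M)%N := leq_trans (size_undup l) lM.
have p0 j : (0 <= (a j ^+ 2)%:E)%E by rewrite lee_fin sqr_ge0.
rewrite sE lE (esumID [set` l'] (~` [set` s])) ?(esumID [set` s] (~` [set` l']))//.
rewrite [X in (_ <= _ + esum X _)%E]setIC; apply: leeD => //.
have -> : ~` [set` s] `&` [set` l'] = [set` [seq j <- l' | j \notin s]].
  apply/seteqP; split => j /=; rewrite mem_filter; first by move=> [/negP -> ->].
  by move=> /andP[/negP ? ?].
have -> : ~` [set` l'] `&` [set` s] = [set` [seq j <- s | j \notin l']].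
  apply/seteqP; split => j /=; rewrite mem_filter; first by move=> [/negP -> ->].
  by move=> /andP[/negP ? ?].
rewrite !esum_seq ?filter_uniq//.
have [tau [tau0 tau_s tau_l full]] : exists tau, [/\ 0 <= tau,
    forall j, j \in s -> tau <= a j, forall j, j \notin s -> a j <= tau &
    tau = 0 \/ size s = M].
  (* If the arrangement ends before M, all unlisted values are zero and the threshold is 0. *)
  case fM: (f M) => [k|].
    exists (a k); split => //.
    - move=> j; rewrite mem_listing => /asboolP[n nM fn].
      exact: (arr_noninc arr (ltnW nM) fn fM).
    - move=> j; rewrite mem_listing => /asboolPn jM.
      have [aj0|/(arr_all arr)[n fn]] := eqVneq (a j) 0; first by rewrite aj0.
      have Mn : (M <= n)%N by rewrite leqNgt; apply/negP => nM; apply: jM; exists n.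
      exact: (arr_noninc arr Mn fM fn).
    - right; rewrite /s /listing size_pmap; apply/eqP.
      rewrite -[X in _ == X](size_iota 0) -all_count; apply/allP => n.
      rewrite mem_iota add0n => nM; case fn: (f n) => //.
      by have := arr_end arr (ltnW nM) fn; rewrite fM.
  exists 0; split => //; last by left.
  move=> j; rewrite mem_listing => /asboolPn jM.
  have [->//|/(arr_all arr)[n fn]] := eqVneq (a j) 0.
  have [nM|Mn] := ltnP n M; first by exfalso; apply: jM; exists n.
  by have := arr_end arr Mn fM; rewrite fn.
have constE (q : seq J) : tau ^+ 2 *+ size q = \sum_(j <- q) tau ^+ 2.
  by rewrite big_const_seq count_predT iter_addr_0.
have le1 : (\sum_(j <- [seq j <- l' | j \notin s]) (a j ^+ 2)%:E <=
    ((tau ^+ 2) *+ size [seq j <- l' | j \notin s])%:E)%E.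
  rewrite constE sumEFin lee_fin big_seq [leRHS]big_seq; apply: ler_sum => j.
  by rewrite mem_filter => /andP[js _]; rewrite lerXn2r ?nnegrE// tau_l.
have le2 : (((tau ^+ 2) *+ size [seq j <- s | j \notin l'])%:E <=
    \sum_(j <- [seq j <- s | j \notin l']) (a j ^+ 2)%:E)%E.
  rewrite constE sumEFin lee_fin big_seq [leRHS]big_seq; apply: ler_sum => j.
  by rewrite mem_filter => /andP[_ js]; rewrite lerXn2r ?nnegrE// tau_s.
apply: le_trans le1 (le_trans _ le2); rewrite lee_fin.
(* A full list is at least as long as the competitor, also after the common elements are removed;
   with threshold 0 both bounds vanish. *)
case: full => [->|sM]; first by rewrite expr0n !mul0rn.
apply: ler_wpMn2l; first exact: sqr_ge0.
rewrite !size_filter.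
have := count_predC (mem s) l'; have := count_predC (mem l') s.
have -> : count (mem s) l' = count (mem l') s.
  rewrite -!size_filter; apply/perm_size/uniq_perm; rewrite ?filter_uniq//.
  by move=> j; rewrite !mem_filter /= andbC.
move: sl; rewrite sM => sl e1 e2.
rewrite -(leq_add2l (count (mem l') s)); rewrite -e2 in sl; rewrite -e1 in sl.
exact: sl.
Qed.

End Arrangements.

Section Contractions.
Context {R : realType} {d : nat} {vt v1 : countType}.
Implicit Types (w : mindex d v1 -> R) (u v : stindex d vt v1 -> R) (i : 'I_d).

Lemma sqnorm_slices v : sqnorm v = (\esum_(t in [set: vt]) sqnorm (slice v t))%E.
Proof. exact: sqnorm_prodr. Qed.

Lemma l2_slice v t : l2 v -> l2 (slice v t).
Proof. exact: l2_row. Qed.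

Lemma esum_fibers i (A : set v1) (a : mindex d v1 -> \bar R) :
  (forall nu, (0 <= a nu)%E) ->
  (\esum_(nu in [set nu : mindex d v1 | A (nu i)]) a nu =
   \esum_(mu in A) \esum_(nu in [set nu : mindex d v1 | nu i = mu]) a nu)%E.
Proof.
move=> a0; rewrite esum_esum//.
rewrite (@reindex_esum R _ _ [set nu : mindex d v1 | A (nu i)] _ (fun nu => (nu i, nu)))//.
split.
- by move=> nu.
- by move=> x y _ _ [].
- by move=> [mu nu] /= [Amu numu]; exists nu; rewrite /= numu.
Qed.

Lemma sqnorm_restrict0 (I : choiceType) (A : set I) (f : I -> R) :
  sqnorm (restrict0 A f) = (\esum_(x in A) (f x ^+ 2)%:E)%E.
Proof.
rewrite [RHS]esum_mkcond; apply: eq_esum => x _; rewrite /restrict0 patchE.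
by case: ifP => // _; rewrite expr0n.
Qed.

Lemma l2_restrict0 (I : choiceType) (A : set I) (f : I -> R) : l2 f -> l2 (restrict0 A f).
Proof.
apply: le_lt_trans; rewrite sqnorm_restrict0; apply: le_esum_set => // x _.
by rewrite lee_fin sqr_ge0.
Qed.

Lemma mode_contractionE i w mu : l2 w -> (mode_contraction i w mu)%:E =
  l2norm (restrict0 [set nu : mindex d v1 | nu i = mu] w).
Proof.
move=> wl; rewrite l2normE; last exact: l2_restrict0.
by rewrite dot_selfE sqnorm_restrict0.
Qed.

Lemma mode_contraction_ge0 i w mu : 0 <= mode_contraction i w mu.
Proof. exact: sqrtr_ge0. Qed.

Lemma mode_contraction_sqr i w mu : l2 w -> ((mode_contraction i w mu) ^+ 2)%:E =
  (\esum_(nu in [set nu : mindex d v1 | nu i = mu]) (w nu ^+ 2)%:E)%E.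
Proof.
move=> wl; rewrite sqr_sqrtr.
  rewrite fineK// -sqnorm_restrict0; exact/l2_fin/l2_restrict0.
by rewrite fine_ge0// esum_ge0// => x _; rewrite lee_fin sqr_ge0.
Qed.

Lemma sqnorm_contraction i v : l2 v -> sqnorm (st_contraction i v) = sqnorm v.
Proof.
move=> vl; rewrite sqnorm_prodr sqnorm_slices; apply: eq_esum => t _.
have /= := @esum_fibers i setT (fun nu => (slice v t nu ^+ 2)%:E).
rewrite (_ : [set _ | True] = setT); last by apply/seteqP; split.
rewrite /sqnorm => ->; last by move=> nu; rewrite lee_fin sqr_ge0.
by apply: eq_esum => mu _; rewrite mode_contraction_sqr//; exact: l2_slice.
Qed.

(** On each fibre the reverse triangle inequality bounds the difference of contractions by the
    contraction of [u - v], and contractions preserve the norm. *)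
Lemma st_contraction_dist i u v : l2 u -> l2 v ->
  (l2norm (fun p => st_contraction i u p - st_contraction i v p)%R <=
   l2norm (fun p => u p - v p)%R)%E.
Proof.
move=> ul vl; have uvl := l2B ul vl.
rewrite /l2norm lee_sqrt ?sqnorm_ge0// -(sqnorm_contraction i uvl); apply: le_sqnorm => -[t mu].
rewrite /st_contraction /= [leRHS]ger0_norm ?mode_contraction_ge0//.
have uS := l2_slice t ul; have vS := l2_slice t vl.
have tri (x y : mindex d v1 -> R) : l2 x -> l2 y ->
    mode_contraction i x mu <= mode_contraction i (fun nu => x nu - y nu) mu + mode_contraction
      i y mu.
  move=> xl yl; rewrite -lee_fin EFinD !mode_contractionE//; last exact: l2B.
  apply: le_trans (l2normD _ _); rewrite le_eqVlt; apply/orP; left; apply/eqP.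
  congr sqrte; apply: eq_sqnorm => nu; rewrite /restrict0 !patchE.
  by case: ifP => _ /=; rewrite ?addr0 ?subrK.
have := tri _ _ uS vS; have := tri _ _ vS uS.
have -> : mode_contraction i (fun nu => slice v t nu - slice u t nu) mu =
    mode_contraction i (slice (fun p => u p - v p) t) mu.
  congr (Num.sqrt (fine _)); apply: eq_esum => nu _; rewrite /slice; congr EFin; ring.
have -> : mode_contraction i (fun nu => slice u t nu - slice v t nu) mu =
    mode_contraction i (slice (fun p => u p - v p) t) mu by [].
by move=> h1 h2; rewrite ler_norml; apply/andP; split; lra.
Qed.

(** An index outside the product set fails in at least one coordinate, so its entry is counted at
    least once in the sum over the modes. *)
Lemma product_error (f : nat -> option ('I_d * vt * v1)) N v : l2 v ->
  (l2norm (fun p => v p - restrict0 (product_set f N) v p)%R <= coarse_bound f v N)%E.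
Proof.
move=> vl; rewrite /l2norm /coarse_bound lee_sqrt; last first.
  apply: esum_ge0 => t _; apply: sume_ge0 => i _; apply: esum_ge0 => mu _.
  by rewrite lee_fin sqr_ge0.
rewrite sqnorm_slices; apply: le_esum => t _.
have vS := l2_slice t vl.
apply: (@le_trans _ _ (\sum_(i < d)
   \esum_(nu in [set nu : mindex d v1 | (~` first_set f N i t) (nu i)]) (slice v t nu ^+ 2)%:E)%E).
  under eq_bigr => i _ do rewrite esum_mkcond.
  rewrite -esum_sum; last by move=> nu i _ _; case: ifP => // _; rewrite lee_fin sqr_ge0.
  apply: le_esum => nu _; rewrite /slice /restrict0 patchE.
  case: ifPn => [_|]; first by rewrite subrr expr0n sume_ge0// => i _; case: ifP => // _;
    rewrite lee_fin sqr_ge0.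
  rewrite notin_setE => /existsNP[i ni]; rewrite subr0 (bigD1 i)//= ifT; last by rewrite inE.
  rewrite leeDl// sume_ge0// => j _; case: ifP => // _; by rewrite lee_fin sqr_ge0.
apply: lee_sum => i _; rewrite esum_fibers; last by move=> nu; rewrite lee_fin sqr_ge0.
by apply: le_esum => mu _; rewrite /st_contraction mode_contraction_sqr.
Qed.

Lemma coarse_boundE (f : nat -> option ('I_d * vt * v1)) N v :
  coarse_bound f v N = sqrte (\esum_(j in ~` listed f N)
    (st_contraction j.1.1 v (j.1.2, j.2) ^+ 2)%:E)%E.
Proof.
congr sqrte; rewrite [RHS]esum_mkcond.
pose F (i : 'I_d) t mu : \bar R := if (i, t, mu) \in ~` listed f N then
  (st_contraction i v (t, mu) ^+ 2)%:E else 0%E.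
have F0 i t mu : (0 <= F i t mu)%E by rewrite /F; case: ifP => // _; rewrite lee_fin sqr_ge0.
transitivity (\esum_(q in [set: ('I_d * vt) * v1]) F q.1.1 q.1.2 q.2); last first.
  by apply: eq_esum => -[[i t] mu].
rewrite (@esum_prod R _ _ (fun (q : 'I_d * vt) mu => F q.1 q.2 mu))//.
rewrite (@esum_prodC R _ _ (fun (i : 'I_d) t => \esum_(mu in [set: v1]) F i t mu)); last first.
  by move=> i t; exact: esum_ge0.
apply: eq_esum => t _; rewrite esum_ord; last by move=> i; exact: esum_ge0.
apply: eq_bigr => i _; rewrite esum_mkcond; apply: eq_esum => mu _.
rewrite /F; by congr (if _ then _ else _); apply/idP/idP; rewrite !inE.
Qed.

End Contractions.

(** * Approximation classes *)

Section NTermApproximation.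
Context {R : realType} {I : choiceType}.
Implicit Types (f h : I -> R) (L : set I).

Definition nterm_error f (N : nat) : \bar R :=
  ereal_inf [set l2norm (f \- restrict0 L f)%R | L in [set L : set I | (L #<= `I_N)%card]].

Lemma seq_card_le (l : seq I) N : (size l <= N)%N -> ([set` l] #<= `I_N)%card.
Proof.
move=> lN; have /finite_setP[n ln] := finite_seq l.
rewrite (card_le_eql ln) card_le_II -(card_fset_set ln); apply: leq_trans lN.
apply: uniq_leq_size; first exact: finmap.fset_uniq.
by move=> x; rewrite in_fset_set ?inE//; exact: finite_seq.
Qed.

Lemma card_le_seq L N : (L #<= `I_N)%card -> exists2 l : seq I, (size l <= N)%N & L = [set` l].
Proof.
move=> LN; have finL : finite_set L by apply: card_le_finite LN _; exact: finite_II.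
exists (finmap.enum_fset (fset_set L)); first exact: geq_card_fset_set.
by rewrite -[LHS](fset_setK finL).
Qed.

Lemma sub_restrict0E L f : (f \- restrict0 L f)%R = restrict0 (~` L) f.
Proof.
apply/funext => x; rewrite /restrict0 /= !patchE in_setC.
by case: (x \in L); rewrite /= ?subrr ?subr0.
Qed.

Lemma nterm_error_ge0 f N : (0 <= nterm_error f N)%E.
Proof. by apply: le_ereal_inf_tmp => _ [L _ <-]; exact: l2norm_ge0. Qed.

Lemma nterm_error_le_As (s : R) f N :
  ((N.+1%:R `^ s)%:E * nterm_error f N <= As_norm s f)%E.
Proof. by apply: ereal_sup_ubound; exists N. Qed.

Lemma As_norm_ge0 (s : R) f : (0 <= As_norm s f)%E.
Proof.
apply: le_trans (nterm_error_le_As s f 0).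
by rewrite mule_ge0 ?lee_fin ?powR_ge0 ?nterm_error_ge0.
Qed.

Lemma nterm_error_lt f N (c : \bar R) : (nterm_error f N < c)%E ->
  exists2 l : seq I, (size l <= N)%N & (l2norm (restrict0 (~` [set` l]) f) < c)%E.
Proof.
move=> /ereal_inf_lt[_ [L LN <-] Lc]; have [l lN LE] := card_le_seq LN.
by exists l => //; rewrite -LE -sub_restrict0E.
Qed.

Lemma nterm_error_supp f (l : seq I) N : (size l <= N)%N -> supp f `<=` [set` l] ->
  nterm_error f N = 0%E.
Proof.
move=> lN fl; apply/eqP; rewrite eq_le nterm_error_ge0 andbT.
apply: ge_ereal_inf; exists (l2norm (f \- restrict0 [set` l] f)%R).
  by exists [set` l] => //; exact: seq_card_le.
rewrite (_ : (_ \- _)%R = fun=> 0); first by rewrite /l2norm sqnorm0 sqrte0.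
apply/funext => x; rewrite /restrict0 /= patchE.
case: ifPn; first by rewrite subrr.
rewrite notin_setE subr0 => xl; apply/eqP; apply: contrapT => /negP fx; exact/xl/fl.
Qed.

Lemma nterm_error_dist f h N (c : R) : (l2norm (fun x => f x - h x)%R <= c%:E)%E ->
  (nterm_error f N <= nterm_error h N + c%:E)%E.
Proof.
move=> fhc; rewrite -leeBlDr//; apply: le_ereal_inf_tmp => _ [L LN <-].
rewrite leeBlDr//; apply: ge_ereal_inf; exists (l2norm (f \- restrict0 L f)%R); first by exists L.
rewrite !sub_restrict0E; apply: le_trans (leeD2l _ fhc).
apply: (@le_trans _ _ (l2norm (restrict0 (~` L) h) + l2norm (restrict0 (~` L) (fun x => f x - h
  x)%R))%E).
  apply: le_trans (l2normD _ _); rewrite le_eqVlt; apply/orP; left; apply/eqP.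
  congr sqrte; apply: eq_sqnorm => x; rewrite /restrict0 !patchE.
  by case: ifP => _ /=; rewrite ?addr0// addrC subrK.
apply: leeD2l; apply: le_l2norm; rewrite sqnorm_restrict0; apply: le_esum_set => // x _.
by rewrite lee_fin sqr_ge0.
Qed.

End NTermApproximation.

(** Write x^p = x x^(p - 1) and bound the second factor by the power of the whole sum. *)
Lemma sum_powR_le (R : realType) n (p : R) (x : 'I_n -> R) : 1 <= p ->
  (forall i, 0 <= x i) -> \sum_(i < n) x i `^ p <= (\sum_(i < n) x i) `^ p.
Proof.
move=> p1 x0; set X := \sum_(i < n) x i.
have X0 : 0 <= X by exact: sumr_ge0.
have powE (y : R) : 0 <= y -> y `^ p = y * y `^ (p - 1).
  rewrite le_eqVlt => /orP[/eqP <-|y0]; first by rewrite mul0r powR0// gt_eqF// (lt_le_trans ltr01).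
  by rewrite -{2}(powRr1 (ltW y0)) -powRD ?(gt_eqF y0) ?implybT// addrC subrK.
rewrite (powE X)// mulr_suml; apply: ler_sum => i _; rewrite powE// ler_wpM2l//.
by rewrite ge0_ler_powR ?nnegrE ?subr_ge0// /X (bigD1 i)//= lerDl sumr_ge0.
Qed.

(** * Hierarchical rank approximation, recompression and coarsening indices *)

Section RankApproximation.
Context {R : realType} {d : nat} {vt v1 : countType}.
Variables (T : {set {set 'I_d}}) (rep : {set {set 'I_d}} -> {set 'I_d}).
Hypotheses (hT : dimension_tree T) (hrep : edge_representer T rep) (hd : (2 <= d)%N).
Implicit Types (u v w x : stindex d vt v1 -> R) (r : vt -> @rankvec R d).

Lemma rank_le_rankmax (r : @rankvec R d) e : e \in edges T -> (r e <= rankmax T r)%E.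
Proof. by move=> eT; rewrite /rankmax (bigmaxD1 e)//= le_max lexx. Qed.

Lemma rank_le_sup r t e : e \in edges T -> (r t e <= rank_sup T r)%E.
Proof.
move=> eT; apply: le_trans (rank_le_rankmax _ eT) _.
by apply: ereal_sup_ubound; exists t.
Qed.

Lemma rank_sup_mono r r' : (forall t e, e \in edges T -> (r t e <= r' t e)%E) ->
  (rank_sup T r <= rank_sup T r')%E.
Proof.
move=> rr; apply: ge_ereal_sup => _ [t _ <-].
apply: (@le_trans _ _ (rankmax T (r' t))); last by apply: ereal_sup_ubound; exists t.
rewrite /rankmax; elim/big_rec2: _ => // e y z eT yz.
by rewrite ge_max !le_max rr//= yz orbT.
Qed.

(** Feasible ranks are ranks of actual tensors, so they are natural or infinite, and the bound
    excludes the latter. *)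
Lemma feasible_nat r n : feasible_family v1 T rep r -> (rank_sup T r <= (n%:R)%:E)%E ->
  exists rho : vt -> {set {set 'I_d}} -> nat,
    forall t e, e \in edges T -> r t e = ((rho t e)%:R)%:E.
Proof.
move=> feas rn.
have rP t e : exists m : nat, e \in edges T -> r t e = (m%:R)%:E.
  have [eT|eT] := boolP (e \in edges T); last by exists 0%N.
  have [w _ wE] := feas t; have rE := wE e eT.
  have := le_trans (rank_le_sup r t eT) rn; rewrite rE /hrank.
  by have [->|[m [-> _]] _] := rank_dichotomy (mat (rep e) w); [|exists m].
have rP' t : exists rho : {set {set 'I_d}} -> nat,
    forall e, e \in edges T -> r t e = ((rho e)%:R)%:E by have [f fP] := choice (rP t); exists f.
by have [rho rhoP] := choice rP'; exists rho.
Qed.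

(** In each slice, Eckart-Young bounds the tail at every edge by the same squared distance; adding
    over the 2d - 3 edges gives the factor. *)
Lemma trunc_bound_le r v w (c : R) : 0 <= c ->
  l2 v -> (forall t a, a \in T -> a != [set: 'I_d]%SET ->
    exists U V, is_svd (mat a (slice v t)) (sing_vals (mat a (slice v t))) U V) ->
  Fset T rep r w -> (l2norm (fun p => v p - w p)%R <= c%:E)%E ->
  (trunc_bound T rep r v <= (Num.sqrt (2 * d%:R - 3) * c)%:E)%E.
Proof.
move=> c0 vl svd [wl wr]; rewrite (l2norm_le_fin _ c0) => vwc.
have k0 : 0 <= (2 * d%:R - 3 : R).
  have : (2%:R : R) <= d%:R by rewrite ler_nat.
  by lra.
have kc0 : 0 <= Num.sqrt (2 * d%:R - 3) * c by rewrite mulr_ge0// sqrtr_ge0.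
rewrite /trunc_bound -[X in (_ <= X)%E](_ : sqrte ((Num.sqrt (2 * d%:R - 3) * c) ^+ 2)%:E = _);
  last first.
  by rewrite /= sqrtr_sqr ger0_norm.
rewrite lee_sqrt ?lee_fin ?sqr_ge0// exprMn sqr_sqrtr//.
apply: (@le_trans _ _ ((2 * d%:R - 3)%:E * sqnorm (fun p => v p - w p)%R)%E); last first.
  by rewrite EFinM lee_wpmul2l// lee_fin.
rewrite sqnorm_slices -esumZl//; last by move=> t _; exact: sqnorm_ge0.
apply: le_esum => t _.
have -> : (2 * d%:R - 3 : R) = #|edges T|%:R.
  have := card_edges hT hrep hd => /(congr1 (fun n => n%:R : R)).
  by rewrite natrD natrM; lra.
apply: (@le_trans _ _ (\sum_(e in edges T) sqnorm (slice (fun p => v p - w p)%R t))%E); last first.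
  rewrite (eq_bigr (fun _ => (1%:E * sqnorm (slice (fun p => v p - w p)%R t))%E));
    last by move=> e _; rewrite mul1e.
  rewrite -ge0_sume_distrl; last by move=> *; rewrite lee_fin.
  by rewrite sumEFin sumr_const.
apply: lee_sum => e eT; have [_ reT] := hrep eT.
have [U [V svdE]] := svd t (rep e) reT (rep_not_root hT hrep eT).
have := (wr t).2 e eT; rewrite /hrank.
have [->|[m [mE _]]] := rank_dichotomy (mat (rep e) (slice w t)).
  (* An infinite rank leaves no singular value to discard. *)
  rewrite leye_eq => /eqP ->; rewrite (_ : [set k : nat | _] = set0).
    by rewrite esum_set0 sqnorm_ge0.
  by apply/seteqP; split => k //=; rewrite leye_eq.
rewrite mE => mr.
have := @eckart_young _ _ _ _ (mat (rep e) (slice w t)) _ _ _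
  (l2_mat (rep e) (l2_slice t vl)) (l2_mat (rep e) (l2_slice t wl)) svdE m.
rewrite mE lexx => /(_ isT) ey.
apply: le_trans (le_trans ey _).
  apply: le_esum_set => [k _|k /= /(le_trans mr)]; first by rewrite lee_fin sqr_ge0.
  by rewrite lee_fin ler_nat.
by rewrite (sqnorm_mat (rep e)).
Qed.

End RankApproximation.

Section BestRankErrors.
Context {R : realType} {d : nat} {vt v1 : countType}.
Variables (T : {set {set 'I_d}}) (rep : {set {set 'I_d}} -> {set 'I_d}).
Implicit Types (u v w x : stindex d vt v1 -> R) (r : vt -> @rankvec R d).

Lemma best_error_ge0 u n : (0 <= best_error T rep u n)%E.
Proof. by apply: le_ereal_inf_tmp => _ [w _ <-]; exact: l2norm_ge0. Qed.

Lemma best_error_le_A (g : nat -> R) u n :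
  ((g n)%:E * best_error T rep u n <= A_norm T rep g u)%E.
Proof. by apply: ereal_sup_ubound; exists n. Qed.

Lemma A_norm_ge0 (g : nat -> R) u : 0 <= g 0%N -> (0 <= A_norm T rep g u)%E.
Proof.
move=> g0; apply: le_trans (best_error_le_A g u 0).
by rewrite mule_ge0// best_error_ge0.
Qed.

Lemma best_error_lt u n (c : \bar R) : (best_error T rep u n < c)%E ->
  exists r w, [/\ feasible_family v1 T rep r, (rank_sup T r <= (n%:R)%:E)%E,
    Fset T rep r w & (l2norm (fun p => u p - w p)%R < c)%E].
Proof. by move=> /ereal_inf_lt[_ [w [r [h1 h2 h3]] <-] wc]; exists r, w. Qed.

Lemma best_error_le u n r w : feasible_family v1 T rep r ->
  (rank_sup T r <= (n%:R)%:E)%E -> Fset T rep r w ->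
  (best_error T rep u n <= l2norm (fun p => u p - w p)%R)%E.
Proof.
move=> h1 h2 h3; apply: ge_ereal_inf; exists (l2norm (u \- w)%R) => //.
by exists w => //; exists r.
Qed.

Lemma best_error_eq0 w n : l2 w -> (rank_infty T rep w <= (n%:R)%:E)%E ->
  best_error T rep w n = 0%E.
Proof.
move=> wl wn; apply/eqP; rewrite eq_le best_error_ge0 andbT.
have -> : 0%E = l2norm (fun p => w p - w p)%R :> \bar R.
  rewrite (_ : (fun p => _) = fun=> 0); first by rewrite /l2norm sqnorm0 sqrte0.
  by apply/funext => p; rewrite subrr.
apply: (@best_error_le _ _ (fun t => hrank rep (slice w t))) => //.
  by move=> t; exists (slice w t) => //; exact: l2_slice.
by split=> // t; split => //; exact: l2_slice.
Qed.

Section ProductRestriction.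
Variables (f : nat -> option ('I_d * vt * v1)) (N : nat).

Let P := product_set f N.

(** The indicator of a product set is the product of a function of the row index and one of the
    column index, so matricisations are merely rescaled. *)
Lemma hrank_restrict x t e :
  (hrank rep (slice (restrict0 P x) t) e <= hrank rep (slice x t) e)%E.
Proof.
set a := rep e.
pose chi (b : {set 'I_d}) (mu : pindex v1 b) : R :=
  `[< forall i : subcoord b, first_set f N (val i) t (mu i) >]%:R.
apply: (@rank_rescale _ _ _ (@chi a) (@chi (~: a)%SET)) => mu nu.
rewrite /mat /slice /restrict0 patchE.
have inP : ((t, midx_glue mu nu) \in P) =
    `[< forall i : subcoord a, first_set f N (val i) t (mu i) >] &&
    `[< forall i : subcoord (~: a)%SET, first_set f N (val i) t (nu i) >].
  apply/idP/andP.
    rewrite inE => h; split; apply/asboolP => i.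
      have ia : val i \in a by exact: valP i.
      by have := h (val i); rewrite /= (midx_glue_in _ _ ia); congr (first_set _ _ _ _ (mu _));
        exact: val_inj.
    have ia : val i \in (~: a)%SET by exact: valP i.
    by have := h (val i); rewrite /= (midx_glue_out _ _ ia); congr (first_set _ _ _ _ (nu _));
      exact: val_inj.
  move=> [/asboolP h1 /asboolP h2]; rewrite inE => i /=.
  have [ia|ia] := boolP (i \in a); first by rewrite (midx_glue_in _ _ ia);
    exact: (h1 (exist _ i ia)).
  have iaC : i \in (~: a)%SET by rewrite inE.
  by rewrite (midx_glue_out _ _ iaC); exact: (h2 (exist _ i iaC)).
rewrite inP /chi; case: `[< _ >]; case: `[< _ >] => /=;
  by rewrite ?mulr1 ?mul1r ?mul0r ?mulr0 ?mul0r.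
Qed.

Lemma Fset_restrict r x : Fset T rep r x -> Fset T rep r (restrict0 P x).
Proof.
move=> [xl xr]; have Rl := @l2_restrict0 R (stindex d vt v1) P x xl; split => // t.
split; first exact: l2_slice.
by move=> e eT; apply: le_trans (hrank_restrict _ _ _) ((xr t).2 e eT).
Qed.

Lemma restrict_dist x y : (l2norm (fun p => restrict0 P x p - restrict0 P y p)%R <=
  l2norm (fun p => x p - y p)%R)%E.
Proof.
apply: le_l2norm; apply: le_sqnorm => p; rewrite /restrict0 !patchE.
by case: ifP => //= _; rewrite subrr normr0 normr_ge0.
Qed.

(** A competitor for [u], restricted to the product set, keeps its rank bounds and thus competes for
    the restriction of [x]. *)
Lemma best_error_restrict u x n (c : R) : (l2norm (fun p => x p - u p)%R <= c%:E)%E ->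
  (best_error T rep (restrict0 P x) n <= best_error T rep u n + c%:E)%E.
Proof.
move=> xu; rewrite -leeBlDr//; apply: le_ereal_inf_tmp => _ [w [r [h1 h2 h3]] <-].
rewrite leeBlDr//; apply: le_trans (best_error_le _ h1 h2 (Fset_restrict h3)) _.
apply: le_trans (restrict_dist _ _) _.
by rewrite addeC; apply: le_trans (l2norm_sub_trans _ u _) _; apply: leeD.
Qed.

Lemma supp_contraction_restrict i x :
  supp (st_contraction i (restrict0 P x)) `<=` [set p | listed f N (i, p.1, p.2)].
Proof.
move=> [t mu] /= /eqP h; apply: contrapT => nl; apply: h.
rewrite /st_contraction /mode_contraction esum1 ?sqrtr0// => nu /= numu.
rewrite /slice /restrict0 patchE ifF ?expr0n//.
apply/negP; rewrite inE => /(_ i) /=; rewrite numu => -[n nN fn].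
by apply: nl; exists n.
Qed.

Lemma sum_size_listing : exists l : 'I_d -> seq (vt * v1),
  (\sum_(i < d) size (l i) <= N)%N /\
  forall i x, supp (st_contraction i (restrict0 P x)) `<=` [set` l i].
Proof.
exists (fun i => [seq (j.1.2, j.2) | j <- listing f N & j.1.1 == i]); split.
  apply: leq_trans (size_listing f N); under eq_bigr do rewrite size_map size_filter -sum1_count.
  by rewrite (exchange_big_dep xpredT)//= -sum1_size; apply: leq_sum => j _;
    rewrite (eq_bigl (pred1 j.1.1)) ?big_pred1_eq// => i /=; rewrite eq_sym.
move=> i x p /supp_contraction_restrict /= pl; apply/mapP.
exists (i, p.1, p.2); last by case: p {pl}.
by rewrite mem_filter eqxx mem_listing; apply/asboolP.
Qed.

End ProductRestriction.

(** The lists together form one competitor to the first indices of the arrangement. Its remainder is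
    at most sqrt d times c, so that many listed indices meet the tolerance, and [N] is minimal. *)
Lemma coarsening_index f N x (tol c : R) (l : 'I_d -> seq (vt * v1)) :
  arrangement (fun j : 'I_d * vt * v1 => st_contraction j.1.1 x (j.1.2, j.2)) f ->
  (forall M, (coarse_bound f x M <= tol%:E)%E -> (N <= M)%N) ->
  0 <= c -> Num.sqrt d%:R * c <= tol ->
  (forall i, (l2norm (restrict0 (~` [set` l i]) (st_contraction i x)) <= c%:E)%E) ->
  (N <= \sum_(i < d) size (l i))%N.
Proof.
move=> arr Nmin c0 ctol lc; apply: Nmin; rewrite coarse_boundE.
pose L : seq ('I_d * vt * v1) := flatten [seq [seq (i, p.1, p.2) | p <- l i] | i <- index_enum
  'I_d].
have memL i t mu : ((i, t, mu) \in L) = ((t, mu) \in l i).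
  apply/flattenP/idP => [[_ /mapP[j _ ->] /mapP[[t' mu'] h [-> -> ->]]] //|h].
  exists [seq (i, p.1, p.2) | p <- l i]; first by apply: map_f; rewrite mem_index_enum.
  by apply/mapP; exists (t, mu).
have sL : (size L <= \sum_(i < d) size (l i))%N.
  rewrite size_flatten /shape -map_comp sumnE big_map; apply: leq_sum => i _ /=.
  by rewrite size_map.
have tol0 : 0 <= tol by apply: le_trans ctol; rewrite mulr_ge0// sqrtr_ge0.
have -> : tol%:E = sqrte (tol ^+ 2)%:E by rewrite /= sqrtr_sqr ger0_norm.
rewrite lee_sqrt ?lee_fin ?sqr_ge0//.
have a0 (j : 'I_d * vt * v1) : 0 <= st_contraction j.1.1 x (j.1.2, j.2) by exact:
  mode_contraction_ge0.
apply: le_trans (listed_best a0 arr sL) _.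
pose F (i : 'I_d) (p : vt * v1) : \bar R := if p \in ~` [set` l i] then
  (st_contraction i x p ^+ 2)%:E else 0%E.
have F0 i p : (0 <= F i p)%E by rewrite /F; case: ifP => // _; rewrite lee_fin sqr_ge0.
rewrite esum_mkcond (@reindex_esum R _ _ setT setT (fun q : 'I_d * (vt * v1) => (q.1, q.2.1,
  q.2.2))); last first.
  split => //; first by move=> [i [t mu]] [i' [t' mu']] _ _ [-> -> ->].
  by move=> [[i t] mu] _; exists (i, (t, mu)).
have -> : (\esum_(q in [set: 'I_d * (vt * v1)])
    (if (q.1, q.2.1, q.2.2) \in ~` [set` L] then
      (st_contraction q.1 x (q.2.1, q.2.2) ^+ 2)%:E else 0) =
    \esum_(q in [set: 'I_d * (vt * v1)]) F q.1 q.2)%E.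
  apply: eq_esum => -[i [t mu]] _ /=; rewrite /F; congr (if _ then _ else _).
  by apply/idP/idP; rewrite !inE /= memL.
rewrite esum_prod// esum_ord; last by move=> i; exact: esum_ge0.
apply: (@le_trans _ _ (\sum_(i < d) (c ^+ 2)%:E)%E).
  apply: lee_sum => i _; have := lc i; rewrite (l2norm_le_fin _ c0) sqnorm_restrict0.
  by rewrite [X in (X <= _)%E]esum_mkcond.
rewrite sumEFin lee_fin sumr_const card_ord.
apply: (@le_trans _ _ ((Num.sqrt d%:R * c) ^+ 2)).
  by rewrite exprMn sqr_sqrtr// mulr_natl.
by rewrite lerXn2r ?nnegrE// mulr_ge0// sqrtr_ge0.
Qed.

Hypotheses (hT : dimension_tree T) (hrep : edge_representer T rep) (hd : (2 <= d)%N).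

Section Recompression.
Variables (v x : stindex d vt v1 -> R) (eta : R) (r : vt -> @rankvec R d).
Hypothesis vl : l2 v.
Hypothesis rmin : min_rank_family T rep v eta r.
Hypothesis trunc : forall t, hsvd_truncation T (r t) (slice v t) (slice x t).

(* Eckart-Young transfers an approximation of u to a feasible family for v. *)
Lemma min_rank_le u n (c e : R) : 0 <= c -> 0 < e ->
  eta = Num.sqrt (2 * d%:R - 3) * (e + c) ->
  (l2norm (fun p => v p - u p)%R <= c%:E)%E -> (best_error T rep u n < e%:E)%E ->
  (rank_sup T r <= (n%:R)%:E)%E.
Proof.
move=> c0 e0 etaE vu /best_error_lt[r' [w [feas rn Fw uw]]].
case: rmin => _ _ rmin'; apply: le_trans rn; apply: rmin' => //.
rewrite etaE; apply: (trunc_bound_le hT hrep hd _ vl _ Fw).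
- by rewrite addr_ge0// ltW.
- by move=> t a aT aN; exact: truncation_svd (trunc t) aT aN.
- rewrite addrC EFinD; apply: le_trans (l2norm_sub_trans _ u _) _.
  by apply: leeD => //; exact: ltW.
Qed.

Lemma recompression_error n : (rank_sup T r <= (n%:R)%:E)%E ->
  (l2norm (fun p => v p - x p)%R <= eta%:E)%E.
Proof.
move=> rn; case: rmin => feas tb _; have [rho rhoE] := feasible_nat feas rn.
apply: le_trans tb; rewrite /l2norm /trunc_bound lee_sqrt.
  rewrite sqnorm_slices; apply: le_esum => t _.
  exact: (truncation_error hT hrep hd (rhoE t) (l2_slice t vl) (trunc t)).
apply: esum_ge0 => t _; apply: sume_ge0 => e _; apply: esum_ge0 => k _.
by rewrite lee_fin sqr_ge0.
Qed.

Lemma recompression_rank n t e : (rank_sup T r <= (n%:R)%:E)%E -> e \in edges T ->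
  (hrank rep (slice x t) e <= r t e)%E.
Proof.
move=> rn eT; case: rmin => feas _ _; have [rho rhoE] := feasible_nat feas rn.
exact: (truncation_rank hT hrep (rhoE t) (trunc t) eT).
Qed.

End Recompression.
End BestRankErrors.

(** * Growth sequences, decay of N-term errors and sums of powers *)

Section GrowthSequences.
Context {R : realType}.
Variable g : nat -> R.
Hypothesis hg : growth_sequence g.

(** Divergence of [g] and well-ordering provide a least index, so the default value in [growth_inv]
    is not what is returned by failure. *)
Lemma growth_inv_ge (x : R) : x <= g (growth_inv g x).
Proof.
case: hg => _ _ _ goo; have [n xn] : exists n, x <= g n.
  by have /cvgryPge/(_ x)[n _ h] := goo; exists n; exact: (h n (leqnn n)).
have [m xm mmin] := ex_minnP (ex_intro (fun n => x <= g n) n xn).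
by have [] := @xgetPex _ 0%N [set n | x <= g n /\ forall m, x <= g m -> (n <= m)%N]
  (ex_intro _ m (conj xm mmin)).
Qed.

Lemma growth_ratio_gt1 : (growth_ratio g < +oo)%E ->
  growth_ratio g \is a fin_num /\ 1 < fine (growth_ratio g).
Proof.
move=> fin; case: hg => g0 ginc g00 _.
have h : ((g 1%N)%:E <= growth_ratio g)%E.
  by apply: ereal_sup_ubound; exists 0%N => //; rewrite g00 divr1.
have g1 : 1 < g 1%N by rewrite -g00; exact: ginc.
have rf : growth_ratio g \is a fin_num.
  rewrite ge0_fin_numE//; apply: le_trans h; rewrite lee_fin.
  exact: ltW (g0 1%N).
by split => //; rewrite -lte_fin fineK// (lt_le_trans _ h).
Qed.

End GrowthSequences.

Section DecayClasses.
Context {R : realType} {I : choiceType}.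

(** With N the integer part of y = (A / q)^(1/s), (N + 1)^s exceeds A / q, so the N-term error is
    strictly below q. Strictness provides an actual index set although the infimum need not be
    attained. *)
Lemma nterm_support (s q : R) (f : I -> R) : 0 < s -> 0 < q -> As_norm s f \is a fin_num ->
  exists2 l : seq I, (size l)%:R <= (fine (As_norm s f) / q) `^ s^-1 &
    (l2norm (restrict0 (~` [set` l]) f) <= q%:E)%E.
Proof.
move=> s0 q0 fin; set A := fine (As_norm s f); set y := _ `^ _.
have A0 : 0 <= A by rewrite fine_ge0// As_norm_ge0.
have y0 : 0 <= y by exact: powR_ge0.
have /andP[Ny yN] := truncn_itv y0.
have [|l lN lq] := @nterm_error_lt R I f (Num.truncn y) q%:E.
  rewrite ltNge; apply/negP => qn.
  have : (((Num.truncn y).+1%:R `^ s * q)%:E <= As_norm s f)%E.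
    apply: le_trans (nterm_error_le_As s f (Num.truncn y)).
    by rewrite EFinM lee_wpmul2l// lee_fin powR_ge0.
  rewrite -(fineK fin) lee_fin -/A -ler_pdivlMr// leNgt => /negP; apply.
  have -> : A / q = y `^ s.
    by rewrite /y -powRrM mulVf ?gt_eqF// powRr1// divr_ge0// ltW.
  by rewrite gt0_ltr_powR// nnegrE.
by exists l; [rewrite (le_trans _ Ny)// ler_nat|exact: ltW].
Qed.

(** Once n reaches the length of the list the error of [f] is zero; below it, n + 1 is at most this
    length, which bounds the weight of the perturbation. *)
Lemma As_norm_perturb (s delta : R) (f h : I -> R) (l : seq I) : 0 <= s -> 0 <= delta ->
  supp f `<=` [set` l] -> (l2norm (fun x => f x - h x)%R <= delta%:E)%E ->
  (As_norm s f <= As_norm s h + ((size l)%:R `^ s * delta)%:E)%E.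
Proof.
move=> s0 delta0 fl fh; apply: ge_ereal_sup => _ [n _ <-]; rewrite -/(nterm_error f n).
have [ln|nl] := leqP (size l) n.
  rewrite (nterm_error_supp ln fl) mule0 adde_ge0 ?As_norm_ge0//.
  by rewrite lee_fin mulr_ge0// powR_ge0.
apply: (@le_trans _ _ ((n.+1%:R `^ s)%:E * (nterm_error h n + delta%:E))%E).
  by rewrite lee_wpmul2l ?lee_fin ?powR_ge0//; exact: nterm_error_dist.
rewrite ge0_muleDr ?nterm_error_ge0//; apply: leeD; first exact: nterm_error_le_As.
by rewrite -EFinM lee_fin ler_wpM2r// ge0_ler_powR ?nnegrE// ler_nat.
Qed.

End DecayClasses.

Section PowerSums.
Context {R : realType}.
Variables (d : nat) (s q : R) (A : 'I_d -> R).
Hypotheses (s0 : 0 < s) (q0 : 0 < q) (A0 : forall i, 0 <= A i).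

Lemma sum_powR_inv_le :
  \sum_(i < d) (A i / q) `^ s^-1 <= d%:R * ((\sum_(i < d) A i) / q) `^ s^-1.
Proof.
rewrite -[X in X%:R * _](card_ord d) mulr_natl -sumr_const; apply: ler_sum => i _.
have q0' := ltW q0; have s0' := ltW s0.
rewrite ge0_ler_powR ?nnegrE ?invr_ge0// ?divr_ge0 ?sumr_ge0//.
by rewrite ler_pM2r ?invr_gt0// (bigD1 i)//= lerDl sumr_ge0.
Qed.

(** For s >= 1 the power is superadditive and the sum of the [K i] is bounded with a factor d,
    giving d^s. For s < 1 the exponent 1/s is the superadditive one: each [K i] is at most (S /
    q)^(1/s), and the d terms give d^1. *)
Lemma sum_powR_max_le (K : 'I_d -> R) : (forall i, 0 <= K i) ->
  \sum_(i < d) K i <= \sum_(i < d) (A i / q) `^ s^-1 ->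
  \sum_(i < d) K i `^ s <= d%:R `^ Num.max 1 s * ((\sum_(i < d) A i) / q).
Proof.
move=> K0 KA; set S := \sum_(i < d) A i.
have S0 : 0 <= S / q by rewrite divr_ge0 ?sumr_ge0 ?ltW.
have Kle i : K i <= \sum_(i < d) K i by rewrite (bigD1 i)//= lerDl sumr_ge0.
have KS0 : 0 <= \sum_(i < d) K i by exact: sumr_ge0.
have powK (x : R) : 0 <= x -> (x `^ s^-1) `^ s = x.
  by move=> x0; rewrite -powRrM mulVf ?gt_eqF// powRr1.
have [s1|s1] := leP 1 s.
  apply: le_trans (sum_powR_le s1 K0) _.
  apply: (@le_trans _ _ ((d%:R * (S / q) `^ s^-1) `^ s)); last first.
    by rewrite powRM ?powR_ge0// powK.
  rewrite ge0_ler_powR ?nnegrE ?(ltW s0)// ?mulr_ge0 ?powR_ge0//.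
  exact: le_trans KA sum_powR_inv_le.
rewrite powRr1// -[d in leRHS]card_ord mulr_natl -sumr_const; apply: ler_sum => i _.
rewrite -[leRHS]powK// ge0_ler_powR ?nnegrE ?(ltW s0)// ?powR_ge0//.
apply: le_trans (Kle i) (le_trans KA _).
rewrite /S mulr_suml; apply: sum_powR_le; last by move=> j; rewrite divr_ge0// ltW.
by rewrite invf_ge1// ltW.
Qed.

End PowerSums.

(** * Error, rank, support and approximation-class bounds for the combined reduction *)

Unset Implicit Arguments.

Theorem theorem3p13 (R : realType) (d : nat) (vt v1 : countType)
  (T : {set {set 'I_d}}) (rep : {set {set 'I_d}} -> {set 'I_d})
  (hd : (2 <= d)%N) (hT : dimension_tree T) (hrep : edge_representer T rep)
  (u v : stindex d vt v1 -> R) (g : nat -> R) (s eta alpha : R)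
  (hu2 : l2 u) (hv2 : l2 v)
  (hg : admissible g) (hu : Aclass T rep g u)
  (hs : 0 < s) (hpi : forall i : 'I_d, As_class s (st_contraction i u))
  (heta : 0 < eta) (huv : (l2norm (u \- v)%R <= eta%:E)%E)
  (halpha : 0 < alpha) :
  let kP : R := Num.sqrt (2 * d%:R - 3) in
  let kC : R := Num.sqrt d%:R in
  let C0 : R := 1 + kP * (1 + alpha) + kC * (kP + 1) * (1 + alpha) in
  let C1 : R := alpha^-1 * (1 + kP * (1 + alpha)) + 1 in
  let C2 : R := 2 `^ s * (1 + 2 `^ s)
                + 2 `^ (3 * s) * alpha^-1 * C0 * d%:R `^ (Num.max 1 s) in
  forall v' w : stindex d vt v1 -> R,
  recompression T rep (kP * (1 + alpha) * eta) v v' ->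
  coarsening (kC * (kP + 1) * (1 + alpha) * eta) v' w ->
  [/\ (l2norm (u \- w)%R <= (C0 * eta)%:E)%E,
      (rank_infty T rep w <=
         ((growth_inv g (fine (growth_ratio g) * fine (A_norm T rep g u)
                         / (alpha * eta)))%:R)%:E)%E,
      (A_norm T rep g w <= C1%:E * A_norm T rep g u)%E,
      (\sum_(i < d) counting (supp (st_contraction i w)) <=
         (2 * eta `^ (- s^-1) * d%:R * alpha `^ (- s^-1))%:E
         * (\sum_(i < d) As_norm s (st_contraction i u)) `^ (s^-1))%E &
      (\sum_(i < d) As_norm s (st_contraction i w) <=
         C2%:E * \sum_(i < d) As_norm s (st_contraction i u))%E].
Proof.
move=> kP kC C0 C1 C2 v' w [r rmin trunc] [f [N [arr tolN Nmin wE]]].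
have [gseq gfin] := hg; have [gpos _ g00 _] := gseq.
have kP0 : 0 <= kP by exact: sqrtr_ge0.
have kC0 : 0 <= kC by exact: sqrtr_ge0.
have q0 : 0 < alpha * eta by exact: mulr_gt0.
have cP0 : 0 <= kP * (1 + alpha) by rewrite mulr_ge0// addr_ge0// ltW.
have cC0 : 0 <= kC * (kP + 1) * (1 + alpha).
  by rewrite !mulr_ge0// ?addr_ge0// ltW.
have C00 : 0 <= C0 by rewrite /C0 !addr_ge0.
have uv : (l2norm (fun p => u p - v p)%R <= eta%:E)%E := huv.
have vu : (l2norm (fun p => v p - u p)%R <= eta%:E)%E by rewrite l2norm_subC.
have Afin : A_norm T rep g u \is a fin_num.
  by rewrite ge0_fin_numE; [exact: hu.2|rewrite A_norm_ge0// ltW].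
set A := fine (A_norm T rep g u); have AE : A_norm T rep g u = A%:E by rewrite fineK.
have A0 : 0 <= A by rewrite fine_ge0// A_norm_ge0// ltW.
have etaE : kP * (1 + alpha) * eta = kP * (alpha * eta + eta) by ring.
have rank_or n : (rank_sup T r <= (n%:R)%:E)%E \/ g n * (alpha * eta) <= A.
  have [lt|ge] := ltP (best_error T rep u n) (alpha * eta)%:E; [left|right].
    exact: (min_rank_le hT hrep hd hv2 rmin trunc (ltW heta) q0 etaE vu lt).
  rewrite -lee_fin -AE; apply: le_trans (best_error_le_A T rep g u n).
  by rewrite EFinM lee_wpmul2l// lee_fin ltW.
have [rfin rho1] := growth_ratio_gt1 gseq gfin.
set n0 := growth_inv g _.
have rn0 : (rank_sup T r <= (n0%:R)%:E)%E.
  (* Otherwise rho A <= g(n0) alpha eta <= A with rho > 1, so A <= 0, against g(n0) alpha eta >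
     0. *)
  have [//|gA] := rank_or n0; exfalso.
  have := growth_inv_ge gseq (fine (growth_ratio g) * A / (alpha * eta)).
  rewrite -/n0 ler_pdivrMr// => h; have : A <= 0.
    by have := le_trans h gA; nra.
  have : 0 < g n0 * (alpha * eta) by rewrite mulr_gt0.
  by lra.
have vv' := recompression_error hT hrep hd hv2 rmin trunc rn0.
have v'l : l2 v'.
  have dl : l2 (fun p => v p - v' p).
    have c0 : 0 <= kP * (1 + alpha) * eta by rewrite mulr_ge0// ltW.
    by move: vv'; rewrite (l2norm_le_fin _ c0) => /le_lt_trans; apply; rewrite ltry.
  rewrite (_ : v' = fun p => v p - (v p - v' p)); first exact: (l2B hv2 dl).
  by apply/funext => p; rewrite subKr.
have uv' : (l2norm (fun p => v' p - u p)%R <= ((1 + kP * (1 + alpha)) * eta)%:E)%E.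
  apply: le_trans (l2norm_sub_trans v' v u) _; rewrite l2norm_subC.
  rewrite (_ : _ * eta = kP * (1 + alpha) * eta + eta); last by ring.
  by rewrite EFinD; exact: leeD.
have v'w : (l2norm (fun p => v' p - w p)%R <= (kC * (kP + 1) * (1 + alpha) * eta)%:E)%E.
  by rewrite wE; apply: le_trans (product_error f N v'l) tolN.
have uw : (l2norm (fun p => u p - w p)%R <= (C0 * eta)%:E)%E.
  apply: le_trans (l2norm_sub_trans u v' w) _; rewrite l2norm_subC.
  rewrite (_ : C0 * eta = (1 + kP * (1 + alpha)) * eta + kC * (kP + 1) * (1 + alpha) * eta);
    last first.
    by rewrite /C0; ring.
  by rewrite EFinD; exact: leeD.
have wl : l2 w by rewrite wE; exact: l2_restrict0.
have rank_w n : (rank_sup T r <= (n%:R)%:E)%E -> (rank_infty T rep w <= (n%:R)%:E)%E.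
  move=> rn; apply: le_trans rn; apply: rank_sup_mono => t e eT.
  rewrite wE; apply: le_trans (hrank_restrict _ _ _ _ _ _) _.
  exact: (recompression_rank hT hrep rmin trunc t rn0 eT).
pose a i := fine (As_norm s (st_contraction i u)).
have afin i : As_norm s (st_contraction i u) \is a fin_num.
  by rewrite ge0_fin_numE ?As_norm_ge0//; exact: (hpi i).2.
have aE i : As_norm s (st_contraction i u) = (a i)%:E by rewrite /a fineK.
have a0 i : 0 <= a i by rewrite fine_ge0// As_norm_ge0.
have sumaE : (\sum_(i < d) As_norm s (st_contraction i u) = (\sum_(i < d) a i)%:E)%E.
  by rewrite -sumEFin; apply: eq_bigr.
have NA : (N%:R : R) <= \sum_(i < d) (a i / (alpha * eta)) `^ s^-1.
  have lP i : exists l : seq (vt * v1), (size l)%:R <= (a i / (alpha * eta)) `^ s^-1 /\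
      (l2norm (restrict0 (~` [set` l]) (st_contraction i u)) <= (alpha * eta)%:E)%E.
    by have [l h1 h2] := nterm_support hs q0 (afin i); exists l.
  have [l lE] := choice lP.
  apply: (@le_trans _ _ (\sum_(i < d) size (l i))%:R).
    (* The remainder per mode is the distance of [v'] from [u] plus alpha eta; multiplied by [kC] it
       equals the coarsening tolerance exactly. *)
    rewrite ler_nat; apply: (coarsening_index (c := (1 + kP) * (1 + alpha) * eta) arr Nmin).
    - by rewrite !mulr_ge0// ?addr_ge0// ltW.
    - by rewrite le_eqVlt; apply/orP; left; apply/eqP; rewrite -/kC; ring.
    move=> i.
    rewrite (_ : restrict0 _ (st_contraction i v') = fun p =>
      restrict0 (~` [set` l i]) (fun p => st_contraction i v' p - st_contraction i u p) p
      + restrict0 (~` [set` l i]) (st_contraction i u) p); last first.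
      apply/funext => p; rewrite /restrict0 !patchE.
      by case: ifP => _ /=; rewrite ?addr0 ?subrK.
    apply: le_trans (l2normD _ _) _.
    rewrite (_ : _ * eta = (1 + kP * (1 + alpha)) * eta + alpha * eta); last by ring.
    rewrite EFinD; apply: leeD; last exact: (lE i).2.
    have cd := st_contraction_dist i v'l hu2; apply: (le_trans _ (le_trans cd uv')).
    apply: le_l2norm; rewrite sqnorm_restrict0; apply: le_esum_set => // p _.
    by rewrite lee_fin sqr_ge0.
  by rewrite natr_sum; apply: ler_sum => i _; exact: (lE i).1.
have [l [lN lw]] := sum_size_listing (R := R) f N.
have S0 : 0 <= \sum_(i < d) a i by exact: sumr_ge0.
split.
- exact: uw.
- exact: rank_w.
- apply: ge_ereal_sup => _ [n _ <-]; rewrite AE -EFinM.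
  have gn0 : 0 <= g n := ltW (gpos n).
  have C1A0 : 0 <= C1 * A.
    by rewrite mulr_ge0// /C1 addr_ge0// mulr_ge0 ?invr_ge0 ?(ltW halpha)// addr_ge0.
  (* If the ranks are at most n, [w] is its own competitor and the error is zero. Otherwise g(n) eta
     <= A / alpha, which converts the additive error into a multiple of A. *)
  have [rn|gA] := rank_or n.
    by rewrite best_error_eq0 ?mule0 ?lee_fin//; exact: rank_w.
  have wn : (best_error T rep w n <=
      best_error T rep u n + ((1 + kP * (1 + alpha)) * eta)%:E)%E.
    by rewrite wE; exact: best_error_restrict.
  apply: (@le_trans _ _ ((g n)%:E * (best_error T rep u n + ((1 + kP * (1 + alpha)) * eta)%:E))%E).
    by rewrite lee_wpmul2l.
  rewrite ge0_muleDr ?best_error_ge0//; last first.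
    by rewrite lee_fin mulr_ge0// ?(ltW heta)// addr_ge0.
  apply: (@le_trans _ _ (A%:E + (g n * ((1 + kP * (1 + alpha)) * eta))%:E)%E).
    by rewrite EFinM leeD2r// -AE; exact: best_error_le_A.
  rewrite -EFinD lee_fin (_ : C1 * A = alpha^-1 * (1 + kP * (1 + alpha)) * A + A); last first.
    by rewrite /C1 mulrDl mul1r.
  rewrite [leLHS]addrC lerD2r.
  have -> : g n * ((1 + kP * (1 + alpha)) * eta) =
      alpha^-1 * (1 + kP * (1 + alpha)) * (g n * (alpha * eta)).
    by field; exact: lt0r_neq0.
  by rewrite ler_wpM2l// mulr_ge0 ?invr_ge0 ?(ltW halpha)// addr_ge0.
- rewrite sumaE poweR_EFin -EFinM.
  apply: (@le_trans _ _ (\sum_(i < d) ((size (l i))%:R)%:E)%E).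
    by apply: lee_sum => i _; apply: counting_seq; rewrite wE.
  rewrite sumEFin lee_fin -natr_sum.
  apply: (@le_trans _ _ N%:R); first by rewrite ler_nat.
  apply: le_trans NA (le_trans (sum_powR_inv_le hs q0 a0) _).
  have qi0 : 0 <= (alpha * eta)^-1 by rewrite invr_ge0 ltW.
  rewrite (powRM _ S0 qi0) 2!powRN.
  have -> : (alpha * eta)^-1 `^ s^-1 = (alpha `^ s^-1)^-1 * (eta `^ s^-1)^-1.
    rewrite -(powR_inv1 (ltW q0)) -powRrM mulN1r powRN (powRM _ (ltW halpha) (ltW heta)).
    by rewrite invfM.
  have X0 : 0 <= d%:R * ((\sum_(i < d) a i) `^ s^-1 * ((alpha `^ s^-1)^-1 * (eta `^ s^-1)^-1)).
    by rewrite !mulr_ge0// ?invr_ge0 ?powR_ge0.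
  (* The quantity reached is non-negative and half of the claimed bound. *)
  by move: X0; lra.
- rewrite [X in (_ <= _ * X)%E]sumaE -EFinM.
  (* Each contraction of [w] is supported on its list and within C0 eta of that of [u]; this eta
     later cancels the one in the bound on the list lengths. *)
  apply: (@le_trans _ _ (\sum_(i < d) (a i + (size (l i))%:R `^ s * (C0 * eta))%:E)%E).
    apply: lee_sum => i _; rewrite EFinD -aE; apply: As_norm_perturb.
    + exact: ltW.
    + by rewrite mulr_ge0// ltW.
    + by rewrite wE.
    + have cd := st_contraction_dist i wl hu2; apply: (le_trans cd); rewrite l2norm_subC; exact: uw.
  rewrite sumEFin lee_fin big_split/= -mulr_suml.
  have KA : \sum_(i < d) (size (l i))%:R <= \sum_(i < d) (a i / (alpha * eta)) `^ s^-1.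
    by rewrite -natr_sum; apply: le_trans NA; rewrite ler_nat.
  have := sum_powR_max_le hs q0 a0 (fun i => ler0n R (size (l i))) KA.
  set S := \sum_(i < d) a i in S0 *; set D := d%:R `^ _; set X := \sum_(i < d) _ => XD.
  have D0 : 0 <= D by exact: powR_ge0.
  have two_powR (y : R) : 0 <= y -> 1 <= 2 `^ y.
    by move=> y0; rewrite -[leLHS](powRr0 2) ler_powR// ler1n.
  have p1 := two_powR s (ltW hs).
  have p3 : 1 <= 2 `^ (3 * s) by rewrite two_powR// mulr_ge0// ltW.
  have XC : X * (C0 * eta) <= alpha^-1 * C0 * D * S.
    apply: (@le_trans _ _ (D * (S / (alpha * eta)) * (C0 * eta))).
      by rewrite ler_wpM2r// mulr_ge0// ltW.
    rewrite le_eqVlt; apply/orP; left; apply/eqP; field.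
    by rewrite !lt0r_neq0.
  have Y0 : 0 <= alpha^-1 * C0 * D * S by rewrite !mulr_ge0 ?invr_ge0 ?(ltW halpha).
  (* Both coefficients fit into [C2] because powers of 2 with exponent s or 3s are at least 1. *)
  apply: le_trans (lerD (lexx S) XC) _; rewrite /C2 -/D mulrDl; apply: lerD.
    by rewrite ler_peMl//; nra.
  rewrite -!mulrA mulrA -[X in X <= _]mul1r; apply: ler_pM => //.
  by rewrite !mulrA.
Qed.
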